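(* Let $Q$ be a Dynkin quiver, $K$ a field, $X$ a $K$-representation of $Q$ and $w$ a word in vertices of $Q$. Then the condition that $X$ has a filtration of type $w$ only depends on $w$ and the isomorphism class $[X]$, and not on the choice of $X$ or the field $K$. Moreover, $$u_w=\sum_{[X]\in[\mathcal{A}_w]}u_{[X]}\in\mathcal{H}_0(Q).$$
   Context: A Dynkin quiver has underlying graph (a disjoint union of) simply-laced Dynkin diagrams. Over every field, isomorphism classes of finite dimensional representations are parametrised by the functions $\alpha\colon\Delta_+\to\mathbb{N}$ on the set of positive roots (multiplicities of the indecomposables), and $[X]$ denotes this combinatorial class. For a word $w=(i_1,\dots,i_r)$ in vertices, a representation $X$ has a filtration of type $w$ if there is a chain $X=X_0\supset X_1\supset\dots\supset X_r=0$ of subrepresentations with $X_{k-1}/X_k\cong S_{i_k}$, the simple at $i_k$. $\mathcal{A}_w$ is the set of representations having a filtration of type $w$, and $[\mathcal{A}_w]$ the set of their classes. Over finite fields put $F^X_{MN}=\#\{U\le X:U\cong N,X/U\cong M\}$; there are Hall polynomials $f^\gamma_{\alpha\beta}\in\mathbb{Z}[q]$ with $F^{X}_{MN}=f^\gamma_{\alpha\beta}(|K|)$ for all finite fields $K$ and $M,N,X$ of classes $\alpha,\beta,\gamma$. $\mathcal{H}_0(Q)$ is the $\mathbb{Q}$-algebra with basis $u_\alpha$ and product $u_\alpha\diamond u_\beta=\sum_\gamma f^\gamma_{\alpha\beta}(0)u_\gamma$, and $u_w=u_{[S_{i_1}]}\diamond\dots\diamond u_{[S_{i_r}]}$. *)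

(* Defs.v *)
From HB Require Import structures.
From mathcomp Require Import all_boot all_order all_algebra.
From mathcomp Require Import finmap multiset.
From mathcomp Require Import boolp classical_sets fsbigop.
From mathcomp Require Import monalg.

Set Implicit Arguments.
Unset Strict Implicit.
Unset Printing Implicit Defensive.

Import GRing.Theory Num.Theory.
Local Open Scope mset_scope.
Local Open Scope ring_scope.

Record quiver := Quiver {
  vertex : finType;
  arrow : finType;
  src : arrow -> vertex;
  tgt : arrow -> vertex
}.

(* [TypeA n] is A_(n+1), for n >= 0, and [TypeD n] is D_(n+4). *)
Inductive dynkin_type := TypeA of nat | TypeD of nat | TypeE6 | TypeE7 | TypeE8.

Definition dynkin_rank (D : dynkin_type) : nat :=
  match D with
  | TypeA n => n.+1 | TypeD n => n.+4 | TypeE6 => 6 | TypeE7 => 7 | TypeE8 => 8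
  end.

(* The path 0 - 1 - ... - (m-2), with the vertex m-1 attached to b. *)
Definition branch_edge (m b i j : nat) : bool :=
  ((i.+1 == j) && (j < m.-1)%N) || ((i == b) && (j == m.-1)).

Definition dynkin_edge (D : dynkin_type) (i j : nat) : bool :=
  match D with
  | TypeA _ => i.+1 == j
  | TypeD n => branch_edge n.+4 n.+1 i j
  | TypeE6 => branch_edge 6 2 i j
  | TypeE7 => branch_edge 7 2 i j
  | TypeE8 => branch_edge 8 2 i j
  end.

Definition dynkin_adj (D : dynkin_type) (i j : nat) : bool :=
  dynkin_edge D i j || dynkin_edge D j i.

(* Number of edges between x and y in the underlying graph (loops if x = y). *)
Definition nb_edges (Q : quiver) (x y : vertex Q) : nat :=
  #|[set a : arrow Q | ((src a == x) && (tgt a == y))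
                    || ((src a == y) && (tgt a == x))]|.

(* The underlying graph is isomorphic to the disjoint union of the diagrams
   D 0, ..., D (k-1). *)
Definition dynkin (Q : quiver) : Prop :=
  exists (k : nat) (D : 'I_k -> dynkin_type)
         (phi : vertex Q -> {c : 'I_k & 'I_(dynkin_rank (D c))}),
    bijective phi /\
    forall x y : vertex Q,
      nb_edges x y = ((tag (phi x) == tag (phi y)) &&
        dynkin_adj (D (tag (phi x))) (tagged (phi x)) (tagged (phi y))) :> nat.

Section Roots.
Variable Q : quiver.

Definition dim_vector := {ffun vertex Q -> nat}.

Definition tits_form (d : dim_vector) : int :=
  \sum_(i : vertex Q) (d i)%:Z ^+ 2
  - \sum_(a : arrow Q) (d (src a))%:Z * (d (tgt a))%:Z.

(* In the simply laced case the roots are the vectors of the root lattice on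
   which the Tits form takes the value 1. *)
Definition pos_root := {d : dim_vector | tits_form d == 1}.

(* Since a Dynkin quiver has finitely many positive roots, finite multisets of
   positive roots are the same thing as functions from them to nat. *)
Definition rep_class := {mset pos_root}.
HB.instance Definition _ := Choice.on rep_class.

Definition simple_dim (i : vertex Q) : dim_vector := [ffun j => (j == i) : nat].

Lemma dynkin_loopless : dynkin Q -> forall a : arrow Q, src a != tgt a.
Proof.
move=> [k [D [phi [_ edgeP]]]] a; apply/eqP => sta.
have := edgeP (src a) (src a); rewrite eqxx /=.
have -> : dynkin_adj (D (tag (phi (src a))))
            (tagged (phi (src a))) (tagged (phi (src a))) = false.
  rewrite /dynkin_adj orbb; move: (nat_of_ord _) => i.
  have nSi : (i.+1 == i) = false by rewrite eqn_leq ltnn.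
  case: (D _) => [n|n|||] /=; rewrite /branch_edge ?nSi //=;
    by case: eqP => //= ->; rewrite ?eqSS // eqn_leq ltnNge leqnSn andbF.
move=> /eqP; rewrite cards_eq0 => /eqP/setP/(_ a).
by rewrite !inE -sta eqxx.
Qed.

Lemma tits_simple (dQ : dynkin Q) (i : vertex Q) : tits_form (simple_dim i) == 1.
Proof.
rewrite /tits_form (bigD1 i) //= big1 ?addr0 => [|j ji]; last first.
  by rewrite ffunE (negbTE ji) expr0n.
rewrite ffunE eqxx big1 ?subr0 ?expr1n // => a _; rewrite !ffunE.
case: (src a =P i) (dynkin_loopless dQ a) => [->|_ _]; last by rewrite mul0r.
by rewrite eq_sym => /negbTE->; rewrite mulr0.
Qed.

Definition simple_root (dQ : dynkin Q) (i : vertex Q) : pos_root :=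
  exist _ (simple_dim i) (tits_simple dQ i).

End Roots.

Record rep (K : fieldType) (Q : quiver) := Rep {
  rspace :> vertex Q -> vectType K;
  rmap : forall a : arrow Q, 'Hom(rspace (src a), rspace (tgt a))
}.

Section Representations.
Variables (K : fieldType) (Q : quiver).
Implicit Types X Y : rep K Q.

Definition dimvec X : dim_vector Q := [ffun i => \dim {:X i}].

Definition iso X Y : Prop :=
  exists phi : forall i, 'Hom(X i, Y i),
    (forall i, bijective (phi i)) /\
    forall a, (phi (tgt a) \o rmap X a = rmap Y a \o phi (src a))%VF.

(* Families of subspaces; [subrep U] says that the family U is a
   subrepresentation. *)
Definition subfamily X := forall i, {vspace X i}.

Definition subrep X (U : subfamily X) : Prop :=
  forall a, (rmap X a @: U (src a) <= U (tgt a))%VS.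

Definition restr X (U : subfamily X) : rep K Q :=
  @Rep K Q (fun i => subvs_of (U i))
    (fun a => linfun (fun v => vsproj (U (tgt a)) (rmap X a (vsval v)))).

(* The quotient X/U. The space X_i/U_i is realised on the complement of U_i
   provided by the library, the class of v being its projection along U_i. *)
Definition quot X (U : subfamily X) : rep K Q :=
  @Rep K Q (fun i => subvs_of (U i)^C%VS)
    (fun a => linfun (fun v => vsproj (U (tgt a))^C%VS
       (daddv_pi (U (tgt a))^C%VS (U (tgt a)) (rmap X a (vsval v))))).

(* For U <= W: the subfamily U of X seen as a subfamily of W. *)
Definition sub_in X (W U : subfamily X) : subfamily (restr W) :=
  fun i => (linfun (@vsval K (X i) (W i)) @^-1: U i)%VS.

Definition simple_rep (i : vertex Q) : rep K Q :=
  @Rep K Q (fun j => 'rV[K]_(j == i)) (fun a => 0).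

Definition has_filtration (w : seq (vertex Q)) X : Prop :=
  exists F : nat -> subfamily X,
    [/\ forall k, (k <= size w)%N -> subrep (F k),
        forall i, F 0%N i = fullv,
        forall i, F (size w) i = 0%VS,
        forall k, (k < size w)%N -> forall i, (F k.+1 i <= F k i)%VS
      & forall k : 'I_(size w),
          iso (quot (sub_in (F k) (F k.+1))) (simple_rep (tnth (in_tuple w) k))].

Definition indecomposable X : Prop :=
  (exists i, {:X i}%VS != 0%VS) /\
  forall U W : subfamily X, subrep U -> subrep W ->
    (forall i, (U i + W i)%VS = fullv /\ (U i :&: W i)%VS = 0%VS) ->
    (forall i, U i = 0%VS) \/ (forall i, W i = 0%VS).

(* [X] = alpha: X is the direct sum, over the positive roots b, of alpha(b)
   indecomposable subrepresentations of dimension vector b. By Gabriel's theorem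
   there is exactly one indecomposable of dimension vector b, up to isomorphism. *)
Definition has_class X (alpha : rep_class Q) : Prop :=
  exists U : {b : finsupp alpha & 'I_(alpha (val b))} -> subfamily X,
    (forall p, [/\ subrep (U p), indecomposable (restr (U p))
                 & dimvec (restr (U p)) = val (val (tag p))]) /\
    (forall i, directv (\sum_p U p i) /\ (\sum_p U p i)%VS = fullv).

Definition filtered_classes (w : seq (vertex Q)) : set (rep_class Q) :=
  [set alpha | exists X : rep K Q, has_class X alpha /\ has_filtration w X]%classic.

End Representations.

Section FiniteVspace.
Variables (K : finFieldType) (V : vectType K).
HB.instance Definition _ := isCountable.Build {vspace V}
  (pcan_pickleK (can_pcan (@VectorInternalTheory.vs2mxK K V))).
HB.instance Definition _ := isFinite.Build {vspace V}
  (pcan_enumP (can_pcan (@VectorInternalTheory.vs2mxK K V))).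
End FiniteVspace.

(* F^X_{MN} *)
Definition hall_number (K : finFieldType) (Q : quiver) (M N X : rep K Q) : nat :=
  #|[set U : {dffun forall i, {vspace X i}} |
      `[< [/\ subrep (fun i => U i), iso (restr (fun i => U i)) N
            & iso (quot (fun i => U i)) M] >]]|.

(* [f alpha beta gamma] is the Hall polynomial f^gamma_{alpha beta}. As every
   class is realised over every finite field, there is at most one such f. *)
Definition hall_polynomials (Q : quiver)
    (f : rep_class Q -> rep_class Q -> rep_class Q -> {poly int}) : Prop :=
  forall (K : finFieldType) (M N X : rep K Q) (alpha beta gamma : rep_class Q),
    has_class M alpha -> has_class N beta -> has_class X gamma ->
    (hall_number M N X)%:Z = (f alpha beta gamma).[#|K|%:Z].

Section HallAlgebra0.
Variable Q : quiver.

(* The underlying vector space of H_0(Q). *)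
Definition hall0 := {malg rat[rep_class Q]}.

Definition basis0 (alpha : rep_class Q) : hall0 := << alpha >>.

Variable f : rep_class Q -> rep_class Q -> rep_class Q -> {poly int}.

(* If f is the family of Hall polynomials only finitely many terms are nonzero,
   since gamma has to be of dimension vector dim alpha + dim beta. *)
Definition basis_mul0 (alpha beta : rep_class Q) : hall0 :=
  \sum_(gamma \in [set: rep_class Q]%classic)
     (f alpha beta gamma).[0]%:~R *: basis0 gamma.

Definition mul0 (x y : hall0) : hall0 :=
  \sum_(alpha <- msupp x) \sum_(beta <- msupp y)
     (x@_alpha * y@_beta) *: basis_mul0 alpha beta.

(* u_w, bracketed to the right (the product of H_0(Q) is associative); the empty
   word gives the unit, the basis element of the zero representation. *)
Definition word0 (dQ : dynkin Q) (w : seq (vertex Q)) : hall0 :=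
  foldr (fun i x => mul0 (basis0 [mset simple_root dQ i]) x) (basis0 mset0) w.

End HallAlgebra0.

(* Main.v *)
From HB Require Import structures.
Require Import Defs.
From mathcomp Require Import all_boot all_order all_algebra all_field.
From mathcomp Require Import finmap multiset.
From mathcomp Require Import boolp classical_sets cardinality fsbigop.
From mathcomp Require Import monalg.
From mathcomp Require Import ring lra zify.

(** Let [a] be a sink of the quiver.  In a flag of subrepresentations [U_k] of [X] with
    prescribed dimension vectors, the spaces at [a] form a chain of subspaces of [X_a]
    containing the images of the spaces at the neighbours of [a].  Over a field with [q]
    elements the number of such chains is [1] modulo [q] as soon as each image is small
    enough, and [0] otherwise.  By rank-nullity the same bounds say that the kernels of the
    maps to [X_a] are large enough, hence govern the chains at [a] in a flag, of other
    prescribed dimensions, of the reflected representation [S_a^+ X].  So passing to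
    [S_a^+ X] preserves the existence of flags over every field and their number modulo [q]
    over a finite one.  After finitely many reflections a representation of a Dynkin quiver
    becomes zero, and the dimensions met on the way only depend on its class.  Therefore the
    existence of a filtration of type [w] only depends on the class, and the number of
    filtrations is [0] or [1] modulo [q].  The coefficients of [u_w] are integers congruent
    to these numbers modulo every prime, because a Hall polynomial satisfies
    [f(p) = f(0)] modulo [p].  Reflections also give the classification of
    representations that is needed to expand the product of [H_0(Q)]. *)

Set Implicit Arguments.
Unset Strict Implicit.
Unset Printing Implicit Defensive.
Import Order.TTheory GRing.Theory Num.Theory.
Local Open Scope ring_scope.

(** * Vectors of positive roots under sink reflections *)

(** A reflection at a sink is not faithful: it loses the simple summands at that vertex. Recording
    the dimension at the sink before each reflection makes up for the loss. The list of these
    dimensions ([profile]) determines the class, and together with the prescribed dimensions it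
    decides whether a flag exists; since it mentions no field, neither does the answer. The Dynkin
    hypothesis acts mainly through a positive vector [y] with [hat y x < 2 * y x]. It makes the
    quadratic form positive definite and bounds a dimension vector by the value of the form, so that
    enough passes of reflections through an adapted order of the vertices kill every root. No Hall
    polynomial is computed: constant terms are integers, pinned down by congruences modulo all
    primes. The coefficients of [u_w] count the subrepresentations [U] of [X] with quotient [S_i]
    that have a filtration of the remaining type, whereas reflections control flags. A given [U] may
    carry many flags, but their number is 0 or 1 modulo [q] according to whether one exists, so
    counting flags of [X] amounts to counting such [U]. *)

Section QuadraticForm.
Variables (T : finType) (e : rel T) (y : T -> nat).

Definition hat (B : T -> nat) (a : T) : nat := (\sum_(x | e a x) B x)%N.

(** Twice the Tits form, written with the Cartan matrix of the graph; on roots it takes the value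
    2. *)
Definition qform (z : T -> int) : int :=
  \sum_x z x * (2 * z x - \sum_(t | e x t) z t).

Definition qdim (B : {ffun T -> nat}) : int := qform (fun x => (B x)%:Z).

Hypothesis e_sym : symmetric e.
Hypothesis eirr : irreflexive e.
(** The Cartan matrix sends [y] to a vector with positive entries, which certifies that the form is
    positive definite. *)
Hypothesis y_ok : forall x, (hat y x < 2 * y x)%N.

Lemma y_gt0 x : (0 < y x)%N.
Proof. by have := y_ok x; lia. Qed.

(* For adjacent [x] and [t], AM-GM gives
   [2 z x * z t <= z x ^ 2 * y t / y x + z t ^ 2 * y x / y t]. *)
Lemma qform_bound (z : T -> int) x : z x ^+ 2 <= (y x)%:Z * qform z.
Proof.
pose Y t : rat := (y t)%:R; pose Z t : rat := (z t)%:~R.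
have Y0 t : 0 < Y t by rewrite ltr0n y_gt0.
have qE : (qform z)%:~R = \sum_t 2 * Z t ^+ 2 - \sum_t \sum_(u | e t u) Z t * Z u.
  rewrite /qform rmorph_sum /= -sumrB; apply: eq_bigr => t _.
  rewrite rmorphM rmorphB rmorphM /= rmorph_sum /= mulrBr mulr_sumr /Z.
  by congr (_ - _); ring.
have crossS : \sum_t \sum_(u | e t u) (Z t ^+ 2 * Y u / Y t)
            = \sum_t \sum_(u | e t u) (Z u ^+ 2 * Y t / Y u).
  rewrite (exchange_big_dep predT) //=; apply: eq_bigr => t _.
  by apply: eq_bigl => u; rewrite e_sym.
have cross : \sum_t \sum_(u | e t u) Z t * Z u
          <= \sum_t \sum_(u | e t u) (Z t ^+ 2 * Y u / Y t).
  (* Twice the right hand side is symmetrised by [crossS], after which the inequality holds for each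
     ordered pair separately. *)
  rewrite -(ler_pM2l (ltr0n rat 2)) [leRHS]mulr_natl [leRHS]mulr2n {2}crossS.
  rewrite -big_split /= mulr_sumr; apply: ler_sum => t _.
  rewrite -big_split /= mulr_sumr; apply: ler_sum => u _.
  rewrite -subr_ge0.
  have -> : Z t ^+ 2 * Y u / Y t + Z u ^+ 2 * Y t / Y u - 2 * (Z t * Z u)
          = (Z t * Y u - Z u * Y t) ^+ 2 / (Y t * Y u).
    by field; rewrite !gt_eqF ?Y0.
  by rewrite divr_ge0 ?sqr_ge0 // mulr_ge0 // ltW.
(* By integrality [hat y t <= 2 * y t - 1], so every row keeps a surplus of [Z t ^+ 2 / Y t]; the
   surplus at [x] is the claimed bound. *)
have row t : \sum_(u | e t u) (Z t ^+ 2 * Y u / Y t) <= 2 * Z t ^+ 2 - Z t ^+ 2 / Y t.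
  have -> : \sum_(u | e t u) (Z t ^+ 2 * Y u / Y t) = Z t ^+ 2 / Y t * (hat y t)%:R.
    by rewrite /hat natr_sum mulr_sumr; apply: eq_bigr => u _; ring.
  have -> : 2 * Z t ^+ 2 - Z t ^+ 2 / Y t = Z t ^+ 2 / Y t * (2 * Y t - 1).
    by field; rewrite gt_eqF ?Y0.
  apply: ler_wpM2l; first by rewrite divr_ge0 ?sqr_ge0 // ltW.
  have := y_ok t; rewrite -(ltr_nat rat) -addn1 /Y => h.
  have : (hat y t + 1)%:R <= (2 * y t)%:R :> rat by rewrite ler_nat addn1.
  by rewrite natrD natrM; lra.
have main : Z x ^+ 2 / Y x <= (qform z)%:~R.
  rewrite qE (le_trans _ (lerB (lexx _) cross)) //.
  rewrite -sumrB (bigD1 x) //=; have rx := row x.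
  rewrite -[leLHS]addr0; apply: lerD; first by rewrite lerBrDr -lerBrDl.
  apply: sumr_ge0 => t _; rewrite subr_ge0; apply: le_trans (row t) _.
  by rewrite gerDl oppr_le0 divr_ge0 ?sqr_ge0 // ltW.
rewrite -(ler_int rat) rmorphXn rmorphM /= -ler_pdivrMl ?Y0 //.
by rewrite mulrC.
Qed.

Lemma qform_eq0 (z : T -> int) : qform z <= 0 -> forall x, z x = 0.
Proof.
move=> q0 x; have := qform_bound z x; have := y_gt0 x; nia.
Qed.

(** Polarisation. With [c] equal to [hat - 2 * z a] the two correction terms cancel, which is
    invariance under reflection; [c = -1] serves in [root_unit]. *)
Lemma qform_shift (z : T -> int) a (c : int) :
  qform (fun x => z x + c * (x == a)%:R)
  = qform z + 2 * c * (2 * z a - \sum_(t | e a t) z t) + 2 * c ^+ 2.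
Proof.
have hatE x : \sum_(t | e x t) (z t + c * (t == a)%:R)
    = \sum_(t | e x t) z t + c * (e x a)%:R.
  rewrite big_split /= -mulr_sumr; congr (_ + c * _).
  case exa: (e x a); first by rewrite (bigD1 a) //= eqxx big1 ?addr0 // => t /andP[_ /negbTE->].
  by rewrite big1 // => t ext; case: eqP => // ta; rewrite -ta ext in exa.
have -> : qform (fun x => z x + c * (x == a)%:R) =
   \sum_x (z x * (2 * z x - \sum_(t | e x t) z t)
     + (c * (x == a)%:R * (4 * z x - \sum_(t | e x t) z t - c * (e x a)%:R + 2 * c)
       - z x * (c * (e x a)%:R))).
  apply: eq_bigr => x _; rewrite hatE; case: (x == a); rewrite /=; ring.
rewrite big_split -addrA; congr (_ + _); rewrite sumrB.
rewrite [X in X - _](bigD1 a) //= [X in _ + X - _]big1 => [|x xa]; last first.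
  by rewrite (negbTE xa) mulr0 mul0r.
rewrite eqxx eirr.
have -> : \sum_x z x * (c * (e x a)%:R) = c * \sum_(t | e a t) z t.
  rewrite mulr_sumr [RHS]big_mkcond; apply: eq_bigr => x _.
  by rewrite e_sym; case: (e a x); rewrite ?mulr1 ?mulr0 1?mulrC.
by rewrite /=; ring.
Qed.

(** Since [n <= n ^ 2] on naturals the bound becomes linear, and only finitely many dimension
    vectors share a given value of the form. *)
Lemma qdim_bound (B : {ffun T -> nat}) x : (B x <= y x * `|qdim B|)%N.
Proof.
have := qform_bound (fun x => (B x)%:Z) x; rewrite -/(qdim B); have := y_gt0 x.
by case: (B x) => [|n]; nia.
Qed.

Lemma qdim_eq0 (B : {ffun T -> nat}) : qdim B = 0 -> B = [ffun=> 0%N].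
Proof.
by move=> B0; apply/ffunP => x; rewrite ffunE; have := qdim_bound B x; rewrite B0; lia.
Qed.

Lemma qdim0 : qdim [ffun=> 0%N] = 0.
Proof. by rewrite /qdim /qform big1 // => x _; rewrite ffunE mul0r. Qed.

Lemma hatZ (B : {ffun T -> nat}) a : \sum_(t | e a t) (B t)%:Z = (hat B a)%:Z.
Proof. by rewrite -[RHS]natz natr_sum; apply: eq_bigr => t _; rewrite natz. Qed.

(* The truncated subtraction sends [unit_dim a] to [0], as the reflection functor
   at [a] kills the simple representation at [a]. *)
Definition reflect_dim (a : T) (B : {ffun T -> nat}) : {ffun T -> nat} :=
  [ffun x => if x == a then (hat B a - B a)%N else B x].

Definition unit_dim (a : T) : {ffun T -> nat} := [ffun x => (x == a) : nat].

Lemma hat_reflect_dim a (B : {ffun T -> nat}) : hat (reflect_dim a B) a = hat B a.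
Proof.
apply: eq_bigr => x; rewrite ffunE; case: eqP => // ->.
by rewrite eirr.
Qed.

Lemma qdim_reflect a (B : {ffun T -> nat}) : (B a <= hat B a)%N -> qdim (reflect_dim a B) = qdim B.
Proof.
move=> ab; rewrite /qdim.
have -> : qform (fun x => (reflect_dim a B x)%:Z)
   = qform (fun x => (B x)%:Z + ((hat B a)%:Z - 2 * (B a)%:Z) * (x == a)%:R).
  have E x : (reflect_dim a B x)%:Z
      = (B x)%:Z + ((hat B a)%:Z - 2 * (B a)%:Z) * (x == a)%:R.
    by rewrite ffunE; case: eqP => [->|_]; lia.
  by apply: eq_bigr => x _; rewrite E; congr (_ * (_ - _)); apply: eq_bigr.
rewrite qform_shift hatZ; ring.
Qed.

Lemma reflect_dimK a (B : {ffun T -> nat}) : (B a <= hat B a)%N -> reflect_dim a (reflect_dim a B) = B.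
Proof.
move=> ab; apply/ffunP => x; rewrite ffunE hat_reflect_dim !ffunE eqxx.
by case: eqP => // ->; lia.
Qed.

Lemma reflect_dim0 a : reflect_dim a [ffun=> 0%N] = [ffun=> 0%N].
Proof.
apply/ffunP => x; rewrite !ffunE; case: eqP => // _.
by rewrite subn0 /hat big1 // => t _; rewrite ffunE.
Qed.

Lemma qdim_unit a : qdim (unit_dim a) = 2.
Proof.
have -> : qdim (unit_dim a) = qform (fun x => 0 + 1 * (x == a)%:R).
  have E x : (unit_dim a x)%:Z = 0 + 1 * (x == a)%:R by rewrite ffunE; lia.
  by apply: eq_bigr => x _; rewrite E; congr (_ * (_ - _)); apply: eq_bigr.
rewrite qform_shift /qform !big1 //=; lia.
Qed.

(** Subtracting the simple root at [a] brings the form down to at most 0, which forces the zero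
    vector. So the simple root at [a] is the only root on which the subtraction in [reflect_dim]
    truncates. *)
Lemma root_unit a B : qdim B = 2 -> (hat B a < B a)%N -> B = unit_dim a.
Proof.
move=> qB hB; apply/ffunP => x.
have q0 : qform (fun x => (B x)%:Z + (-1) * (x == a)%:R) <= 0.
  by rewrite qform_shift hatZ -/(qdim B) qB; lia.
by have := qform_eq0 q0 x; rewrite ffunE; lia.
Qed.

Lemma reflect_unit a : reflect_dim a (unit_dim a) = [ffun=> 0%N].
Proof.
apply/ffunP => x; rewrite !ffunE eqxx; case: eqP => // _; apply/eqP.
rewrite subn_eq0 /hat big1 // => t eat; rewrite ffunE; case: eqP => // ta.
by rewrite ta eirr in eat.
Qed.

Definition run (vs : seq T) (B : {ffun T -> nat}) := foldl (fun B a => reflect_dim a B) B vs.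

(** No subtraction along the run truncates, so the run is a product of true simple reflections and
    preserves [qdim]. *)
Fixpoint exact_run (vs : seq T) (B : {ffun T -> nat}) : bool :=
  if vs is a :: vs' then (B a <= hat B a)%N && exact_run vs' (reflect_dim a B) else true.

Lemma run_cat vs1 vs2 B : run (vs1 ++ vs2) B = run vs2 (run vs1 B).
Proof. exact: foldl_cat. Qed.

Lemma exact_run_cat vs1 vs2 B :
  exact_run (vs1 ++ vs2) B = exact_run vs1 B && exact_run vs2 (run vs1 B).
Proof. by elim: vs1 B => //= a vs IH B; rewrite IH andbA. Qed.

Lemma run0 vs : run vs [ffun=> 0%N] = [ffun=> 0%N].
Proof. by elim: vs => //= a vs IH; rewrite reflect_dim0. Qed.

Lemma qdim_run vs B : exact_run vs B -> qdim (run vs B) = qdim B.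
Proof.
by elim: vs B => //= a vs IH B /andP[ab /IH->]; rewrite qdim_reflect.
Qed.

Lemma run_notin vs B x : x \notin vs -> run vs B x = B x.
Proof.
elim: vs B => //= a vs IH B; rewrite inE negb_or => /andP[xa /IH->].
by rewrite ffunE (negbTE xa).
Qed.

(** In a run without repetition the value at a vertex changes only at its own turn, so a vector
    fixed by the whole run is fixed at every step. *)
Lemma run_fixed vs B : uniq vs -> (forall x, x \in vs -> run vs B x = B x) ->
  forall a, a \in vs -> reflect_dim a B = B.
Proof.
elim: vs B => //= a vs IH B /andP[avs uvs] fixB.
have Ba : reflect_dim a B = B.
  apply/ffunP => x; case: (eqVneq x a) => [->|xa]; last by rewrite ffunE (negbTE xa).
  by rewrite -(run_notin _ avs) fixB ?mem_head.
move=> t; rewrite inE => /predU1P[->//|]; apply: IH => // x xvs.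
by rewrite -{1}Ba fixB // inE xvs orbT.
Qed.

Definition dim_sum (F : nat -> {ffun T -> nat}) i j : {ffun T -> nat} :=
  [ffun x => (\sum_(i <= k < j) F k x)%N].

(** Truncated subtraction is additive only where it does not truncate, whence the exactness
    hypothesis. *)
Lemma run_dim_sum vs F i j : (forall k, exact_run vs (F k)) ->
  exact_run vs (dim_sum F i j) /\
  run vs (dim_sum F i j) = dim_sum (fun k => run vs (F k)) i j.
Proof.
elim: vs F => //= a vs IH F ex.
have hatS : hat (dim_sum F i j) a = (\sum_(i <= k < j) hat (F k) a)%N.
  by rewrite /hat exchange_big /=; apply: eq_bigr => x _; rewrite ffunE.
have le k : (F k a <= hat (F k) a)%N by have /andP[] := ex k.
have -> : reflect_dim a (dim_sum F i j) = dim_sum (fun k => reflect_dim a (F k)) i j.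
  apply/ffunP => x; rewrite ffunE hatS !ffunE; case: (eqVneq x a) => [->|xa].
    rewrite -sumnB => [|k _]; last exact: le.
    by apply: eq_bigr => k _; rewrite ffunE eqxx.
  by apply: eq_bigr => k _; rewrite ffunE (negbTE xa).
have [|-> ->] := IH (fun k => reflect_dim a (F k)).
  by move=> k; have /andP[] := ex k.
by rewrite hatS ffunE leq_sum.
Qed.

(* Along an infinite exact run the vectors stay in a finite set, so that the
   sum over one period is a fixed vector of all reflections. *)
Lemma exact_run_eq0 p B : uniq p -> (forall x, x \in p) ->
  (forall N, exact_run (flatten (nseq N p)) B) -> B = [ffun=> 0%N].
Proof.
move=> up pT exB.
pose C k := run (flatten (nseq k p)) B.
have flatS k : flatten (nseq k.+1 p) = flatten (nseq k p) ++ p.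
  by elim: k => [|k IH] //=; [rewrite cats0 | rewrite -catA -IH].
have CS k : run p (C k) = C k.+1 by rewrite /C flatS run_cat.
have exC k : exact_run p (C k).
  by have := exB k.+1; rewrite flatS exact_run_cat => /andP[].
have qC k : qdim (C k) = qdim B by rewrite qdim_run.
pose n := (\max_x (y x * `|qdim B|)).+1%N.
have Cn k x : (C k x < n)%N.
  rewrite ltnS (leq_trans (qdim_bound (C k) x)) // qC.
  exact: (leq_bigmax (F := fun x => y x * `|qdim B|)%N).
pose g (k : 'I_(#|{ffun T -> 'I_n}|).+1) : {ffun T -> 'I_n} := [ffun x => Ordinal (Cn k x)].
(* Pigeonhole: the vectors [C k] have entries below [n], so two of them coincide. *)
have [i [j [ij gij]]] : exists i j, (i < j)%N /\ C i = C j.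
  have : ~~ injectiveb g.
    by apply/negP => /injectiveP /leq_card; rewrite [X in (X <= _)%N]card_ord ltnn.
  case/injectivePn => i [j ij gij]; have Cij : C i = C j.
    by apply/ffunP => x; have /ffunP/(_ x) := gij; rewrite !ffunE => /(congr1 val).
  case: (ltngtP i j) => [lij|lji|/val_inj E]; last by rewrite E eqxx in ij.
    by exists (val i), (val j).
  by exists (val j), (val i).
have [_ runS] := run_dim_sum i j exC.
have zfix : run p (dim_sum C i j) = dim_sum C i j.
  rewrite runS; apply/ffunP => x; rewrite !ffunE.
  under eq_bigr => k _ do rewrite CS.
  have recl := big_nat_recl j i (fun k => C k x) (ltnW ij).
  have recr := big_nat_recr j i (fun k => C k x) (ltnW ij).
  by apply: (@addnI (C i x)); rewrite -recl recr /= gij addnC.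
(* A vector fixed by the reflection at [a] either vanishes at [a] or satisfies [hat = 2 * value]
   there; both make the term of the form at [a] zero. *)
have qz : qdim (dim_sum C i j) = 0.
  rewrite /qdim /qform big1 // => a _; rewrite hatZ.
  have /ffunP/(_ a) := run_fixed up (fun x _ => congr1 (fun f : {ffun _} => f x) zfix) (pT a).
  rewrite [LHS]ffunE eqxx => h.
  have [->|h2] := posnP (dim_sum C i j a); first by rewrite mul0r.
  have -> : hat (dim_sum C i j) a = (2 * dim_sum C i j a)%N by lia.
  by rewrite PoszM subrr mulr0.
have Ci0 : C i = [ffun=> 0%N].
  apply/ffunP => x; have /ffunP/(_ x) := qdim_eq0 qz; rewrite !ffunE.
  by rewrite big_ltn // => /eqP; rewrite addn_eq0 => /andP[/eqP].
by apply: qdim_eq0; rewrite -(qC i) Ci0 qdim0.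
Qed.

Lemma not_exact_run p B : uniq p -> (forall x, x \in p) -> B <> [ffun=> 0%N] ->
  exists N, ~~ exact_run (flatten (nseq N p)) B.
Proof.
move=> up pT B0; apply/not_existsP => h; apply: B0.
by apply: (exact_run_eq0 up pT) => N; apply/negPn/negP/h.
Qed.

(** Exactness can only fail at a vertex [a] where the root has become the simple root at [a], and
    the truncated reflection sends that one to 0. *)
Lemma root_run_eq0 vs B : qdim B = 2 -> ~~ exact_run vs B -> run vs B = [ffun=> 0%N].
Proof.
elim: vs B => //= a vs IH B qB; rewrite negb_and -ltnNge; case: (leqP (B a)) => [ab|ba _].
  by apply: IH; rewrite qdim_reflect.
by rewrite (root_unit qB ba) reflect_unit run0.
Qed.

(** Unlike the set of roots, this set is closed under truncated reflections. *)
Definition root0 (B : {ffun T -> nat}) := (qdim B == 2) || (B == [ffun=> 0%N]).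

Lemma root0_reflect a B : root0 B -> root0 (reflect_dim a B).
Proof.
case/orP => /eqP h; last by rewrite /root0 h reflect_dim0 eqxx orbT.
case: (leqP (B a) (hat B a)) => ab; first by rewrite /root0 qdim_reflect // h.
by rewrite (root_unit h ab) /root0 reflect_unit eqxx orbT.
Qed.

Lemma root0_cases a B : root0 B -> (B a <= hat B a)%N \/ B = unit_dim a.
Proof.
case/orP => /eqP h; last by left; rewrite h ffunE.
by case: (leqP (B a) (hat B a)) => ab; [left | right; apply: root_unit].
Qed.

(** A bound uniform in the root and the vertex; it serves to choose one ambient space for a whole
    run. *)
Lemma root0_bound B x : root0 B -> (B x <= 2 * \sum_t y t)%N.
Proof.
move=> /orP[]/eqP h; last by rewrite h ffunE.
have := qdim_bound B x; rewrite h (bigD1 x) //=; lia.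
Qed.

(** When [bs] lists the dimension vectors of the summands of a representation, these are the
    dimensions of the representation and of its successive reflections at the vertex about to be
    reflected. *)
Fixpoint profile (vs : seq T) (bs : seq {ffun T -> nat}) : seq (T * nat) :=
  if vs is a :: vs' then
    (a, \sum_(B <- bs) B a)%N :: profile vs' [seq reflect_dim a B | B <- bs]
  else [::].

(** By induction the reflected lists agree up to zeros. Reflecting back recovers every root except
    the copies of [unit_dim a], and their number is read off from the recorded total at [a]. *)
Lemma profile_inj vs bs cs : all root0 bs -> all root0 cs ->
  all (fun B => run vs B == [ffun=> 0%N]) bs -> all (fun B => run vs B == [ffun=> 0%N]) cs ->
  profile vs bs = profile vs cs ->
  perm_eq [seq B <- bs | B != [ffun=> 0%N]] [seq B <- cs | B != [ffun=> 0%N]].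
Proof.
elim: vs bs cs => [|a vs IH] bs cs Rb Rc /= zb zc.
  have nil ds : all (fun B : {ffun T -> nat} => B == [ffun=> 0%N]) ds ->
      [seq B <- ds | B != [ffun=> 0%N]] = [::].
    by elim: ds => //= B ds IHd /andP[-> /IHd].
  by rewrite !nil.
case=> headE tailE.
(* The vectors that survive the reflection at [a]. *)
pose old (B : {ffun T -> nat}) := (B != [ffun=> 0%N]) && (B != unit_dim a).
have oldP ds : all root0 ds -> [seq reflect_dim a B | B <-
    [seq B <- [seq reflect_dim a B | B <- ds] | B != [ffun=> 0%N]]] = [seq B <- ds | old B].
  elim: ds => //= B ds IHd /andP[RB /IHd {}IHd]; rewrite /old.
  case: (eqVneq B (unit_dim a)) => [->|Bu]; first by rewrite reflect_unit eqxx andbF.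
  case: (root0_cases a RB) => [ab|E]; last by rewrite E eqxx in Bu.
  rewrite andbT; case: (eqVneq B [ffun=> 0%N]) => [->|B0]; first by rewrite reflect_dim0 eqxx.
  case: eqP => [R0|_] /=; last by rewrite IHd reflect_dimK.
  by rewrite -(reflect_dimK ab) R0 reflect_dim0 eqxx in B0.
have Rmap ds : all root0 ds -> all root0 [seq reflect_dim a B | B <- ds].
  by rewrite all_map; apply: sub_all => B; apply: root0_reflect.
have /(perm_map (reflect_dim a)) : perm_eq
    [seq B <- [seq reflect_dim a B | B <- bs] | B != [ffun=> 0%N]]
    [seq B <- [seq reflect_dim a B | B <- cs] | B != [ffun=> 0%N]].
  by apply: IH => //; rewrite ?Rmap // all_map.
rewrite !oldP // => pold.
have uN0 : unit_dim a != [ffun=> 0%N].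
  by apply/eqP => /ffunP/(_ a); rewrite !ffunE eqxx.
have split (ds : seq {ffun T -> nat}) : perm_eq [seq B <- ds | B != [ffun=> 0%N]]
    ([seq B <- ds | old B] ++ nseq (count_mem (unit_dim a) ds) (unit_dim a)).
  elim: ds => //= B ds; rewrite /old => IHd; case: (eqVneq B (unit_dim a)) => [->|Bu].
    rewrite uN0 add1n /=; apply/permP => P; move/permP/(_ P): IHd => /=.
    by rewrite !count_cat /=; lia.
  by rewrite add0n andbT; case: ifP => //= _; rewrite perm_cons.
have sumE (ds : seq {ffun T -> nat}) : (\sum_(B <- ds) B a
     = \sum_(B <- [seq B <- ds | old B]) B a + count_mem (unit_dim a) ds)%N.
  elim: ds => [|B ds IHd]; first by rewrite !big_nil.
  rewrite big_cons IHd /= /old; case: (eqVneq B (unit_dim a)) => [->|Bu] /=.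
    by rewrite andbF ffunE eqxx; lia.
  case: (eqVneq B [ffun=> 0%N]) => [->|B0] /=; first by rewrite ffunE; lia.
  by rewrite big_cons; lia.
(* Each lost copy of [unit_dim a] contributes 1 to the total at [a], and the surviving vectors
   contribute equally on both sides. *)
have cE : count_mem (unit_dim a) bs = count_mem (unit_dim a) cs.
  by have := headE; rewrite (sumE bs) (sumE cs) (perm_big _ pold) => /addnI.
rewrite (perm_trans (split bs)) // cE perm_sym (perm_trans (split cs)) //.
by rewrite perm_cat2r perm_sym.
Qed.

End QuadraticForm.

(** * Linear maps *)

Section LinearMaps.
Variable K : fieldType.
Implicit Types A B C : vectType K.

Definition injective_on A B (h : 'Hom(A, B)) (U : {vspace A}) :=
  forall u, u \in U -> h u = 0 -> u = 0.

Lemma injective_onP A B (h : 'Hom(A, B)) (U : {vspace A}) :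
  injective_on h U <-> (U :&: lker h = 0)%VS.
Proof.
split=> [inj|cap0 u uU hu].
  apply/eqP; rewrite -subv0; apply/subvP => u; rewrite memv_cap memv_ker memv0.
  by case/andP => uU /eqP/(inj u uU)->.
by apply/eqP; rewrite -memv0 -cap0 memv_cap uU memv_ker hu eqxx.
Qed.

Lemma dim_injective_on A B (h : 'Hom(A, B)) (U : {vspace A}) :
  injective_on h U <-> \dim (h @: U) = \dim U.
Proof.
rewrite injective_onP; have := limg_ker_dim h U; split=> [E|E].
  by rewrite E dimv0 in H.
by apply/eqP; rewrite -dimv_eq0; lia.
Qed.

Lemma injective_on_eq A B (h : 'Hom(A, B)) (U : {vspace A}) u v :
  injective_on h U -> u \in U -> v \in U -> h u = h v -> u = v.
Proof.
move=> inj uU vU E; apply/eqP; rewrite -subr_eq0; apply/eqP/inj.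
  by rewrite rpredB.
by rewrite linearB /= E subrr.
Qed.

Lemma exists_injective_on A B (U : {vspace A}) (W : {vspace B}) :
  (\dim U <= \dim W)%N ->
  exists h : 'Hom(A, B), injective_on h U /\ (h @: U <= W)%VS.
Proof.
move=> UW; pose Y := take (\dim U) (vbasis W).
have sY : size Y = \dim U by rewrite size_take size_tuple; case: ltngtP UW.
have fY : free Y.
  have := basis_free (vbasisP W); rewrite -(cat_take_drop (\dim U) (vbasis W)).
  exact: catl_free.
have [f fE] := linear_of_free (vbasis U) Y.
have {}fE : map (linfun f) (vbasis U) = Y.
  have sYU : size Y = size (vbasis U) by rewrite sY size_tuple.
  rewrite -[RHS](fE (basis_free (vbasisP U)) sYU).
  by apply: eq_map => u; rewrite lfunE.
exists (linfun f).
have img : (linfun f @: U = <<Y>>)%VS.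
  by rewrite -{1}(span_basis (vbasisP U)) limg_span fE.
split; last first.
  rewrite img; apply/span_subvP => v /mem_take; exact: vbasis_mem.
apply/dim_injective_on; by rewrite img -sY; apply/eqP.
Qed.

Lemma lfun_factor A B C (f : 'Hom(A, B)) (g : 'Hom(A, C)) (D : {vspace A}) :
  (forall u, u \in D -> f u = 0 -> g u = 0) ->
  exists h : 'Hom(B, C), forall u, u \in D -> h (f u) = g u.
Proof.
(* The preimage chosen by [f1^-1] may lie outside [D]; its projection to [D] has the same image
   under [f], and there [fg] applies. *)
move=> fg; pose f1 := (f \o projv D)%VF.
exists (g \o projv D \o f1^-1)%VF => u uD.
have fuE : f1 u = f u by rewrite !lfunE /= projv_id.
rewrite !lfunE /= !lfunE /=; set u' := projv D _.
have : f u' = f u.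
  rewrite /u' -fuE; have := limg_lfunVK (memv_img f1 (memvf u)).
  by rewrite [f1 (f1^-1%VF _)]lfunE.
move/eqP; rewrite -subr_eq0 -linearB => /eqP fu; apply/eqP.
rewrite -subr_eq0 -linearB /= fg //.
by rewrite rpredB ?memv_proj.
Qed.

(** Carries a subspace of the tuple space [{ffun T -> E}] back into [E], as the reflected space must
    live there. The map is a left inverse on [U] of an embedding of [U]. *)
Lemma exists_onto A B (U : {vspace B}) : (\dim U <= \dim {:A})%N ->
  exists (h : 'Hom(A, B)) (C : {vspace A}), injective_on h C /\ (h @: C = U)%VS.
Proof.
move=> dU; have [g [ginj _]] := exists_injective_on dU.
have [|h hg] := @lfun_factor B A B g \1%VF U.
  by move=> u uU /(ginj u uU)->; rewrite linear0.
have {}hg u : u \in U -> h (g u) = u by move/hg->; rewrite lfunE.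
exists h, (g @: U)%VS; split.
  by move=> _ /memv_imgP[u uU ->]; rewrite hg // => ->; rewrite linear0.
apply/vspaceP => u; apply/memv_imgP/idP => [[_ /memv_imgP[v vU ->] ->]|uU].
  by rewrite hg.
by exists (g u); rewrite ?memv_img // hg.
Qed.

Lemma sum_capv0 A (U W : {vspace A}) u w :
  (U :&: W = 0)%VS -> u \in U -> w \in W -> u + w = 0 -> u = 0 /\ w = 0.
Proof.
move=> cap uU wW /eqP; rewrite addr_eq0 => /eqP uw.
have u0 : u = 0.
  by apply/eqP; rewrite -memv0 -cap memv_cap uU uw rpredN.
by split=> //; apply: oppr_inj; rewrite -uw oppr0.
Qed.

(** The complements of [I] in [V] and of [h1 @: I] in [W] have equal dimension; any injective map
    between them completes [h1]. *)
Lemma extend_injective_on A B (h1 : 'Hom(A, B)) (I V : {vspace A}) (W : {vspace B}) :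
  (I <= V)%VS -> injective_on h1 I -> (h1 @: I <= W)%VS -> \dim V = \dim W ->
  exists h : 'Hom(A, B),
    [/\ forall u, u \in I -> h u = h1 u, injective_on h V & (h @: V = W)%VS].
Proof.
move=> IV inj IW dVW; pose C := (V :\: I)%VS; pose D := (W :\: h1 @: I)%VS.
have dimdiff (A' : vectType K) (V' I' : {vspace A'}) : (I' <= V')%VS ->
    \dim (V' :\: I') = (\dim V' - \dim I')%N.
  move=> s; have := dimv_cap_compl V' I'; rewrite (capv_idPr s); lia.
have dCD : (\dim C <= \dim D)%N.
  by rewrite /C /D !dimdiff // dVW ; have /dim_injective_on-> := inj.
have [k [kinj kD]] := exists_injective_on dCD.
have capC : (C :&: I = 0)%VS := capv_diff V I.
have capI : (I :&: C = 0)%VS by rewrite capvC.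
have capD : (h1 @: I :&: D = 0)%VS by rewrite capvC capv_diff.
have VE : (C + I = V)%VS by rewrite addv_diff; apply/addv_idPl.
pose h : 'Hom(A, B) := (h1 \o daddv_pi I C)%VF + (k \o daddv_pi C I)%VF.
have hE u : h u = h1 (daddv_pi I C u) + k (daddv_pi C I u).
  by rewrite /h add_lfunE !comp_lfunE.
have hI u : u \in I -> h u = h1 u.
  move=> uI; rewrite hE daddv_pi_id //.
  have := daddv_pi_add capI (subvP (addvSl _ C) u uI).
  by rewrite daddv_pi_id // => /(canRL (addKr _)); rewrite addNr => ->; rewrite linear0 addr0.
have hinj : injective_on h V.
  move=> u uV; rewrite hE => /(sum_capv0 capD)[].
  - by rewrite memv_img ?memv_pi.
  - by apply: (subvP kD); rewrite memv_img ?memv_pi.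
  move=> /inj -/(_ (memv_pi _ _ _)) E1 /kinj -/(_ (memv_pi _ _ _)) E2.
  have uIC : u \in (I + C)%VS by rewrite addvC VE.
  by rewrite -(daddv_pi_add capI uIC) E1 E2 addr0.
exists h; split=> //; apply/eqP; rewrite eqEdim; apply/andP; split.
  apply/subvP => _ /memv_imgP[u uV ->]; rewrite hE rpredD //.
    by apply: (subvP IW); rewrite memv_img ?memv_pi.
  by apply: (subvP (diffvSl W (h1 @: I))); apply: (subvP kD); rewrite memv_img ?memv_pi.
by have /dim_injective_on-> := hinj; rewrite dVW.
Qed.

End LinearMaps.

(** * Direct sums of subspaces of [E], inside a space of tuples *)

Section TupleSpace.
Variables (K : fieldType) (E : vectType K) (T : finType).
Implicit Types (P : pred T) (U : T -> {vspace E}) (g : T -> 'End(E)).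

Definition inj_at_fun (x : T) (v : E) : {ffun T -> E} := [ffun z => if z == x then v else 0].

Fact inj_at_linear x : linear (inj_at_fun x).
Proof.
move=> c u v; apply/ffunP => z; rewrite !ffunE; case: (z == x) => //.
by rewrite scaler0 addr0.
Qed.

HB.instance Definition _ x :=
  GRing.isLinear.Build K E {ffun T -> E} _ (inj_at_fun x) (inj_at_linear x).

Definition proj_at_fun (x : T) (u : {ffun T -> E}) : E := u x.

Fact proj_at_linear x : linear (proj_at_fun x).
Proof. by move=> c u v; rewrite /proj_at_fun !ffunE. Qed.

HB.instance Definition _ x :=
  GRing.isLinear.Build K {ffun T -> E} E _ (proj_at_fun x) (proj_at_linear x).

Definition inj_at x : 'Hom(E, {ffun T -> E}) := linfun (inj_at_fun x).
Definition proj_at x : 'Hom({ffun T -> E}, E) := linfun (proj_at_fun x).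

Lemma inj_atE x v z : inj_at x v z = if z == x then v else 0.
Proof. by rewrite lfunE /= ffunE. Qed.

Lemma proj_atE x u : proj_at x u = u x.
Proof. by rewrite lfunE. Qed.

Lemma sum_inj_at P (u : T -> E) z :
  (\sum_(x | P x) inj_at x (u x)) z = if P z then u z else 0.
Proof.
rewrite sum_ffunE; under eq_bigr => x _ do rewrite inj_atE.
case: ifP => Pz.
  by rewrite (bigD1 z) //= eqxx big1 ?addr0 // => x /andP[_]; rewrite eq_sym => /negbTE->.
by rewrite big1 // => x Px; case: eqP => // zx; rewrite zx Px in Pz.
Qed.

(** The external direct sum of the [U x] for [x] in [P]; sums of images become images of this one
    space under one map. *)
Definition famspace P U : {vspace {ffun T -> E}} := (\sum_(x | P x) inj_at x @: U x)%VS.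

Lemma memv_famspace P U u :
  u \in famspace P U <-> (forall x, P x -> u x \in U x) /\ (forall x, ~~ P x -> u x = 0).
Proof.
split=> [/memv_sumP[us usU ->]|[uU u0]].
  have /fin_all_exists[w wP] x : exists w, P x -> w \in U x /\ us x = inj_at x w.
    case: (boolP (P x)) => [Px|]; last by exists 0.
    by have /memv_imgP[w wU ->] := usU x Px; exists w.
  have -> : \sum_(x | P x) us x = \sum_(x | P x) inj_at x (w x).
    by apply: eq_bigr => x /wP[].
  split=> x; rewrite sum_inj_at; last by move/negbTE->.
  by move=> Px; rewrite Px; have [] := wP x Px.
have -> : u = \sum_(x | P x) inj_at x (u x).
  by apply/ffunP => x; rewrite sum_inj_at; case: ifP => // /negbT/u0.
by apply/memv_sumP; exists (fun x => inj_at x (u x)) => // x Px; rewrite memv_img ?uU.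
Qed.

Lemma inj_at_inj x U : injective_on (inj_at x) (U x).
Proof. by move=> v _ /ffunP/(_ x); rewrite inj_atE eqxx ffunE. Qed.

Lemma dim_famspace P U : \dim (famspace P U) = (\sum_(x | P x) \dim (U x))%N.
Proof.
transitivity (\sum_(x | P x) \dim (inj_at x @: U x))%N; last first.
  by apply: eq_bigr => x _; apply/dim_injective_on/inj_at_inj.
apply/eqP; rewrite -[_ == _]/(directv _); apply/directv_sum_independent => us usU us0 x Px.
have /memv_imgP[w wU uxE] := usU x Px; rewrite uxE; suff -> : w = 0 by rewrite linear0.
have /ffunP/(_ x) := us0; rewrite sum_ffunE ffunE (bigD1 x) //= uxE inj_atE eqxx.
rewrite big1 ?addr0 // => z /andP[Pz zx]; have /memv_imgP[v _ ->] := usU z Pz.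
by rewrite inj_atE eq_sym (negbTE zx).
Qed.

Definition sum_map P g : 'Hom({ffun T -> E}, E) := \sum_(x | P x) (g x \o proj_at x)%VF.

Lemma sum_mapE P g u : sum_map P g u = \sum_(x | P x) g x (u x).
Proof. by rewrite sum_lfunE; apply: eq_bigr => x _; rewrite comp_lfunE proj_atE. Qed.

Lemma limg_sum_map P g U : (sum_map P g @: famspace P U = \sum_(x | P x) g x @: U x)%VS.
Proof.
apply/vspaceP => v; apply/memv_imgP/memv_sumP => [[u /memv_famspace[uU _] ->]|[vs vsU ->]].
  by exists (fun x => g x (u x)); rewrite ?sum_mapE // => x Px; rewrite memv_img ?uU.
have /fin_all_exists[w wP] x : exists w, P x -> w \in U x /\ vs x = g x w.
  case: (boolP (P x)) => [Px|]; last by exists 0.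
  by have /memv_imgP[w wU ->] := vsU x Px; exists w.
exists [ffun x => if P x then w x else 0].
  apply/memv_famspace; split=> x; rewrite ffunE; last by move/negbTE->.
  by move=> Px; rewrite Px; have [] := wP x Px.
by rewrite sum_mapE; apply: eq_bigr => x Px; rewrite ffunE Px; have [] := wP x Px.
Qed.

Definition tuple_map P g : 'Hom(E, {ffun T -> E}) := \sum_(x | P x) (inj_at x \o g x)%VF.

Lemma tuple_mapE P g v x : tuple_map P g v x = if P x then g x v else 0.
Proof.
rewrite sum_lfunE; under eq_bigr => z _ do rewrite comp_lfunE.
exact: (sum_inj_at P (fun z => g z v)).
Qed.

End TupleSpace.

(** * Representations inside one vector space and their reflections *)

Section Orientation.
Variables (T : finType) (e : rel T).
Hypothesis e_sym : symmetric e.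
Hypothesis eirr : irreflexive e.

(* The arrows of the orientation of [e] in which they go from later to earlier
   vertices of the list [p]. *)
Definition arr (p : seq T) : rel T := fun x y => e x y && (index y p < index x p)%N.

(** The vertex [a] is a sink of [r], and [r'] arises by reversing all arrows at [a]. *)
Definition sink_flip (a : T) (r r' : rel T) :=
  [/\ forall x y, x != a -> y != a -> r' x y = r x y,
      forall x, r x a = e a x, forall x, r a x = false,
      forall x, r' a x = e a x & forall x, r' x a = false].

(** Arrows go from later to earlier entries, so the head of the list is a sink; moving it to the end
    makes it a source and leaves the other arrows alone. *)
Lemma arr_flip a p : uniq (a :: p) -> (forall x, x \in a :: p) ->
  sink_flip a (arr (a :: p)) (arr (rcons p a)).
Proof.
rewrite cons_uniq => /andP[ap up] allp.
have inp x : x != a -> x \in p by have := allp x; rewrite inE; case: eqP.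
have idx x : x != a -> index x (rcons p a) = index x p.
  by move=> xa; rewrite -cats1 index_cat inp.
have idxa : index a (rcons p a) = size p.
  by rewrite -cats1 index_cat (negbTE ap) /= eqxx addn0.
split=> [x y xa ya|x|x|x|x]; rewrite /arr /=.
- by rewrite !idx // ![a == _]eq_sym (negbTE xa) (negbTE ya).
- by rewrite eqxx e_sym; case: eqP => [<-|]; rewrite ?eirr // andbT.
- by rewrite eqxx; case: eqP => [<-|]; rewrite andbF.
- case: (eqVneq x a) => [->|xa]; first by rewrite eirr.
  by rewrite idxa idx // index_mem inp // andbT.
- case: (eqVneq x a) => [->|xa]; first by rewrite eirr.
  by rewrite idxa idx // ltnNge index_size andbF.
Qed.

End Orientation.

Section Systems.
Variables (K : fieldType) (E : vectType K) (T : finType) (e : rel T).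
Hypothesis eirr : irreflexive e.
Implicit Types (f g : T -> T -> 'End(E)) (U V W : T -> {vspace E}) (r : rel T) (a : T).

(* A representation is encoded by subspaces [V x] of a single space [E] and
   endomorphisms [f x y] of [E], so that a reflection does not change any type. *)
Definition stable r f V : bool := [forall x, forall y, r x y ==> (f x y @: V x <= V y)%VS].

Lemma stableP r f V :
  reflect (forall x y, r x y -> forall v, v \in V x -> f x y v \in V y) (stable r f V).
Proof.
apply: (iffP 'forall_'forall_implyP) => [st x y rxy v vV|st x y rxy].
  by apply: (subvP (st x y rxy)); rewrite memv_img.
by apply/subvP => _ /memv_imgP[v vV ->]; apply: st.
Qed.

Definition incoming a f V : {vspace E} := (\sum_(x | e a x) f x a @: V x)%VS.

Lemma memv_incoming a f V v : v \in incoming a f V <->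
  exists u, (forall x, e a x -> u x \in V x) /\ v = \sum_(x | e a x) f x a (u x).
Proof.
rewrite /incoming -(limg_sum_map (e a) (f^~ a)); split=> [/memv_imgP[u /memv_famspace[uV _] ->]|[u [uV ->]]].
  by exists u; rewrite sum_mapE.
apply/memv_imgP; exists [ffun x => if e a x then u x else 0].
  apply/memv_famspace; split=> x; rewrite ffunE; last by move/negbTE->.
  by move=> eax; rewrite eax uV.
by rewrite sum_mapE; apply: eq_bigr => x eax; rewrite ffunE eax.
Qed.

(* [0 -> C -> (+)_(x adjacent to a) V x -> V a] is exact: the map [f'] out of [a]
   is that of the reflected representation at the sink [a], whose space is [C]. *)
Record reflection a f V f' (C : {vspace E}) : Prop := Reflection {
  reflection_off : forall x y, x != a -> y != a -> f' x y = f x y;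
  reflection_in : forall v, v \in C -> forall x, e a x -> f' a x v \in V x;
  reflection_inj : forall v, v \in C -> (forall x, e a x -> f' a x v = 0) -> v = 0;
  reflection_ker : forall v, v \in C -> \sum_(x | e a x) f x a (f' a x v) = 0;
  reflection_sur : forall u : T -> E, (forall x, e a x -> u x \in V x) ->
    \sum_(x | e a x) f x a (u x) = 0 ->
    exists2 v, v \in C & forall x, e a x -> f' a x v = u x }.

(** The reflection of a subrepresentation [U], placed inside the reflection of the whole: at [a] it
    is the kernel [C] intersected with the direct sum of the [U x]. *)
Definition reflected a (C : {vspace E}) f' U : T -> {vspace E} := fun x =>
  if x == a then (C :&: \bigcap_(z | e a z) (f' a z @^-1: U z))%VS else U x.

Lemma memv_reflected a C f' U v :
  v \in reflected a C f' U a <-> v \in C /\ forall x, e a x -> f' a x v \in U x.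
Proof.
rewrite /reflected eqxx memv_cap; split=> [/andP[vC vU]|[vC vU]]; last first.
  rewrite vC memvE; apply/subv_bigcapP => x eax.
  by rewrite -memvE -memv_preim vU.
split=> // x eax; rewrite memv_preim; move: vU.
by rewrite !memvE => /subv_bigcapP/(_ x eax).
Qed.

Lemma reflectedE a C f' U x : x != a -> reflected a C f' U x = U x.
Proof. by rewrite /reflected => /negbTE->. Qed.

Lemma adj_neq a x : e a x -> x != a.
Proof. by apply: contraTneq => ->; rewrite eirr. Qed.

Section Reflection.
Variables (a : T) (f : T -> T -> 'End(E)) (V : T -> {vspace E}).
Variables (f' : T -> T -> 'End(E)) (C : {vspace E}).
Hypothesis H : reflection a f V f' C.

Lemma reflected_full : reflected a C f' V a = C.
Proof.
apply/vspaceP => v; apply/idP/idP => [/memv_reflected[]//|vC].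
by apply/memv_reflected; split=> //; apply: (reflection_in H vC).
Qed.

(** The same [f'] reflects all subfamilies of [V] at once, so that flags and decompositions can be
    reflected without changing the maps. *)
Lemma reflection_sub U : (forall x, e a x -> (U x <= V x)%VS) ->
  reflection a f U f' (reflected a C f' U a).
Proof.
move=> UV; split.
- exact: reflection_off H.
- by move=> v /memv_reflected[].
- by move=> v /memv_reflected[vC _]; apply: (reflection_inj H vC).
- by move=> v /memv_reflected[vC _]; apply: (reflection_ker H vC).
- move=> u uU u0; have [|v vC vE] := reflection_sur H _ u0.
    by move=> x eax; apply: (subvP (UV x eax)); apply: uU.
  exists v => //; apply/memv_reflected; split=> // x eax.
  by rewrite vE // uU.
Qed.

(** Rank-nullity for the map from the direct sum of the [U x] to [E], whose kernel is identified
    with the reflected space by the tuple of the maps [f' a x]. *)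
Lemma dim_reflected U : (forall x, e a x -> (U x <= V x)%VS) ->
  (\dim (reflected a C f' U a) + \dim (incoming a f U) = \sum_(x | e a x) \dim (U x))%N.
Proof.
move=> /reflection_sub H'; set R := reflected _ _ _ _ _ in H' *.
pose Phi := sum_map (e a) (f^~ a); pose Psi := tuple_map (e a) (f' a).
rewrite -dim_famspace -(limg_ker_dim Phi) limg_sum_map; congr (_ + _)%N.
have PsiE v x : e a x -> Psi v x = f' a x v by rewrite tuple_mapE => ->.
have <- : \dim (Psi @: R) = \dim R.
  apply/dim_injective_on => v vR Pv0; apply: (reflection_inj H' vR) => x eax.
  by rewrite -PsiE // Pv0 ffunE.
congr (\dim _); apply/vspaceP => u; rewrite memv_cap memv_ker sum_mapE.
apply/memv_imgP/andP => [[v vR ->]|[/memv_famspace[uU u0] /eqP Pu0]].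
  split.
    apply/memv_famspace; split=> x; last by rewrite tuple_mapE => /negbTE->.
    by move=> eax; rewrite PsiE //; apply: (reflection_in H' vR).
  apply/eqP; rewrite -[RHS](reflection_ker H' vR); apply: eq_bigr => x eax.
  by rewrite PsiE.
have [v vR vE] := reflection_sur H' uU Pu0; exists v => //.
apply/ffunP => x; rewrite tuple_mapE; case: ifP => [/vE//|/negbT/u0//].
Qed.

Lemma stable_reflected r r' U : sink_flip e a r r' -> stable r f U ->
  stable r' f' (reflected a C f' U).
Proof.
move=> [off _ _ ra rna] /stableP st; apply/stableP => x y.
case: (eqVneq y a) => [->|ya]; first by rewrite rna.
case: (eqVneq x a) => [->|xa].
  by rewrite ra => eay v /memv_reflected[_ /(_ y eay)]; rewrite reflectedE.
by rewrite off // !reflectedE // (reflection_off H) //; apply: st.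
Qed.

(** The kernel of a direct sum of maps is the direct sum of the kernels. *)
Lemma direct_reflected (I : finType) (W : I -> T -> {vspace E}) :
  (forall i x, e a x -> (f x a @: W i x <= W i a)%VS) ->
  (forall x, directv (\sum_i W i x)%VS) -> (forall x, (\sum_i W i x)%VS = V x) ->
  forall x, directv (\sum_i reflected a C f' (W i) x)%VS /\
    (\sum_i reflected a C f' (W i) x)%VS = reflected a C f' V x.
Proof.
move=> stW dirW sumW x; case: (eqVneq x a) => [->|xa]; last first.
  by rewrite /reflected (negbTE xa).
split.
  apply/directv_sum_independent => us usR us0 i _.
  have /memv_reflected[usC _] := usR i isT.
  apply: (reflection_inj H usC) => z eaz.
  have /directv_sum_independent dir := dirW z.
  apply: (dir (fun i => f' a z (us i))) => //.
    by move=> j _; have /memv_reflected[_] := usR j isT; apply.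
  by rewrite -linear_sum us0 linear0.
apply/vspaceP => v; rewrite reflected_full; apply/memv_sumP/idP => [[us usR ->]|vC].
  by apply: rpred_sum => i _; have /memv_reflected[] := usR i isT.
have /fin_all_exists[us usP] z : exists us : I -> E, e a z ->
    (forall i, us i \in W i z) /\ f' a z v = \sum_i us i.
  case: (boolP (e a z)) => [eaz|]; last by exists (fun _ => 0).
  have := reflection_in H vC eaz; rewrite -sumW => /memv_sumP[us usW ->].
  by exists us => _; split=> // i; apply: usW.
(* The [i]-th sum lies in [W i a]; these sums add up to 0 and the spaces [W i a] are independent. *)
have us0 i : \sum_(z | e a z) f z a (us z i) = 0.
  have /directv_sum_independent dir := dirW a.
  apply: (dir (fun i => \sum_(z | e a z) f z a (us z i))) => // [j _|].
    apply: rpred_sum => z eaz; apply: (subvP (stW j z eaz)).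
    by rewrite memv_img //; have [] := usP z eaz.
  rewrite exchange_big /= -[RHS](reflection_ker H vC); apply: eq_bigr => z eaz.
  by have [_ ->] := usP z eaz; rewrite linear_sum.
have /fin_all_exists[vs vsP] i : exists v, v \in C /\ forall z, e a z -> f' a z v = us z i.
  have [|w wC wE] := reflection_sur H _ (us0 i); last by exists w.
  by move=> z eaz; rewrite -sumW; have [usW _] := usP z eaz; apply: (subvP (sumv_sup i _ _)).
exists vs.
  move=> i _; have [vsC vsE] := vsP i; apply/memv_reflected; split=> // z eaz.
  by rewrite vsE //; have [usW _] := usP z eaz.
apply/eqP; rewrite -subr_eq0; apply/eqP/(reflection_inj H).
  by rewrite rpredB // rpred_sum // => i _; have [] := vsP i.
move=> z eaz; rewrite linearB linear_sum /=; have [_ ->] := usP z eaz.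
by rewrite -sumrB big1 // => i _; have [_ ->] := vsP i; rewrite // subrr.
Qed.

End Reflection.

Definition decomposed r f V (I : finType) (W : I -> T -> {vspace E}) :=
  [/\ forall i, stable r f (W i), forall x, directv (\sum_i W i x)%VS &
      forall x, (\sum_i W i x)%VS = V x].

Lemma decomposed_reflected a r r' f V f' C (I : finType) (W : I -> T -> {vspace E}) :
  sink_flip e a r r' -> reflection a f V f' C -> decomposed r f V W ->
  decomposed r' f' (reflected a C f' V) (fun i => reflected a C f' (W i)).
Proof.
move=> fl H [stW dirW sumW]; have [_ ra _ _ _] := fl.
have dr x := direct_reflected H (fun i x eax =>
  implyP (forallP (forallP (stW i) x) a) (etrans (ra x) eax)) dirW sumW x.
split=> [i|x|x]; first exact: (stable_reflected H fl (stW i)).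
  by have [] := dr x.
by have [] := dr x.
Qed.

Lemma decomposed_pair r f V U1 U2 :
  decomposed r f V (fun b : bool => if b then U1 else U2) <->
  [/\ stable r f U1, stable r f U2 &
      forall x, (U1 x + U2 x = V x)%VS /\ (U1 x :&: U2 x = 0)%VS].
Proof.
split=> [[st dir sumV]|[st1 st2 UV]].
  split; [exact: (st true) | exact: (st false) |] => x.
  have := sumV x; rewrite big_bool /= => ->; split=> //.
  by have /directv_sumP/(_ true isT) := dir x; rewrite (big_pred1 false); last by case.
split=> [[]|x|x] //; last by rewrite big_bool; have [] := UV x.
apply/directv_sumP => b _; have [_ cap] := UV x.
by case: b; [rewrite (big_pred1 false) | rewrite (big_pred1 true) 1?capvC]; rewrite //; case.
Qed.

Definition zero_family V := forall x, V x = 0%VS.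

(* Indecomposable or zero. *)
Definition indec r f V := forall U1 U2, stable r f U1 -> stable r f U2 ->
  (forall x, (U1 x + U2 x = V x)%VS /\ (U1 x :&: U2 x = 0)%VS) ->
  zero_family U1 \/ zero_family U2.


Lemma incoming_stable a r r' f V : sink_flip e a r r' -> stable r f V ->
  (incoming a f V <= V a)%VS.
Proof.
move=> [_ ra _ _ _] /stableP st; apply/subvP => v /memv_incoming[u [uV ->]].
by apply: rpred_sum => x eax; apply: st; rewrite ?ra // uV.
Qed.

Lemma eq_incoming a f V W : (forall x, x != a -> V x = W x) -> incoming a f V = incoming a f W.
Proof. by move=> VW; apply: eq_bigr => x /adj_neq/VW->. Qed.

(** A decomposition of the reflection lifts to one of [V]: keep the spaces away from [a] and put at
    [a] the images of their neighbours. Surjectivity onto [V a] makes these images fill [V a]. *)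
Lemma indec_reflected a r r' f V f' C : sink_flip e a r r' -> reflection a f V f' C ->
  incoming a f V = V a -> indec r f V -> indec r' f' (reflected a C f' V).
Proof.
move=> fl H onto indV U1 U2 st1 st2 UV; have [off ra rna r'a r'na] := fl.
pose up U : T -> {vspace E} := fun x => if x == a then incoming a f U else U x.
have stup U : stable r' f' U -> stable r f (up U).
  move=> /stableP st; apply/stableP => x y; case: (eqVneq x a) => [->|xa].
    by rewrite rna.
  case: (eqVneq y a) => [->|ya].
    rewrite ra /up eqxx (negbTE xa) => eax v vU; apply: (subvP (sumv_sup x _ (subvv _))) => //.
    by rewrite memv_img.
  by rewrite -off // /up (negbTE xa) (negbTE ya) -(reflection_off H) //; apply: st.
have upz U : (U a <= C)%VS -> stable r' f' U -> zero_family (up U) -> zero_family U.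
  move=> UC /stableP st z x; have zU t : t != a -> U t = 0%VS.
    by move=> ta; have := z t; rewrite /up (negbTE ta).
  case: (eqVneq x a) => [->|xa]; last exact: zU.
  apply/eqP; rewrite -subv0; apply/subvP => v vU; rewrite memv0; apply/eqP.
  apply: (reflection_inj H (subvP UC v vU)) => t eat; apply/eqP.
  by rewrite -memv0 -(zU t (adj_neq eat)); apply: st; rewrite ?r'a.
have [UVa capa] := UV a; rewrite (reflected_full H) in UVa.
have [|z|z] := indV _ _ (stup _ st1) (stup _ st2); last 2 first.
- by left; apply: upz => //; rewrite -UVa addvSl.
- by right; apply: upz => //; rewrite -UVa addvSr.
move=> x; case: (eqVneq x a) => [->|xa]; last first.
  by rewrite /up (negbTE xa); have := UV x; rewrite reflectedE.
rewrite /up eqxx; split.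
  rewrite -onto /incoming -big_split /=; apply: eq_bigr => t eat.
  by rewrite -limgD; have [-> _] := UV t; rewrite reflectedE ?adj_neq.
apply/eqP; rewrite -subv0; apply/subvP => w; rewrite memv_cap => /andP[].
move=> /memv_incoming[u1 [u1U ->]] /memv_incoming[u2 [u2U u12]].
(* A vector of both images, written as the sums of [u1] and of [u2], puts [u1 - u2] in the kernel.
   Splitting the kernel element as [v1 + v2] and comparing components shows that [u1] comes from
   [v1], so its sum is 0. *)
have [||v vC vE] := reflection_sur H (u := fun t => u1 t - u2 t).
- move=> t eat; have <- : (U1 t + U2 t = V t)%VS.
    by have [-> _] := UV t; rewrite reflectedE ?adj_neq.
  by rewrite memv_add ?rpredN ?u1U ?u2U.
- under eq_bigr => t _ do rewrite linearB /=.
  by rewrite sumrB u12 subrr.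
move: vC; rewrite -UVa => /memv_addP[v1 v1U [v2 v2U vD]].
have u1E t : e a t -> u1 t = f' a t v1.
  move=> eat; have := vE t eat; rewrite vD linearD /= => vDE; have [_ capt] := UV t.
  have [|||/eqP E1 _] := @sum_capv0 _ _ _ _ (f' a t v1 - u1 t) (f' a t v2 + u2 t) capt.
  - by rewrite rpredB ?u1U //; apply: (stableP _ _ _ st1); rewrite ?r'a.
  - by rewrite rpredD ?u2U //; apply: (stableP _ _ _ st2); rewrite ?r'a.
  - by rewrite addrACA vDE [- u1 t + _]addrC subrKA subrr.
  by move: E1; rewrite subr_eq0 => /eqP.
rewrite memv0; apply/eqP.
have v1C : v1 \in C by rewrite -UVa; apply: (subvP (addvSl _ _)).
rewrite -[RHS](reflection_ker H v1C); apply: eq_bigr => t eat.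
by rewrite u1E.
Qed.

(** A decomposition of [V] reflects to a decomposition of the reflection, so only a part whose
    reflection vanishes has to be ruled out. *)
Lemma indec_of_reflected a r r' f V f' C : sink_flip e a r r' -> reflection a f V f' C ->
  incoming a f V = V a -> indec r' f' (reflected a C f' V) -> indec r f V.
Proof.
move=> fl H onto indV U1 U2 st1 st2 UV; have [off ra rna r'a r'na] := fl.
have := decomposed_reflected fl H (proj2 (decomposed_pair r f V U1 U2) (And3 st1 st2 UV)).
rewrite (_ : (fun i : bool => _) =
    (fun i : bool => if i then reflected a C f' U1 else reflected a C f' U2)); last first.
  by apply: funext; case.
move=> /decomposed_pair[st1' st2' UV'].
(* Such a part [A] is concentrated at [a], where [V a] is spanned by images coming from [B] alone;
   so [A a] lies in [B a] and is zero. *)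
have down A B : stable r f A -> stable r f B -> (forall x, (A x + B x = V x)%VS /\ (A x :&: B x = 0)%VS) ->
    zero_family (reflected a C f' A) -> zero_family A.
  move=> stA /stableP stB AB z; have zA x : x != a -> A x = 0%VS.
    by move=> xa; have := z x; rewrite reflectedE.
  move=> x; case: (eqVneq x a) => [->|]; last exact: zA.
  have [ABa <-] := AB a; apply/esym/capv_idPl; apply/subvP => v vA.
  have : v \in V a by rewrite -ABa; apply: (subvP (addvSl _ _)).
  rewrite -onto => /memv_incoming[u [uV ->]]; apply: rpred_sum => t eat.
  apply: stB; rewrite ?ra //.
  by move: (uV t eat); have [<- _] := AB t; rewrite zA ?adj_neq // add0v.
case: (indV _ _ st1' st2' UV') => z; [left | right].
  exact: down st1 st2 UV z.
by apply: down st2 st1 _ z => x; rewrite addvC capvC.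
Qed.

(** A complement of the image at a sink splits off as a summand concentrated there, so it is the
    whole indecomposable. *)
Lemma indec_not_onto a r r' f V : sink_flip e a r r' -> stable r f V -> indec r f V ->
  incoming a f V != V a -> forall x, x != a -> V x = 0%VS.
Proof.
move=> fl stV indV nonto; have [off ra rna r'a r'na] := fl.
pose U1 x := if x == a then incoming a f V else V x.
pose U2 x := if x == a then (V a :\: incoming a f V)%VS else 0%VS.
have inc := incoming_stable fl stV.
have [|||z|z] := indV U1 U2.
- apply/stableP => x y rxy v; rewrite /U1.
  case: (eqVneq x a) rxy => [->|xa] rxy; first by rewrite rna in rxy.
  case: (eqVneq y a) rxy => [->|ya] rxy; last exact: (stableP _ _ _ stV).
  by move=> vV; apply: (subvP (sumv_sup x _ (subvv _))); rewrite -?ra // memv_img.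
- apply/stableP => x y rxy v; rewrite /U2.
  case: (eqVneq x a) rxy => [->|xa] rxy; first by rewrite rna in rxy.
  by rewrite memv0 => /eqP->; rewrite linear0 mem0v.
- move=> x; rewrite /U1 /U2; case: eqP => [->|_]; last by rewrite addv0 capv0.
  split; last by rewrite capvC capv_diff.
  by rewrite addvC addv_diff; apply/addv_idPl.
- by move=> x xa; have := z x; rewrite /U1 (negbTE xa).
- have := z a; rewrite /U2 eqxx => /eqP; rewrite diffv_eq0 => VI.
  by case/negP: nonto; rewrite eqEsubv inc.
Qed.

Lemma indec_concentrated a r r' f V : sink_flip e a r r' -> indec r f V ->
  (forall x, x != a -> V x = 0%VS) -> (\dim (V a) <= 1)%N.
Proof.
move=> [off ra rna r'a r'na] indV Vz.
have [->|Va0] := eqVneq (V a) 0%VS; first by rewrite dimv0.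
pose l : {vspace E} := <[vpick (V a)]>%VS.
have lV : (l <= V a)%VS by rewrite -memvE memv_pick.
pose U1 x := if x == a then l else 0%VS.
pose U2 x := if x == a then (V a :\: l)%VS else 0%VS.
have st (A : {vspace E}) : stable r f (fun x => if x == a then A else 0%VS).
  apply/stableP => x y rxy v; case: eqP rxy => [->|_] rxy; first by rewrite rna in rxy.
  by rewrite memv0 => /eqP->; rewrite linear0 mem0v.
have [|z|z] := indV U1 U2 (st _) (st _).
- move=> x; rewrite /U1 /U2; case: (eqVneq x a) => [->|xa]; last by rewrite addv0 capv0 Vz.
  split; last by rewrite capvC capv_diff.
  by rewrite addvC addv_diff; apply/addv_idPl.
- have := z a; rewrite /U1 eqxx => /eqP.
  by rewrite -dimv_eq0 dim_vline vpick0 Va0.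
- have := z a; rewrite /U2 eqxx => /eqP; rewrite diffv_eq0 => /dimvS.
  by rewrite dim_vline vpick0 Va0.
Qed.

(** The dimension hypothesis guarantees that the kernel, a subspace of the tuple space, fits into
    [E]. *)
Lemma exists_reflection a f V : (\sum_(x | e a x) \dim (V x) <= \dim {:E})%N ->
  exists f' C, reflection a f V f' C.
Proof.
move=> dimE; pose Phi := sum_map (e a) (f^~ a).
pose ker := (famspace (e a) V :&: lker Phi)%VS.
have [|h [C [hinj hC]]] := @exists_onto K E {ffun T -> E} ker.
  by apply: leq_trans dimE; rewrite -dim_famspace dimvS ?capvSl.
have hker v : v \in C -> h v \in ker by move=> vC; rewrite -hC memv_img.
exists (fun x y => if x == a then (proj_at E y \o h)%VF else f x y), C.
rewrite /=; split.
- by move=> x y xa _; rewrite (negbTE xa).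
- move=> v /hker; rewrite memv_cap => /andP[/memv_famspace[hV _] _] x eax.
  by rewrite eqxx comp_lfunE proj_atE hV.
- move=> v vC v0; apply: (hinj v vC); apply/ffunP => x; rewrite ffunE.
  case: (boolP (e a x)) => [/v0|nax]; first by rewrite eqxx comp_lfunE proj_atE.
  by have := hker v vC; rewrite memv_cap => /andP[/memv_famspace[_ ->]].
- move=> v /hker; rewrite memv_cap memv_ker sum_mapE => /andP[_ /eqP {2}<-].
  by apply: eq_bigr => x _; rewrite eqxx comp_lfunE proj_atE.
- move=> u uV u0; pose u' : {ffun T -> E} := [ffun x => if e a x then u x else 0].
  have : u' \in ker.
    rewrite memv_cap memv_ker sum_mapE; apply/andP; split.
      apply/memv_famspace; split=> x; rewrite ffunE; last by move/negbTE->.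
      by move=> eax; rewrite eax uV.
    by apply/eqP; rewrite -[RHS]u0; apply: eq_bigr => x eax; rewrite ffunE eax.
  rewrite -hC => /memv_imgP[v vC u'E]; exists v => // x eax.
  by rewrite eqxx comp_lfunE proj_atE -u'E ffunE eax.
Qed.

(** The inverse reflection, at a source: the new space at [a] is the cokernel of the map from [V' a]
    to the direct sum of its neighbours, realised on a complement of the image and embedded into
    [E]. *)
Lemma exists_coreflection a f' V' : (\sum_(x | e a x) \dim (V' x) <= \dim {:E})%N ->
  (forall v, v \in V' a -> forall x, e a x -> f' a x v \in V' x) ->
  (forall v, v \in V' a -> (forall x, e a x -> f' a x v = 0) -> v = 0) ->
  exists f V, [/\ reflection a f V f' (V' a), incoming a f V = V a &
                  forall x, x != a -> V x = V' x].
Proof.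
move=> dimE inV inj; pose Psi := tuple_map (e a) (f' a); pose D := famspace (e a) V'.
pose im := (Psi @: V' a)%VS; pose C := (D :\: im)%VS.
have imD : (im <= D)%VS.
  apply/subvP => _ /memv_imgP[v vV ->]; apply/memv_famspace; split=> x; rewrite tuple_mapE.
    by move=> eax; rewrite eax inV.
  by move/negbTE->.
have capC : (C :&: im = 0)%VS by exact: capv_diff.
have CimD : (C + im = D)%VS by rewrite addv_diff; apply/addv_idPl.
have [|h [hinj _]] := @exists_injective_on K _ E C fullv.
  by apply: leq_trans dimE; rewrite -dim_famspace dimvS ?diffvSl.
pose Phi : 'Hom({ffun T -> E}, E) := (h \o daddv_pi C im)%VF.
have Phi0 u : u \in D -> (Phi u == 0) = (u \in im).
  rewrite -{1}CimD => /(daddv_pi_add capC) uE.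
  rewrite comp_lfunE; apply/eqP/idP => [u0|uim].
    by rewrite -uE (hinj _ (memv_pi _ _ _) u0) add0r memv_pi.
  have capim : (im :&: C = 0)%VS by rewrite capvC.
  move: uE; rewrite (daddv_pi_id capim uim) => /(canRL (addrK _)).
  by rewrite subrr => ->; rewrite linear0.
pose f x y := if y == a then (Phi \o inj_at E x)%VF else f' x y.
pose V x := if x == a then (Phi @: D)%VS else V' x.
have fE (u : T -> E) : \sum_(x | e a x) f x a (u x) = Phi (\sum_(x | e a x) inj_at E x (u x)).
  by rewrite linear_sum; apply: eq_bigr => x _; rewrite /f eqxx comp_lfunE.
have tE (u : T -> E) : (forall x, e a x -> u x \in V' x) ->
    \sum_(x | e a x) inj_at E x (u x) \in D.
  by move=> uV; apply: memv_sumr => x eax; rewrite memv_img // uV.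
exists f, V; split; last by move=> x xa; rewrite /V (negbTE xa).
- split.
  + by move=> x y _ ya; rewrite /f (negbTE ya).
  + by move=> v vV x eax; rewrite /V (negbTE (adj_neq eax)) inV.
  + exact: inj.
  + move=> v vV; rewrite fE; apply/eqP; rewrite Phi0; last by apply: tE => x; apply: inV.
    apply/memv_imgP; exists v => //; apply/ffunP => x.
    by rewrite sum_inj_at tuple_mapE.
  + move=> u uV; rewrite fE => /eqP; rewrite Phi0.
      case/memv_imgP => v vV /ffunP E1; exists v => // x eax.
      by have := E1 x; rewrite sum_inj_at tuple_mapE eax.
    by apply: tE => x eax; have := uV x eax; rewrite /V (negbTE (adj_neq eax)).
- rewrite {2}/V eqxx /D /famspace limg_sum; apply: eq_bigr => x eax.
  by rewrite /f eqxx limg_comp /V (negbTE (adj_neq eax)).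
Qed.

Definition sys_iso r f V g W (h : T -> 'End(E)) :=
  [/\ forall x, (h x @: V x)%VS = W x, forall x, injective_on (h x) (V x) &
      forall x y, r x y -> forall v, v \in V x -> h y (f x y v) = g x y (h x v)].

(** An isomorphism of the reflections matches the two kernels, hence induces an isomorphism between
    the images at [a]. Any extension of it to [V a] will do, because no arrow leaves the sink. *)
Lemma sys_iso_of_reflected a r r' f V f' C g W g' D h' :
  sink_flip e a r r' -> stable r f V -> stable r g W ->
  reflection a f V f' C -> reflection a g W g' D -> \dim (V a) = \dim (W a) ->
  sys_iso r' f' (reflected a C f' V) g' (reflected a D g' W) h' ->
  exists h, sys_iso r f V g W h.
Proof.
move=> fl stV stW HV HW dVW [himg hinj hcom]; have [off ra rna r'a r'na] := fl.
rewrite /= in himg.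
have imgx x : x != a -> (h' x @: V x = W x)%VS.
  by move=> xa; have := himg x; rewrite !reflectedE.
have injx x : x != a -> injective_on (h' x) (V x).
  by move=> xa; have := hinj x; rewrite !reflectedE.
have imga : (h' a @: C = D)%VS by have := himg a; rewrite (reflected_full HV) (reflected_full HW).
pose Phi := sum_map (e a) (f^~ a).
pose Psi := sum_map (e a) (fun x => (g x a \o h' x)%VF).
have PsiE u : Psi u = \sum_(x | e a x) g x a (h' x (u x)).
  by rewrite sum_mapE; apply: eq_bigr => x _; rewrite comp_lfunE.
have coma v x : v \in C -> e a x -> h' x (f' a x v) = g' a x (h' a v).
  by move=> vC eax; apply: hcom; rewrite ?r'a // (reflected_full HV).
(* [Phi] and [Psi] have the same kernel on the direct sum, because [h'] identifies [C] with [D]; so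
   [Psi] factors through [Phi]. *)
have PhiPsi u : u \in famspace (e a) V -> (Phi u == 0) = (Psi u == 0).
  move=> /memv_famspace[uV _]; rewrite PsiE sum_mapE; apply/eqP/eqP => u0.
    have [v vC vE] := reflection_sur HV uV u0.
    have vD : h' a v \in D by rewrite -imga memv_img.
    rewrite -[RHS](reflection_ker HW vD); apply: eq_bigr => x eax.
    by rewrite -coma // vE.
  have [|w] := reflection_sur HW (u := fun x => h' x (u x)) _ u0.
    by move=> x eax; rewrite -imgx ?adj_neq // memv_img // uV.
  rewrite -imga => /memv_imgP[v vC ->] vE.
  rewrite -[RHS](reflection_ker HV vC); apply: eq_bigr => x eax; congr (f x a _).
  apply: (injective_on_eq (injx x (adj_neq eax))); rewrite ?uV //.
    exact: (reflection_in HV vC).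
  by rewrite coma // vE.
have [|k kE] := @lfun_factor K _ E E Phi Psi (famspace (e a) V).
  by move=> u uD /eqP; rewrite PhiPsi // => /eqP.
have incE : (Phi @: famspace (e a) V = incoming a f V)%VS := limg_sum_map _ _ _.
have [||||h [hk hinja himga]] := @extend_injective_on K _ _ k (incoming a f V) (V a) (W a).
- exact: incoming_stable fl stV.
- rewrite -incE => _ /memv_imgP[u uD ->]; rewrite kE // => /eqP.
  by rewrite -PhiPsi // => /eqP.
- rewrite -incE; apply/subvP => _ /memv_imgP[_ /memv_imgP[u uD ->] ->].
  rewrite kE // PsiE; apply: (subvP (incoming_stable fl stW)).
  apply/memv_incoming; exists (fun x => h' x (u x)); split=> // x eax.
  by case/memv_famspace: uD => uV _; rewrite -imgx ?adj_neq // memv_img // uV.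
- exact: dVW.
exists (fun x => if x == a then h else h' x); split.
- by move=> x; case: (eqVneq x a) => [->|/imgx].
- by move=> x; case: (eqVneq x a) => [->|/injx].
move=> x y rxy v vV; case: (eqVneq x a) => [xa|xa]; first by rewrite xa rna in rxy.
case: (eqVneq y a) => [ya|ya]; last first.
  have := hcom x y; rewrite off // => /(_ rxy v).
  by rewrite reflectedE // (reflection_off HV) // (reflection_off HW) //; apply.
rewrite ya in rxy *; have eax : e a x by rewrite -ra.
have uD : inj_at E x v \in famspace (e a) V.
  by apply: (subvP (sumv_sup x _ (subvv _))) => //; rewrite memv_img.
have sumx (F : T -> 'End(E)) : \sum_(z | e a z) F z (inj_at E x v z) = F x v.
  rewrite (bigD1 x) //= inj_atE eqxx big1 ?addr0 // => z /andP[_ zx].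
  by rewrite inj_atE (negbTE zx) linear0.
have := kE _ uD; rewrite sum_mapE (sumx (f^~ a)) => E1.
rewrite hk; last first.
  by apply: (subvP (sumv_sup x _ (subvv _))) => //; rewrite memv_img.
by rewrite E1 sum_mapE (sumx (fun z => (g z a \o h' z)%VF)) comp_lfunE.
Qed.

End Systems.

(** * Iterated reflections *)

Section Runs.
Variables (T : finType) (e : rel T) (y : T -> nat).
Hypothesis e_sym : symmetric e.
Hypothesis eirr : irreflexive e.
Hypothesis y_ok : forall x, (hat e y x < 2 * y x)%N.

Definition enumerates (p : seq T) := uniq p /\ forall x, x \in p.

Lemma enumerates_rot a p : enumerates (a :: p) -> enumerates (rcons p a).
Proof.
by move=> [up allp]; split=> [|x]; rewrite ?rcons_uniq // mem_rcons.
Qed.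

(** Each vertex of [vs] is the head of the current order, thus a sink, and moves to the end once it
    has been reflected. *)
Fixpoint follows (p vs : seq T) : bool :=
  match vs, p with
  | [::], _ => true
  | a :: vs', b :: p' => (b == a) && follows (rcons p' a) vs'
  | _ :: _, [::] => false
  end.

Lemma follows_cat s t vs : follows (t ++ s) vs -> follows (s ++ t) (s ++ vs).
Proof.
elim: s t => [|a s IH] t /=; first by rewrite cats0.
by move=> h; rewrite eqxx /= -cats1 -catA cats1; apply: IH; rewrite cat_rcons.
Qed.

Lemma follows_flatten N p : follows p (flatten (nseq N p)).
Proof.
elim: N => //= N IH; rewrite -[p in follows p]cats0.
exact: (@follows_cat p [::]).
Qed.

Section Space.
Variables (K : fieldType) (E : vectType K).
Implicit Types (f g : T -> T -> 'End(E)) (U V : T -> {vspace E}) (r : rel T) (a : T).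

Definition dimf V : {ffun T -> nat} := [ffun x => \dim (V x)].

Lemma dimf_eq0 V : dimf V = [ffun=> 0%N] <-> zero_family V.
Proof.
split=> [/ffunP V0 x|V0].
  by apply/eqP; rewrite -dimv_eq0; have := V0 x; rewrite !ffunE => ->.
by apply/ffunP => x; rewrite !ffunE V0 dimv0.
Qed.

Lemma indec_zero r f V : zero_family V -> indec r f V.
Proof.
move=> V0 U1 U2 _ _ UV; left=> x; have [E1 _] := UV x.
by apply/eqP; rewrite -subv0 -(V0 x) -E1 addvSl.
Qed.

(** If the images do not fill [V a], then [V] is concentrated at [a] and its reflection is zero; the
    truncation in [reflect_dim] gives the right vector in this case too. *)
Lemma indec_step a r r' f V f' C : sink_flip e a r r' -> reflection e a f V f' C ->
  stable r f V -> indec r f V ->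
  indec r' f' (reflected e a C f' V) /\
  dimf (reflected e a C f' V) = reflect_dim e a (dimf V).
Proof.
move=> fl H st ind; have dimR := dim_reflected H (fun x _ => subvv (V x)).
have hatE : hat e (dimf V) a = (\sum_(x | e a x) \dim (V x))%N.
  by apply: eq_bigr => x _; rewrite ffunE.
case: (eqVneq (incoming e a f V) (V a)) => [onto|nonto].
  split; first exact: indec_reflected onto ind.
  apply/ffunP => x; rewrite !ffunE hatE -dimR onto.
  by case: (eqVneq x a) => [->|xa]; [rewrite addnK | rewrite reflectedE].
have V0 := indec_not_onto fl st ind nonto.
have R0 : zero_family (reflected e a C f' V).
  move=> x; case: (eqVneq x a) => [->|xa]; last by rewrite reflectedE // V0.
  apply/eqP; rewrite -dimv_eq0 -leqn0.
  rewrite (leq_trans (leq_addr (\dim (incoming e a f V)) _)) // dimR.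
  by rewrite big1 // => t eat; rewrite V0 ?dimv0 // (adj_neq eirr eat).
split; first exact: indec_zero.
rewrite (proj2 (dimf_eq0 _) R0); apply/ffunP => x; rewrite !ffunE.
case: (eqVneq x a) => [_|xa]; last by rewrite V0 ?dimv0.
rewrite hatE big1 // => t eat.
by rewrite V0 ?dimv0 // (adj_neq eirr eat).
Qed.

Definition indec_decomposed r f V (I : finType) (W : I -> T -> {vspace E}) :=
  decomposed r f V W /\ forall i, indec r f (W i).

Definition part_dims (I : finType) (W : I -> T -> {vspace E}) : seq {ffun T -> nat} :=
  [seq dimf (W i) | i <- enum I].

Lemma decomposed_stable r f V (I : finType) (W : I -> T -> {vspace E}) :
  decomposed r f V W -> stable r f V.
Proof.
move=> [st _ sumW]; apply/stableP => x z rxz v; rewrite -!sumW => /memv_sumP[us usW ->].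
rewrite linear_sum; apply: memv_sumr => i _; apply: (stableP _ _ _ (st i)) => //.
exact: usW.
Qed.

Lemma decomposed_dim r f V (I : finType) (W : I -> T -> {vspace E}) x :
  decomposed r f V W -> \dim (V x) = (\sum_(B <- part_dims W) B x)%N.
Proof.
move=> [_ dir <-]; have /directvP /= -> := dir x.
by rewrite /part_dims big_map big_enum /=; apply: eq_bigr => i _; rewrite ffunE.
Qed.

Lemma indec_decomposed_step a r r' f V f' C (I : finType) (W : I -> T -> {vspace E}) :
  sink_flip e a r r' -> reflection e a f V f' C -> indec_decomposed r f V W ->
  indec_decomposed r' f' (reflected e a C f' V) (fun i => reflected e a C f' (W i)) /\
  part_dims (fun i => reflected e a C f' (W i)) = map (reflect_dim e a) (part_dims W).
Proof.
move=> fl H [dec ind]; have [st dir sumW] := dec.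
have WV i x : (W i x <= V x)%VS by rewrite -sumW (sumv_sup i).
have H' i := reflection_sub H (fun x _ => WV i x).
have RE i : reflected e a (reflected e a C f' (W i) a) f' (W i) = reflected e a C f' (W i).
  apply: funext => x; case: (eqVneq x a) => [->|xa]; last by rewrite !reflectedE.
  exact: reflected_full (H' i).
split.
  split=> [|i]; first exact: decomposed_reflected fl H dec.
  by have [] := indec_step fl (H' i) (st i) (ind i); rewrite RE.
rewrite /part_dims -map_comp; apply: eq_map => i /=.
by have [_] := indec_step fl (H' i) (st i) (ind i); rewrite RE.
Qed.

(** Room in [E] for one space at every vertex of a sum of [n] roots or zeros. The number of
    summands, some of them possibly zero, is constant along a run, so one bound serves all the
    reflections. *)
Definition root_bound (n : nat) : Prop :=
  (#|T| * (n * (2 * \sum_t y t)) <= \dim {:E})%N.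

Lemma decomposed_exists_reflection a r f V (I : finType) (W : I -> T -> {vspace E}) :
  root_bound #|I| -> decomposed r f V W -> all (root0 e) (part_dims W) ->
  exists f' C, reflection e a f V f' C.
Proof.
move=> bnd dec /allP roots; apply: exists_reflection => //; apply: leq_trans bnd.
apply: (@leq_trans (\sum_(x | e a x) #|I| * (2 * \sum_t y t))).
  apply: leq_sum => x _; rewrite (decomposed_dim x dec).
  apply: (@leq_trans (\sum_(B <- part_dims W) 2 * \sum_t y t)).
    rewrite big_seq [leqRHS]big_seq; apply: leq_sum => B /roots R0.
    exact: root0_bound.
  by rewrite big_const_seq iter_addn_0 count_predT size_map -cardE mulnC.
by rewrite sum_nat_const leq_mul2r max_card orbT.
Qed.

Lemma root0_map a bs : all (root0 e) bs -> all (root0 e) (map (reflect_dim e a) bs).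
Proof. by rewrite all_map; apply: sub_all => B; apply: (root0_reflect e_sym eirr y_ok). Qed.

(** The recorded dimensions are those of [V] and its reflections, whatever the decomposition. With
    [profile_inj] this gives uniqueness of the class. *)
Lemma decomposed_profile p vs f V (I J : finType) (W : I -> T -> {vspace E})
    (Z : J -> T -> {vspace E}) :
  enumerates p -> follows p vs -> root_bound #|I| ->
  indec_decomposed (arr e p) f V W -> indec_decomposed (arr e p) f V Z ->
  all (root0 e) (part_dims W) ->
  profile e vs (part_dims W) = profile e vs (part_dims Z).
Proof.
elim: vs p f V W Z => //= a vs IH [|b p] //= f V W Z pE /andP[/eqP ba fo] bnd decW decZ roots.
rewrite ba in pE decW decZ *.
rewrite -(decomposed_dim a (proj1 decW)) -(decomposed_dim a (proj1 decZ)); congr (_ :: _).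
have [f' [C H]] := decomposed_exists_reflection a bnd (proj1 decW) roots.
have fl := arr_flip e_sym eirr (proj1 pE) (proj2 pE).
have [decW' EW] := indec_decomposed_step fl H decW.
have [decZ' EZ] := indec_decomposed_step fl H decZ.
rewrite -EW -EZ; apply: IH fo bnd decW' decZ' _; first exact: enumerates_rot.
by rewrite EW root0_map.
Qed.

(** Both systems are reflected until they vanish, and the isomorphism is then lifted back step by
    step. *)
Lemma same_dims_iso p vs f V g V2 (I : finType) (W Z : I -> T -> {vspace E}) :
  enumerates p -> follows p vs -> root_bound #|I| ->
  indec_decomposed (arr e p) f V W -> indec_decomposed (arr e p) g V2 Z ->
  part_dims W = part_dims Z -> all (root0 e) (part_dims W) ->
  all (fun B => run e vs B == [ffun=> 0%N]) (part_dims W) ->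
  exists h, sys_iso (arr e p) f V g V2 h.
Proof.
elim: vs p f V g V2 W Z => /= [|a vs IH] p f V g V2 W Z pE fo bnd decW decZ WZ roots runs.
  have z r k A (X : I -> T -> {vspace E}) : decomposed r k A X -> part_dims X = part_dims W ->
      zero_family A.
    move=> dec E1 x; apply/eqP; rewrite -dimv_eq0 (decomposed_dim x dec) E1 big_seq big1 //.
    by move=> B /(allP runs)/eqP->; rewrite ffunE.
  have V0 := z _ _ _ _ (proj1 decW) erefl; have V20 := z _ _ _ _ (proj1 decZ) (esym WZ).
  exists (fun=> 0); split=> [x|x v|x t _ v].
  - by rewrite V0 V20 limg0.
  - by rewrite V0 memv0 => /eqP.
  - by rewrite V0 memv0 => /eqP->; rewrite !linear0.
case: p pE fo decW decZ => //= b p pE /andP[/eqP ba fo] decW decZ.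
rewrite ba in pE decW decZ *.
have fl := arr_flip e_sym eirr (proj1 pE) (proj2 pE).
have rootsZ : all (root0 e) (part_dims Z) by rewrite -WZ.
have [f' [C H]] := decomposed_exists_reflection a bnd (proj1 decW) roots.
have [g' [D HZ]] := decomposed_exists_reflection a bnd (proj1 decZ) rootsZ.
have [decW' EW] := indec_decomposed_step fl H decW.
have [decZ' EZ] := indec_decomposed_step fl HZ decZ.
have [|||h hP] := IH _ _ _ _ _ _ _ (enumerates_rot pE) fo bnd decW' decZ'.
- by rewrite EW EZ WZ.
- by rewrite EW root0_map.
- by rewrite EW all_map.
apply: (sys_iso_of_reflected eirr fl _ _ H HZ _ hP).
- exact: decomposed_stable (proj1 decW).
- exact: decomposed_stable (proj1 decZ).
- by rewrite (decomposed_dim a (proj1 decW)) WZ -(decomposed_dim a (proj1 decZ)).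
Qed.

(** As long as the run is exact the form keeps its value. Where exactness first fails, the
    indecomposable is concentrated at the sink and of dimension 1, so that value is 2. *)
Lemma indec_root p vs f V : enumerates p -> follows p vs -> stable (arr e p) f V ->
  indec (arr e p) f V -> ~ zero_family V -> ~~ exact_run e vs (dimf V) ->
  (#|T| * (\sum_t y t * `|qdim e (dimf V)|) <= \dim {:E})%N -> qdim e (dimf V) = 2.
Proof.
elim: vs p f V => //= a vs IH [|b p] f V pE; first by have := proj2 pE a.
move=> /andP[/eqP ba fo] st ind nz; rewrite ba in pE st ind.
have fl := arr_flip e_sym eirr (proj1 pE) (proj2 pE).
have dimfE x : dimf V x = \dim (V x) by rewrite ffunE.
have [le|lt _ bnd] := leqP (dimf V a) (hat e (dimf V) a); last first.
  (* If the images filled [V a], its dimension could not exceed that of the direct sum of its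
     neighbours. *)
  have nonto : incoming e a f V != V a.
    apply: contraL lt => /eqP onto; rewrite -leqNgt dimfE -onto.
    have -> : hat e (dimf V) a = \dim (famspace (e a) V).
      by rewrite dim_famspace; apply: eq_bigr => x _; rewrite ffunE.
    rewrite -(limg_ker_dim (sum_map (e a) (f^~ a))) limg_sum_map; exact: leq_addl.
  have V0 := indec_not_onto fl st ind nonto.
  have := indec_concentrated fl ind V0.
  move=> d1; have -> : dimf V = unit_dim a.
    apply/ffunP => x; rewrite !ffunE; case: (eqVneq x a) => [->|xa]; last by rewrite V0 ?dimv0.
    by move: lt; rewrite dimfE; lia.
  exact: qdim_unit.
move=> /= nex bnd; have [|f' [C H]] := @exists_reflection K E T e a f V.
  apply: leq_trans bnd; apply: (@leq_trans (\sum_(x | e a x) (\sum_t y t * `|qdim e (dimf V)|))).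
    apply: leq_sum => x _; rewrite -dimfE (bigD1 x) //=.
    by apply: leq_trans (leq_addr _ _); apply: qdim_bound.
  by rewrite sum_nat_const leq_mul2r max_card orbT.
have [ind' dimE] := indec_step fl H st ind.
have st' := stable_reflected H fl st.
rewrite -(qdim_reflect e_sym eirr le) -dimE.
apply: (IH _ _ _ (enumerates_rot pE) fo st' ind').
- move=> /dimf_eq0; rewrite dimE => R0; apply: nz; apply/dimf_eq0.
  by apply: (qdim_eq0 e_sym y_ok); rewrite -(qdim_reflect e_sym eirr le) R0 qdim0.
- by rewrite dimE.
- by rewrite dimE qdim_reflect.
Qed.

(** Dual to [indec_not_onto]: at a source, a vector killed by all arrows spans a direct summand. *)
Lemma indec_not_inj a r r' f' V v : sink_flip e a r r' -> stable r' f' V -> indec r' f' V ->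
  v \in V a -> v != 0 -> (forall x, e a x -> f' a x v = 0) -> forall x, x != a -> V x = 0%VS.
Proof.
move=> [off ra rna r'a r'na] st ind vV v0 fv x xa.
pose l : {vspace E} := <[v]>%VS.
pose U1 x := if x == a then l else 0%VS.
pose U2 x := if x == a then (V a :\: l)%VS else V x.
have lV : (l <= V a)%VS by rewrite -memvE.
have [|||z|z] := ind U1 U2.
- apply/stableP => t z rtz u; rewrite /U1; case: (eqVneq t a) rtz => [->|_] rtz; last first.
    by rewrite memv0 => /eqP->; rewrite linear0 mem0v.
  by move=> /vlineP[k ->]; rewrite linearZ /= fv -?r'a // scaler0 mem0v.
- apply/stableP => t z rtz u; rewrite /U2.
  case: (eqVneq z a) rtz => [->|za] rtz; first by rewrite r'na in rtz.
  case: (eqVneq t a) rtz => [->|ta] rtz uV; apply: (stableP _ _ _ st) => //.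
  by apply: (subvP (diffvSl _ l)).
- move=> t; rewrite /U1 /U2; case: (eqVneq t a) => [->|_]; last by rewrite add0v cap0v.
  split; last by rewrite capvC capv_diff.
  by rewrite addvC addv_diff; apply/addv_idPl.
- by have := z a; rewrite /U1 eqxx => /eqP; rewrite -dimv_eq0 dim_vline v0.
- by have := z x; rewrite /U2 (negbTE xa).
Qed.

(** The run is followed to the vertex where the root becomes simple, which is realised by a line;
    coreflections then lead back to [B]. *)
Lemma exists_indec p vs B : enumerates p -> follows p vs -> qdim e B = 2 ->
  ~~ exact_run e vs B -> root_bound 1 ->
  exists f V, [/\ stable (arr e p) f V, indec (arr e p) f V & dimf V = B].
Proof.
elim: vs p B => //= a vs IH [|b p] B pE; first by have := proj2 pE a.
move=> /andP[/eqP ba fo] qB nex bnd; rewrite ba in pE *.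
have fl := arr_flip e_sym eirr (proj1 pE) (proj2 pE).
have [off ra rna r'a r'na] := fl.
have [le|lt] := leqP (B a) (hat e B a); last first.
  rewrite (root_unit e_sym eirr y_ok qB lt).
  have dE : (0 < \dim {:E})%N.
    apply: leq_trans bnd; rewrite !muln_gt0 /=; apply/andP; split.
      by apply/card_gt0P; exists a.
    by rewrite (bigD1 a) //= addn_gt0 (y_gt0 y_ok).
  pose v : E := vpick {:E}.
  have v0 : v != 0 by rewrite vpick0 -dimv_eq0 -lt0n.
  pose V x : {vspace E} := if x == a then <[v]>%VS else 0%VS.
  have dV : dimf V = unit_dim a.
    by apply/ffunP => x; rewrite !ffunE /V; case: eqP => _; rewrite ?dimv0 // dim_vline v0.
  exists (fun _ _ => 0), V; split=> //.
    by apply/stableP => x t _ u _; rewrite lfunE /= mem0v.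
  move=> U1 U2 _ _ UV.
  have off_a (U : T -> {vspace E}) : (forall x, (U x <= V x)%VS) -> \dim (U a) = 0%N -> zero_family U.
    move=> UV' Ua x; case: (eqVneq x a) => [->|xa]; first by apply/eqP; rewrite -dimv_eq0 Ua.
    by apply/eqP; have := UV' x; rewrite /V (negbTE xa) subv0.
  have [E1 capa] := UV a; have := dimv_sum_cap (U1 a) (U2 a).
  rewrite capa dimv0 addn0 E1 {1}/V eqxx dim_vline v0 => d1.
  case: (posnP (\dim (U1 a))) => [z1|p1]; [left | right]; apply: off_a => //.
  - by move=> x; have [<- _] := UV x; rewrite addvSl.
  - by move=> x; have [<- _] := UV x; rewrite addvSr.
  - by move: d1 p1; case: (\dim (U1 a)) => // [[|n]] //; case: (\dim (U2 a)).
have qB' : qdim e (reflect_dim e a B) = 2 by rewrite qdim_reflect.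
have nex' : ~~ exact_run e vs (reflect_dim e a B) by move: nex; rewrite le.
have [f' [V' [st' ind' dV']]] := IH _ _ (enumerates_rot pE) fo qB' nex' bnd.
have dV'E x : \dim (V' x) = reflect_dim e a B x by rewrite -dV' ffunE.
(* Otherwise [V'] would be concentrated at [a]; then [B] vanishes away from [a], hence also at [a]
   by [le], against [qB]. *)
have inj v : v \in V' a -> (forall x, e a x -> f' a x v = 0) -> v = 0.
  move=> vV fv; apply/eqP; apply/negPn/negP => v0.
  have V0 := indec_not_inj fl st' ind' vV v0 fv.
  have B0 x : x != a -> B x = 0%N.
    by move=> xa; have := dV'E x; rewrite V0 // dimv0 ffunE (negbTE xa).
  have h0 : hat e B a = 0%N by rewrite /hat big1 // => x /(adj_neq eirr)/B0.
  have : B = [ffun=> 0%N].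
    apply/ffunP => x; rewrite ffunE; case: (eqVneq x a) => [->|/B0//].
    by apply/eqP; rewrite -leqn0 -h0.
  by move=> Bz; move: qB; rewrite Bz qdim0.
have [|v vV x eax|//|f [V [H onto VE]]] := @exists_coreflection K E T e eirr a f' V'.
  apply: leq_trans bnd; apply: (@leq_trans (\sum_(x | e a x) (2 * \sum_t y t))).
    apply: leq_sum => x _; rewrite dV'E; apply: (root0_bound e_sym y_ok).
    by rewrite /root0 qB' eqxx.
  by rewrite sum_nat_const mul1n leq_mul2r max_card orbT.
- by apply: (stableP _ _ _ st') => //; rewrite r'a.
have RV : reflected e a (V' a) f' V = V'.
  apply: funext => x; case: (eqVneq x a) => [->|xa]; last by rewrite reflectedE // VE.
  exact: reflected_full H.
have dV : dimf V = B.
  have := dim_reflected H (fun x _ => subvv (V x)); rewrite RV onto dV'E ffunE eqxx.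
  have -> : (\sum_(x | e a x) \dim (V x))%N = hat e B a.
    apply: eq_bigr => x /(adj_neq eirr) xa; rewrite VE // dV'E ffunE.
    by rewrite (negbTE xa).
  move=> dVa; apply/ffunP => x; rewrite ffunE; case: (eqVneq x a) => [->|xa].
    by lia.
  by rewrite VE // dV'E ffunE (negbTE xa).
exists f, V; split=> //.
  apply/stableP => x t; case: (eqVneq x a) => [->|xa]; first by rewrite rna.
  case: (eqVneq t a) => [->|ta].
    rewrite ra => eax v vV; rewrite -onto; apply: (subvP (sumv_sup x _ (subvv _))) => //.
    by rewrite memv_img.
  by rewrite -off // -(reflection_off H) // !VE //; apply: (stableP _ _ _ st').
by apply: (indec_of_reflected eirr fl H onto); rewrite RV.
Qed.

End Space.
End Runs.

(** * Subspaces between two subspaces *)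

Lemma dim_addv_line (K : fieldType) (E : vectType K) (A : {vspace E}) v :
  v \notin A -> \dim (A + <[v]>) = (\dim A).+1.
Proof.
move=> vA; have := dimv_sum_cap A <[v]>; rewrite dim_vline.
have -> : (A :&: <[v]> = 0)%VS.
  apply/eqP; rewrite -subv0; apply/subvP => w; rewrite memv_cap memv0.
  case/andP => wU /vlineP[c wE]; rewrite wE scaler_eq0.
  case: (eqVneq c 0) => //= c0; case/negP: vA.
  by rewrite -[v]scale1r -(mulVf c0) -scalerA -wE rpredZ.
have -> : (v != 0) by apply: contraNneq vA => ->; rewrite mem0v.
by rewrite dimv0 addn0 addn1.
Qed.

Lemma exists_between (K : fieldType) (E : vectType K) (A B : {vspace E}) d :
  (A <= B)%VS -> (\dim A <= d <= \dim B)%N ->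
  exists U : {vspace E}, [/\ (A <= U)%VS, (U <= B)%VS & \dim U = d].
Proof.
move=> AB /andP[]; elim: d => [|d IH].
  by rewrite leqn0 => /eqP A0 _; exists A.
rewrite leq_eqVlt => /predU1P[<- _|]; first by exists A.
rewrite ltnS => Ad dB; have [|U [AU UB dU]] := IH Ad; first exact: ltnW.
have /subvPn[v vB vU] : ~~ (B <= U)%VS.
  by apply/negP => /dimvS; rewrite dU leqNgt dB.
exists (U + <[v]>)%VS; split.
- exact: subv_trans (addvSl _ _).
- by rewrite subv_add UB -memvE.
by rewrite dim_addv_line // dU.
Qed.

Section CountSubspaces.
Variables (K : finFieldType) (N : nat).
Let E := 'rV[K]_N.
Let q := #|K|.

Definition between (A B : {vspace E}) d : {set {vspace E}} :=
  [set U : {vspace E} | [&& (A <= U)%VS, (U <= B)%VS & \dim U == d]].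

Lemma card_vs (U : {vspace E}) : #|[set v : E | v \in U]| = (q ^ \dim U)%N.
Proof. by rewrite cardsE (card_vspace U). Qed.

Lemma card_diff_vs (A B : {vspace E}) : (A <= B)%VS ->
  #|[set v : E | (v \in B) && (v \notin A)]| = (q ^ \dim B - q ^ \dim A)%N.
Proof.
move=> /subvP AB; rewrite -!card_vs.
have -> : [set v : E | (v \in B) && (v \notin A)] =
    [set v : E | v \in B] :\: [set v : E | v \in A].
  by apply/setP => v; rewrite !inE andbC.
rewrite cardsD; congr (_ - #|pred_of_set _|)%N; apply/setP => v; rewrite !inE.
by case: (boolP (v \in A)) => [/AB->|]; rewrite ?andbF.
Qed.

(* Count the pairs [(v, U)] with [v] in [U] but not in [A] in two ways. *)
Lemma card_between_vector (A B : {vspace E}) d : (A <= B)%VS ->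
  (\sum_(v : E | (v \in B) && (v \notin A)) #|between (A + <[v]>) B d|
    = #|between A B d| * (q ^ d - q ^ \dim A))%N.
Proof.
move=> AB; transitivity (\sum_(v : E | (v \in B) && (v \notin A))
    \sum_(U in between (A + <[v]>) B d) 1)%N.
  by apply: eq_bigr => v _; rewrite sum1_card.
rewrite (exchange_big_dep (fun U => U \in between A B d)) /=; last first.
  move=> v U _; rewrite !inE subv_add => /and3P[/andP[-> _] -> ->] //.
rewrite -sum_nat_const; apply: eq_bigr => U; rewrite inE => /and3P[AU UB /eqP dU].
rewrite sum1dep_card -dU -card_diff_vs //; apply: eq_card => v.
rewrite !inE subv_add AU UB dU eqxx -memvE andbT /=.
by rewrite andbT; case: (boolP (v \in U)) => vU; rewrite ?andbF // andbT (subvP UB).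
Qed.

(** In the application [x] is a power of [m], not invertible modulo [m] in general; it is cancelled
    as a common factor before reducing. *)
Lemma modn_cancel m x : (1 < m)%N -> (x > 0)%N ->
  forall a b k l, (0 < k)%N -> (0 < l)%N ->
  (a * (x * m ^ k - x) = b * (x * m ^ l - x))%N -> a = b %[mod m].
Proof.
move=> m1 x0 a b k l k0 l0.
have xE j : (x * m ^ j - x = x * (m ^ j - 1))%N by rewrite mulnBr muln1.
rewrite !xE !(mulnCA _ x) => /eqP; rewrite eqn_pmul2l // => /eqP E1.
have pos j : (0 < m ^ j)%N by rewrite expn_gt0 (ltnW m1).
have : (a * m ^ k + b = b * m ^ l + a)%N.
  have := leq_pmulr a (pos k); have := leq_pmulr b (pos l).
  by move: E1; rewrite !mulnBr !muln1; lia.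
rewrite -(prednK k0) -(prednK l0) !expnSr !mulnA => E2.
by rewrite -[RHS](modnMDl (a * m ^ k.-1)) E2 modnMDl.
Qed.

Lemma between_dim_eq (A B : {vspace E}) : (A <= B)%VS -> between A B (\dim A) = [set A].
Proof.
move=> AB; apply/setP => U; rewrite !inE; apply/and3P/eqP => [[AU UB /eqP dU]|->].
  by apply/eqP; rewrite eq_sym eqEdim AU dU leqnn.
by rewrite subvv AB eqxx.
Qed.

(** The number is a Gaussian binomial coefficient, a polynomial in [q] with constant term 1; the
    double count avoids writing it down. *)
Lemma card_between_mod (A B : {vspace E}) d : (A <= B)%VS -> (\dim A <= d <= \dim B)%N ->
  #|between A B d| = 1 %[mod q].
Proof.
have q1 : (1 < q)%N by exact: finNzRing_gt1.
have qpos j : (0 < q ^ j)%N by rewrite expn_gt0 (ltnW q1).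
(* The induction also proves that the number depends on the dimensions only, in order to take it out
   of the sum over the vectors [v]. *)
suff H k : forall (A B A' B' : {vspace E}) d, (A <= B)%VS -> (A' <= B')%VS ->
    \dim A = \dim A' -> \dim B = \dim B' -> (\dim A + k)%N = d -> (d <= \dim B)%N ->
    #|between A B d| = #|between A' B' d| /\ #|between A B d| = 1 %[mod q].
  move=> AB /andP[Ad dB].
  by have [||||||] := H (d - \dim A)%N A B A B d; rewrite ?subnKC.
elim: k => [|k IH] {}A {}B A' B' {}d AB AB' dA dB.
  by rewrite addn0 => <- _; rewrite {2}dA !between_dim_eq // !cards1.
move=> dE dleB; have ltAB : (\dim A < \dim B)%N by lia.
have [v0 v0B v0A] : exists2 v, v \in B & v \notin A.
  by apply/subvPn; apply/negP => /dimvS; rewrite leqNgt ltAB.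
have line (A1 B1 : {vspace E}) v : (A1 <= B1)%VS -> v \in B1 -> v \notin A1 ->
    (A1 + <[v]> <= B1)%VS /\ \dim (A1 + <[v]>) = (\dim A1).+1.
  by move=> AB1 vB vA; split; [rewrite subv_add AB1 -memvE | exact: dim_addv_line].
have [L1 L2] := line _ _ _ AB v0B v0A.
(* All terms of the sum in [card_between_vector] equal the one for [v0]. *)
have c0E (A1 B1 : {vspace E}) : (A1 <= B1)%VS -> \dim A1 = \dim A -> \dim B1 = \dim B ->
   (#|between A1 B1 d| * (q ^ d - q ^ \dim A)
     = #|between (A + <[v0]>) B d| * (q ^ \dim B - q ^ \dim A))%N.
  move=> AB1 dA1 dB1; have := card_between_vector d AB1; rewrite dA1 => <-.
  rewrite -dB1 -dA1 -card_diff_vs // mulnC -sum_nat_const.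
  apply: eq_big => v; first by rewrite inE.
  case/andP => vB vA; have [l1 l2] := line _ _ _ AB1 vB vA.
  by have [] // := IH (A1 + <[v]>)%VS B1 (A + <[v0]>)%VS B d; rewrite ?l2 ?L2 ?dA1 ?dB1 //; lia.
have c1 : #|between (A + <[v0]>) B d| = 1 %[mod q].
  by have [] // := IH (A + <[v0]>)%VS B (A + <[v0]>)%VS B d; rewrite ?L2 //; lia.
have split j : (\dim A <= j)%N -> (q ^ j = q ^ \dim A * q ^ (j - \dim A))%N.
  by move=> le; rewrite -expnD subnKC.
split.
  have := c0E _ _ AB erefl erefl; rewrite -(c0E _ _ AB' (esym dA) (esym dB)).
  move/eqP; rewrite eqn_pmul2r => [/eqP//|].
  by rewrite subn_gt0 ltn_exp2l // -dE; lia.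
rewrite -c1; have := c0E _ _ AB erefl erefl; rewrite (split d) ?(split (\dim B)) //; try lia.
by apply: modn_cancel => //; lia.
Qed.

End CountSubspaces.

(** * Chains of subspaces *)

Section InsertOrd.
Variables (X : Type) (m : nat) (h : 'I_m.+1).

Definition insert_ord (x : X) (c : 'I_m -> X) : 'I_m.+1 -> X :=
  fun k => if unlift h k is Some j then c j else x.

Lemma insert_ord_at x c : insert_ord x c h = x.
Proof. by rewrite /insert_ord unlift_none. Qed.

Lemma insert_ord_lift x c j : insert_ord x c (lift h j) = c j.
Proof. by rewrite /insert_ord liftK. Qed.

End InsertOrd.

Lemma card_insert_ord (X : finType) m (h : 'I_m.+1) (P : pred ('I_m.+1 -> X)) :
  (forall c c', c =1 c' -> P c = P c') ->
  #|[set c : {ffun 'I_m.+1 -> X} | P c]|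
  = (\sum_x #|[set c : {ffun 'I_m -> X} | P (insert_ord h x c)]|)%N.
Proof.
move=> Pext.
transitivity (\sum_x \sum_(c : {ffun 'I_m -> X} | P (insert_ord h x c)) 1)%N; last first.
  by apply: eq_bigr => x _; rewrite sum1dep_card.
rewrite pair_big_dep -sum1dep_card /=.
pose ins (p : X * {ffun 'I_m -> X}) : {ffun 'I_m.+1 -> X} := [ffun k => insert_ord h p.1 p.2 k].
have insK : cancel ins (fun c => (c h, [ffun j => c (lift h j)])).
  move=> [x c]; rewrite ffunE insert_ord_at; congr pair.
  by apply/ffunP => j; rewrite !ffunE insert_ord_lift.
rewrite (reindex ins) /=; last first.
  exists (fun c => (c h, [ffun j => c (lift h j)])) => [p _|c _]; first exact: insK.
  apply/ffunP => k; rewrite ffunE /insert_ord /=.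
  by case: unliftP => [j ->|->]; rewrite ?ffunE.
by apply: eq_bigl => p; apply: Pext => k; rewrite ffunE.
Qed.

Lemma sum_mod_const (I : finType) (P : pred I) (F : I -> nat) q :
  (forall i, P i -> F i = 1 %[mod q]) -> (\sum_(i | P i) F i)%N = #|[pred i | P i]| %[mod q].
Proof.
move=> F1; rewrite -sum1_card -modn_summ -[RHS]modn_summ.
by congr (_ %% _)%N; apply: eq_bigr => i /F1->.
Qed.

Section Chains.
Variables (K : fieldType) (E : vectType K).

Definition chain m (lo hi : 'I_m -> {vspace E}) (d : 'I_m -> nat) (c : 'I_m -> {vspace E}) :=
  [forall i, [&& (lo i <= c i)%VS, (c i <= hi i)%VS & \dim (c i) == d i]] &&
  [forall i : 'I_m, forall j : 'I_m, (i <= j)%N ==> (c j <= c i)%VS].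

Lemma chainP m (lo hi : 'I_m -> {vspace E}) (d : 'I_m -> nat) (c : 'I_m -> {vspace E}) :
  reflect ((forall i, [/\ (lo i <= c i)%VS, (c i <= hi i)%VS & \dim (c i) = d i]) /\
           (forall i j : 'I_m, (i <= j)%N -> (c j <= c i)%VS)) (chain lo hi d c).
Proof.
apply: (iffP andP) => [[/forallP h1 /'forall_'forall_implyP h2]|[h1 h2]].
  by split=> // i; have /and3P[? ? /eqP] := h1 i.
split; last exact/'forall_'forall_implyP.
by apply/forallP => i; have [-> -> ->] := h1 i; rewrite eqxx.
Qed.

Lemma eq_chain m (lo hi : 'I_m -> {vspace E}) (d : 'I_m -> nat) (c c' : 'I_m -> {vspace E}) :
  c =1 c' -> chain lo hi d c = chain lo hi d c'.
Proof.
move=> cc; rewrite /chain; congr (_ && _).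
  by apply: eq_forallb => i; rewrite cc.
by apply: eq_forallb => i; apply: eq_forallb => j; rewrite !cc.
Qed.

Section Peel.
Variables (m : nat) (lo hi : 'I_m.+1 -> {vspace E}) (V : {vspace E}) (d : 'I_m.+1 -> nat).

(** With varying lower bounds the largest member is chosen first; it then is the common upper bound
    of the others, and the later lower bounds lie below it whatever the choice. *)
Lemma chain_insert_first x (c : 'I_m -> {vspace E}) :
  chain lo (fun=> V) d (insert_ord ord0 x c) =
  [&& (lo ord0 <= x)%VS, (x <= V)%VS & \dim x == d ord0] &&
  chain (fun j => lo (lift ord0 j)) (fun=> x) (fun j => d (lift ord0 j)) c.
Proof.
apply/chainP/andP => [[h1 h2]|[/and3P[lox xV /eqP dx] /chainP[h1 h2]]].
  split.
    by have := h1 ord0; rewrite insert_ord_at => -[-> -> ->]; rewrite eqxx.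
  apply/chainP; split=> [j|i j ij].
    have := h1 (lift ord0 j); rewrite insert_ord_lift => -[loj _ dj]; split=> //.
    by have := h2 ord0 (lift ord0 j) isT; rewrite insert_ord_at insert_ord_lift.
  by have := h2 (lift ord0 i) (lift ord0 j); rewrite !insert_ord_lift; apply.
split=> [i|i j].
  case: (unliftP ord0 i) => [k ->|->]; last by rewrite insert_ord_at.
  rewrite insert_ord_lift; have [l1 l2 l3] := h1 k; split=> //.
  exact: subv_trans l2 xV.
case: (unliftP ord0 i) => [k ->|->]; case: (unliftP ord0 j) => [l ->|->];
  rewrite ?insert_ord_lift ?insert_ord_at // => kl; first exact: h2.
by have [] := h1 l.
Qed.

(** With varying upper bounds the smallest member is chosen first, for the dual reason. *)
Lemma chain_insert_last x (c : 'I_m -> {vspace E}) :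
  chain (fun=> V) hi d (insert_ord ord_max x c) =
  [&& (V <= x)%VS, (x <= hi ord_max)%VS & \dim x == d ord_max] &&
  chain (fun=> x) (fun j => hi (lift ord_max j)) (fun j => d (lift ord_max j)) c.
Proof.
apply/chainP/andP => [[h1 h2]|[/and3P[lox xV /eqP dx] /chainP[h1 h2]]].
  split.
    by have := h1 ord_max; rewrite insert_ord_at => -[-> -> ->]; rewrite eqxx.
  apply/chainP; split=> [j|i j ij].
    have := h1 (lift ord_max j); rewrite insert_ord_lift => -[loj hij dj]; split=> //.
    have := h2 (lift ord_max j) ord_max; rewrite insert_ord_at insert_ord_lift; apply.
    exact: leq_ord.
  by have := h2 (lift ord_max i) (lift ord_max j); rewrite !insert_ord_lift !lift_max; apply.
split=> [i|i j].
  case: (unliftP ord_max i) => [k ->|->]; last by rewrite insert_ord_at.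
  rewrite insert_ord_lift; have [l1 l2 l3] := h1 k; split=> //.
  exact: subv_trans lox l1.
case: (unliftP ord_max i) => [k ->|->]; case: (unliftP ord_max j) => [l ->|->];
  rewrite ?insert_ord_lift ?insert_ord_at ?lift_max // => kl; first exact: h2.
  by have [] := h1 k.
by have := ltn_ord l; rewrite ltnNge kl.
Qed.

End Peel.

Lemma exists_chain_above m (lo : 'I_m -> {vspace E}) V (d : 'I_m -> nat) :
  (forall i j : 'I_m, (i <= j)%N -> (lo j <= lo i)%VS /\ (d j <= d i)%N) ->
  (forall i, (lo i <= V)%VS /\ (\dim (lo i) <= d i <= \dim V)%N) ->
  exists c, chain lo (fun=> V) d c.
Proof.
elim: m lo V d => [|m IH] lo V d mono bnd.
  by exists (fun=> V); apply/chainP; split=> -[].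
have [lV ld] := bnd ord0; have [x [lx xV dx]] := exists_between lV ld.
have [|i|c cP] := IH (fun j => lo (lift ord0 j)) x (fun j => d (lift ord0 j)).
- by move=> i j ij; apply: mono.
- have [m1 m2] := mono ord0 (lift ord0 i) isT; split; first exact: subv_trans m1 lx.
  by rewrite dx m2 andbT; have [_ /andP[]] := bnd (lift ord0 i).
by exists (insert_ord ord0 x c); rewrite chain_insert_first lx xV dx eqxx.
Qed.

Lemma exists_chain_below m A (hi : 'I_m -> {vspace E}) (d : 'I_m -> nat) :
  (forall i j : 'I_m, (i <= j)%N -> (hi j <= hi i)%VS /\ (d j <= d i)%N) ->
  (forall i, (A <= hi i)%VS /\ (\dim A <= d i <= \dim (hi i))%N) ->
  exists c, chain (fun=> A) hi d c.
Proof.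
elim: m A hi d => [|m IH] A hi d mono bnd.
  by exists (fun=> A); apply/chainP; split=> -[].
have [lV ld] := bnd ord_max; have [x [lx xV dx]] := exists_between lV ld.
have [|i|c cP] := IH x (fun j => hi (lift ord_max j)) (fun j => d (lift ord_max j)).
- by move=> i j ij; apply: mono; rewrite !lift_max.
- have [m1 m2] := mono (lift ord_max i) ord_max (leq_ord _); split; first exact: subv_trans m1.
  by rewrite dx m2; have [_ /andP[]] := bnd (lift ord_max i).
by exists (insert_ord ord_max x c); rewrite chain_insert_last lx xV dx eqxx.
Qed.

End Chains.

Section CountChains.
Variables (K : finFieldType) (N : nat).
Let E := 'rV[K]_N.
Let q := #|K|.

Lemma count_chain_above m (lo : 'I_m -> {vspace E}) V (d : 'I_m -> nat) :
  (forall i j : 'I_m, (i <= j)%N -> (lo j <= lo i)%VS /\ (d j <= d i)%N) ->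
  (forall i, (lo i <= V)%VS /\ (\dim (lo i) <= d i <= \dim V)%N) ->
  #|[set c : {ffun 'I_m -> {vspace E}} | chain lo (fun=> V) d c]| = 1 %[mod q].
Proof.
elim: m lo V d => [|m IH] lo V d mono bnd.
  congr (_ %% _)%N; apply/eqP/cards1P; exists [ffun=> V].
  apply/setP => c; rewrite !inE; apply/chainP/eqP => _; last by split=> -[].
  by apply/ffunP => -[].
rewrite (card_insert_ord ord0) //; last exact: eq_chain.
have [lV ld] := bnd ord0; rewrite -(card_between_mod lV ld).
rewrite (bigID (mem (between (lo ord0) V (d ord0)))) /= addnC big1 => [|x nx].
  rewrite add0n sum_mod_const => [|x]; first by congr (_ %% _)%N; apply: eq_card.
  rewrite inE => /and3P[lx xV /eqP dx].
  rewrite -(IH (fun j => lo (lift ord0 j)) x (fun j => d (lift ord0 j))).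
  - congr (_ %% _)%N; apply: eq_card => c.
    by rewrite !inE chain_insert_first lx xV dx eqxx.
  - by move=> i j ij; apply: mono.
  - move=> i; have [m1 m2] := mono ord0 (lift ord0 i) isT; split; first exact: subv_trans m1 lx.
    by rewrite dx m2 andbT; have [_ /andP[]] := bnd (lift ord0 i).
apply: eq_card0 => c; rewrite !inE chain_insert_first.
by move: nx; rewrite inE => /negbTE->.
Qed.

Lemma count_chain_below m A (hi : 'I_m -> {vspace E}) (d : 'I_m -> nat) :
  (forall i j : 'I_m, (i <= j)%N -> (hi j <= hi i)%VS /\ (d j <= d i)%N) ->
  (forall i, (A <= hi i)%VS /\ (\dim A <= d i <= \dim (hi i))%N) ->
  #|[set c : {ffun 'I_m -> {vspace E}} | chain (fun=> A) hi d c]| = 1 %[mod q].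
Proof.
elim: m A hi d => [|m IH] A hi d mono bnd.
  congr (_ %% _)%N; apply/eqP/cards1P; exists [ffun=> A].
  apply/setP => c; rewrite !inE; apply/chainP/eqP => _; last by split=> -[].
  by apply/ffunP => -[].
rewrite (card_insert_ord ord_max) //; last exact: eq_chain.
have [lV ld] := bnd ord_max; rewrite -(card_between_mod lV ld).
rewrite (bigID (mem (between A (hi ord_max) (d ord_max)))) /= addnC big1 => [|x nx].
  rewrite add0n sum_mod_const => [|x]; first by congr (_ %% _)%N; apply: eq_card.
  rewrite inE => /and3P[lx xV /eqP dx].
  rewrite -(IH x (fun j => hi (lift ord_max j)) (fun j => d (lift ord_max j))).
  - congr (_ %% _)%N; apply: eq_card => c.
    by rewrite !inE chain_insert_last lx xV dx eqxx.
  - by move=> i j ij; apply: mono; rewrite !lift_max.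
  - move=> i; have [m1 m2] := mono (lift ord_max i) ord_max (leq_ord _).
    split; first exact: subv_trans m1.
    by rewrite dx m2; have [_ /andP[]] := bnd (lift ord_max i).
apply: eq_card0 => c; rewrite !inE chain_insert_last.
by move: nx; rewrite inE => /negbTE->.
Qed.

End CountChains.

(** * Flags of subrepresentations *)

Section FlagDims.
Variables (T : finType) (e : rel T) (m : nat).
Implicit Type d : 'I_m -> T -> nat.

(* In a flag of dimensions [d], the kernel at [a] of the [j]-th step has dimension at
   least [hat e (d j) a - d j a]; the steps decrease, hence the maximum over [k <= j]. *)
Definition reflect_flag_dim (a : T) d : 'I_m -> T -> nat := fun k x =>
  if x == a then (\max_(j < m | k <= j) (hat e (d j) a - d j a))%N else d k x.

(** Numerical criterion for a flag of dimensions [d] in a representation with profile [s]: the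
    obvious necessary conditions at each reflected vertex, and dimensions 0 once the representation
    has vanished. *)
Fixpoint good_dims (s : seq (T * nat)) d : bool :=
  if s is (a, n) :: s' then
    [&& [forall k, (d k a <= n)%N],
        [forall i : 'I_m, forall j : 'I_m, (i <= j)%N ==> (d j a <= d i a)%N]
      & good_dims s' (reflect_flag_dim a d)]
  else [forall k, forall x, d k x == 0%N].

End FlagDims.

Section Flags.
Variables (T : finType) (e : rel T).
Hypothesis e_sym : symmetric e.
Hypothesis eirr : irreflexive e.
Variables (K : fieldType) (E : vectType K) (m : nat).
Implicit Types (f : T -> T -> 'End(E)) (V : T -> {vspace E}) (r : rel T) (a : T).
Implicit Types (d : 'I_m -> T -> nat) (F : 'I_m -> T -> {vspace E}) (c : 'I_m -> {vspace E}).

Definition is_flag r f V d F :=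
  [/\ forall k x, (F k x <= V x)%VS, forall k x, \dim (F k x) = d k x,
      forall k, stable r f (F k) &
      forall i j : 'I_m, (i <= j)%N -> forall x, (F j x <= F i x)%VS].

(** The conditions on a flag that do not involve the vertex [a]; they are the same for a
    representation and its reflection. *)
Definition is_flag_off a r f V d F :=
  [/\ forall k x, x != a -> (F k x <= V x)%VS,
      forall k x, x != a -> \dim (F k x) = d k x,
      forall k x z, x != a -> z != a -> r x z -> (f x z @: F k x <= F k z)%VS &
      forall i j : 'I_m, (i <= j)%N -> forall x, x != a -> (F j x <= F i x)%VS].

Definition replace a F c : 'I_m -> T -> {vspace E} := fun k x => if x == a then c k else F k x.

Lemma replace_off a F c k x : x != a -> replace a F c k x = F k x.
Proof. by rewrite /replace => /negbTE->. Qed.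

Lemma replace_at a F c k : replace a F c k a = c k.
Proof. by rewrite /replace eqxx. Qed.

Lemma is_flag_off_ext a r f V d F F' : (forall k x, x != a -> F k x = F' k x) ->
  is_flag_off a r f V d F -> is_flag_off a r f V d F'.
Proof.
move=> FF [h1 h2 h3 h4]; split=> [k x xa|k x xa|k x z xa za|i j ij x xa];
  rewrite -?FF //; [exact: h1 | exact: h2 | exact: h3 | exact: h4].
Qed.

Section Step.
Variables (a : T) (r r' : rel T) (f : T -> T -> 'End(E)) (V : T -> {vspace E}).
Variables (f' : T -> T -> 'End(E)) (C : {vspace E}).
Hypothesis fl : sink_flip e a r r'.
Hypothesis H : reflection e a f V f' C.
Hypothesis stV : stable r f V.

(** At a sink the spaces only have to contain the images of their neighbours, which are lower
    bounds. *)
Lemma is_flag_sink d F : is_flag r f V d F <-> is_flag_off a r f V d F /\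
  chain (fun k => incoming e a f (F k)) (fun=> V a) (d^~ a) (F^~ a).
Proof.
have [off ra rna r'a r'na] := fl.
split=> [[h1 h2 h3 h4]|[[h1 h2 h3 h4] /chainP[c1 c2]]].
  split.
    split=> [k x xa|k x xa|k x z xa za rxz|i j ij x xa]; rewrite ?h1 ?h2 ?h4 //.
    by have /'forall_'forall_implyP := h3 k; apply.
  apply/chainP; split=> [k|i j ij]; last exact: h4.
  by split=> //; apply: incoming_stable fl (h3 k).
split=> [k x|k x|k|i j ij x].
- case: (eqVneq x a) => [->|]; [by have [] := c1 k | exact: h1].
- case: (eqVneq x a) => [->|]; [by have [] := c1 k | exact: h2].
- apply/'forall_'forall_implyP => x z rxz.
  case: (eqVneq x a) rxz => [->|xa] rxz; first by rewrite rna in rxz.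
  case: (eqVneq z a) rxz => [->|za] rxz; last exact: h3.
  have [le _ _] := c1 k; apply: subv_trans le.
  by apply: (sumv_sup x) => //; rewrite -ra.
- by case: (eqVneq x a) => [->|]; [exact: c2 | exact: h4].
Qed.

(** At a source the spaces only have to map into their neighbours, which are upper bounds. *)
Lemma is_flag_source d d' F : (forall k x, x != a -> d' k x = d k x) ->
  is_flag r' f' (reflected e a C f' V) d' F <-> is_flag_off a r f V d F /\
  chain (fun=> 0%VS) (fun k => reflected e a C f' (F k) a) (d'^~ a) (F^~ a).
Proof.
move=> dd; have [off ra rna r'a r'na] := fl.
split=> [[h1 h2 h3 h4]|[[h1 h2 h3 h4] /chainP[c1 c2]]].
  split.
    split=> [k x xa|k x xa|k x z xa za rxz|i j ij x xa].
    - by have := h1 k x; rewrite reflectedE.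
    - by rewrite h2 dd.
    - have /'forall_'forall_implyP/(_ x z) := h3 k.
      by rewrite off // (reflection_off H) //; apply.
    - exact: h4.
  apply/chainP; split=> [k|i j ij]; last exact: h4.
  split=> //; first exact: sub0v.
  apply/subvP => v vF; apply/memv_reflected; split.
    by have := subvP (h1 k a) v vF; rewrite (reflected_full H).
  by move=> x eax; apply: (stableP _ _ _ (h3 k)); rewrite ?r'a.
split=> [k x|k x|k|i j ij x].
- case: (eqVneq x a) => [->|xa]; last by rewrite reflectedE // h1.
  have [_ le _] := c1 k; apply: (subv_trans le); apply/subvP => v /memv_reflected[vC _].
  by rewrite (reflected_full H).
- case: (eqVneq x a) => [->|xa]; [by have [] := c1 k | by rewrite h2 // dd].
- apply/'forall_'forall_implyP => x z rxz.
  case: (eqVneq z a) rxz => [->|za] rxz; first by rewrite r'na in rxz.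
  case: (eqVneq x a) rxz => [->|xa] rxz.
    apply/subvP => _ /memv_imgP[v vF ->]; have [_ le _] := c1 k.
    by have /memv_reflected[_] := subvP le v vF; apply; rewrite -r'a.
  by rewrite (reflection_off H) // h3 // -off.
- by case: (eqVneq x a) => [->|]; [exact: c2 | exact: h4].
Qed.

Lemma incoming_replace F c k : incoming e a f (replace a F c k) = incoming e a f (F k).
Proof. by apply: eq_incoming => // x xa; rewrite replace_off. Qed.

Lemma reflected_replace F c k :
  reflected e a C f' (replace a F c k) a = reflected e a C f' (F k) a.
Proof.
apply/vspaceP => v; apply/idP/idP => /memv_reflected[vC vF]; apply/memv_reflected;
  split=> // x eax; by have := vF x eax; rewrite replace_off // (adj_neq eirr eax).
Qed.

Lemma is_flag_replace_sink d F c : is_flag r f V d (replace a F c) <->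
  is_flag_off a r f V d F /\ chain (fun k => incoming e a f (F k)) (fun=> V a) (d^~ a) c.
Proof.
rewrite is_flag_sink.
have E1 : (fun k => incoming e a f (replace a F c k)) = (fun k => incoming e a f (F k)).
  by apply: funext => k; rewrite incoming_replace.
have E2 : (fun k => replace a F c k a) = c by apply: funext => k; rewrite replace_at.
by rewrite E1 E2; split=> -[off ch]; split=> //; apply: is_flag_off_ext off => k x xa;
  rewrite replace_off.
Qed.

Lemma is_flag_replace_source d F c :
  is_flag r' f' (reflected e a C f' V) (reflect_flag_dim e a d) (replace a F c) <->
  is_flag_off a r f V d F /\
  chain (fun=> 0%VS) (fun k => reflected e a C f' (F k) a) ((reflect_flag_dim e a d)^~ a) c.
Proof.
rewrite (is_flag_source (d := d)) => [|k x xa]; last by rewrite /reflect_flag_dim (negbTE xa).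
have E1 : (fun k => reflected e a C f' (replace a F c k) a) = (fun k => reflected e a C f' (F k) a).
  by apply: funext => k; rewrite reflected_replace.
have E2 : (fun k => replace a F c k a) = c by apply: funext => k; rewrite replace_at.
by rewrite E1 E2; split=> -[off ch]; split=> //; apply: is_flag_off_ext off => k x xa;
  rewrite replace_off.
Qed.

Section Off.
Variables (d : 'I_m -> T -> nat) (F : 'I_m -> T -> {vspace E}).
Hypothesis offF : is_flag_off a r f V d F.

Lemma off_sub k x : e a x -> (F k x <= V x)%VS.
Proof. by have [h _ _ _] := offF => /(adj_neq eirr)/h. Qed.

Lemma incoming_anti (i j : 'I_m) : (i <= j)%N -> (incoming e a f (F j) <= incoming e a f (F i))%VS.
Proof.
move=> ij; have [_ _ _ h] := offF; apply/subv_sumP => x eax.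
by apply: (sumv_sup x) => //; rewrite limgS // h // (adj_neq eirr eax).
Qed.

Lemma incoming_le k : (incoming e a f (F k) <= V a)%VS.
Proof.
apply: subv_trans (incoming_stable fl stV); apply/subv_sumP => x eax.
by apply: (sumv_sup x) => //; rewrite limgS // off_sub.
Qed.

Lemma reflected_anti (i j : 'I_m) : (i <= j)%N ->
  (reflected e a C f' (F j) a <= reflected e a C f' (F i) a)%VS.
Proof.
move=> ij; have [_ _ _ h] := offF; apply/subvP => v /memv_reflected[vC vF].
apply/memv_reflected; split=> // x eax.
by apply: (subvP (h i j ij x (adj_neq eirr eax))); apply: vF.
Qed.

Lemma off_dim k :
  (\dim (reflected e a C f' (F k) a) + \dim (incoming e a f (F k)) = hat e (d k) a)%N.
Proof.
rewrite (dim_reflected H) => [|x]; last exact: off_sub.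
by have [_ h _ _] := offF; apply: eq_bigr => x /(adj_neq eirr)/h.
Qed.

Lemma off_dim_equiv :
  (forall k, (\dim (incoming e a f (F k)) <= d k a)%N) <->
  (forall k, (reflect_flag_dim e a d k a <= \dim (reflected e a C f' (F k) a))%N).
Proof.
split=> h k; last first.
  have := h k; rewrite /reflect_flag_dim eqxx => /bigmax_leqP/(_ k (leqnn _)).
  by have := off_dim k; lia.
rewrite /reflect_flag_dim eqxx; apply/bigmax_leqP => j kj.
(* For [k <= j] the kernel of the step [j] lies in that of the step [k], which accounts for the
   maximum in [reflect_flag_dim]. *)
apply: (@leq_trans (\dim (reflected e a C f' (F j) a))); last exact/dimvS/reflected_anti.
by have := off_dim j; have := h j; lia.
Qed.

Lemma reflect_flag_dim_anti (i j : 'I_m) : (i <= j)%N ->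
  (reflect_flag_dim e a d j a <= reflect_flag_dim e a d i a)%N.
Proof.
move=> ij; rewrite /reflect_flag_dim eqxx; apply/bigmax_leqP => k jk.
apply: (leq_bigmax_cond (F := fun j : 'I_m => (hat e (d j) a - d j a)%N)).
exact: leq_trans jk.
Qed.

Hypothesis d_le : forall k, (d k a <= \dim (V a))%N.
Hypothesis d_anti : forall i j : 'I_m, (i <= j)%N -> (d j a <= d i a)%N.

Lemma exists_chain_sink :
  (exists c, chain (fun k => incoming e a f (F k)) (fun=> V a) (d^~ a) c) <->
  forall k, (\dim (incoming e a f (F k)) <= d k a)%N.
Proof.
split=> [[c /chainP[h _]] k|le]; first by have [/dimvS + _ <-] := h k.
apply: exists_chain_above => [i j ij|k]; first by rewrite incoming_anti // d_anti.
by rewrite incoming_le le d_le.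
Qed.

Lemma exists_chain_source :
  (exists c, chain (fun=> 0%VS) (fun k => reflected e a C f' (F k) a)
     ((reflect_flag_dim e a d)^~ a) c) <->
  forall k, (reflect_flag_dim e a d k a <= \dim (reflected e a C f' (F k) a))%N.
Proof.
split=> [[c /chainP[h _]] k|le]; first by have [_ /dimvS + <-] := h k.
apply: exists_chain_below => [i j ij|k].
  by rewrite reflected_anti // reflect_flag_dim_anti.
by rewrite sub0v dimv0 le.
Qed.

End Off.

Lemma is_flag_dims d F : is_flag r f V d F ->
  (forall k, (d k a <= \dim (V a))%N) /\
  (forall i j : 'I_m, (i <= j)%N -> (d j a <= d i a)%N).
Proof.
move=> [h1 h2 _ h4]; split=> [k|i j ij]; first by rewrite -h2 dimvS.
by rewrite -!h2 dimvS // h4.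
Qed.

Lemma replace_id F : replace a F (F^~ a) = F.
Proof. by apply: funext => k; apply: funext => x; rewrite /replace; case: eqP => [->|]. Qed.

(** The two flags share their spaces away from [a]; only the chain at [a] is replaced. *)
Lemma exists_flag_step d :
  (forall k, (d k a <= \dim (V a))%N) ->
  (forall i j : 'I_m, (i <= j)%N -> (d j a <= d i a)%N) ->
  (exists F, is_flag r f V d F) <->
  (exists F, is_flag r' f' (reflected e a C f' V) (reflect_flag_dim e a d) F).
Proof.
move=> d_le d_anti; split=> -[F]; rewrite -[F]replace_id.
  move=> /is_flag_replace_sink[off ch].
  have /(exists_chain_sink off d_le d_anti) : exists c,
    chain (fun k => incoming e a f (F k)) (fun=> V a) (d^~ a) c by exists (F^~ a).
  move=> /(off_dim_equiv off)/(exists_chain_source off)[c cP].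
  by exists (replace a F c); apply/is_flag_replace_source.
move=> /is_flag_replace_source[off ch].
have /(exists_chain_source off) : exists c, chain (fun=> 0%VS)
  (fun k => reflected e a C f' (F k) a) ((reflect_flag_dim e a d)^~ a) c by exists (F^~ a).
move=> /(off_dim_equiv off)/(exists_chain_sink off d_le d_anti)[c cP].
by exists (replace a F c); apply/is_flag_replace_sink.
Qed.

End Step.

Variable y : T -> nat.
Hypothesis y_ok : forall x, (hat e y x < 2 * y x)%N.

Theorem exists_flag p vs f V (I : finType) (W : I -> T -> {vspace E}) d :
  enumerates p -> follows p vs -> root_bound y E #|I| ->
  indec_decomposed (arr e p) f V W -> all (root0 e) (part_dims W) ->
  all (fun B => run e vs B == [ffun=> 0%N]) (part_dims W) ->
  (exists F, is_flag (arr e p) f V d F) <-> good_dims e (profile e vs (part_dims W)) d.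
Proof.
elim: vs p f V W d => /= [|a vs IH] p f V W d pE fo bnd decW roots runs.
  have V0 x : V x = 0%VS.
    apply/eqP; rewrite -dimv_eq0 (decomposed_dim x (proj1 decW)) big_seq big1 // => B.
    by move/(allP runs)/eqP->; rewrite ffunE.
  split=> [[F [h1 h2 _ _]]|/'forall_'forall_eqP d0].
    apply/'forall_'forall_eqP => k x; rewrite -h2; apply/eqP.
    by rewrite dimv_eq0 -subv0 -(V0 x).
  exists (fun _ _ => 0%VS); split=> [k x|k x|k|i j ij x].
  - exact: sub0v.
  - by rewrite d0 dimv0.
  - by apply/'forall_'forall_implyP => x z _; rewrite limg0 subvv.
  - exact: subvv.
case: p pE fo decW => //= b p pE /andP[/eqP ba fo] decW.
rewrite ba in pE decW *.
have fl := arr_flip e_sym eirr (proj1 pE) (proj2 pE).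
have [f' [C H]] := decomposed_exists_reflection e_sym y_ok a bnd (proj1 decW) roots.
have [decW' EW] := indec_decomposed_step eirr fl H decW.
have stV := decomposed_stable (proj1 decW).
rewrite -(decomposed_dim a (proj1 decW)) -EW.
have IHd : (exists F, is_flag (arr e (rcons p a)) f' (reflected e a C f' V)
      (reflect_flag_dim e a d) F) <->
    good_dims e (profile e vs (part_dims (fun i => reflected e a C f' (W i))))
      (reflect_flag_dim e a d).
  apply: (IH _ _ _ _ _ (enumerates_rot pE) fo bnd decW'); rewrite EW; last by rewrite all_map.
  exact: (root0_map e_sym eirr y_ok).
split=> [[F isF]|/and3P[/forallP d_le /'forall_'forall_implyP d_anti]].
  have [d_le d_anti] := is_flag_dims a isF.
  apply/and3P; split; [exact/forallP | exact/'forall_'forall_implyP|].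
  by apply/IHd/(exists_flag_step fl H stV d_le d_anti); exists F.
by move/IHd/(exists_flag_step fl H stV d_le d_anti).
Qed.

End Flags.

Section CountFlags.
Variables (T : finType) (e : rel T) (y : T -> nat).
Hypothesis e_sym : symmetric e.
Hypothesis eirr : irreflexive e.
Hypothesis y_ok : forall x, (hat e y x < 2 * y x)%N.
Variables (K : finFieldType) (N m : nat).
Let E := 'rV[K]_N.
Let q := #|K|.
Implicit Types (f : T -> T -> 'End(E)) (V : T -> {vspace E}) (r : rel T) (a : T).
Implicit Types (d : 'I_m -> T -> nat).

Definition flags r f V d : {set {ffun 'I_m -> {ffun T -> {vspace E}}}} :=
  [set F : {ffun 'I_m -> {ffun T -> {vspace E}}} | `[< is_flag r f V d (fun k x => F k x) >]].

(** Families are grouped by their spaces away from [a]; each group is represented by its member that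
    is 0 at [a]. *)
Lemma card_replace a (P : ('I_m -> T -> {vspace E}) -> Prop) :
  #|[set F : {ffun 'I_m -> {ffun T -> {vspace E}}} | `[< P (fun k x => F k x) >]]|
  = (\sum_(F : {ffun 'I_m -> {ffun T -> {vspace E}}} | [forall k, F k a == 0%VS])
      #|[set c : {ffun 'I_m -> {vspace E}} | `[< P (replace a (fun k x => F k x) c) >]]|)%N.
Proof.
pose rep (p : {ffun 'I_m -> {ffun T -> {vspace E}}} * {ffun 'I_m -> {vspace E}}) :
  {ffun 'I_m -> {ffun T -> {vspace E}}} :=
  [ffun k => [ffun x => replace a (fun k x => p.1 k x) p.2 k x]].
pose unrep (F : {ffun 'I_m -> {ffun T -> {vspace E}}}) :=
  (rep (F, [ffun=> 0%VS]), [ffun k => F k a]).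
have repE p : (fun k x => rep p k x) = replace a (fun k x => p.1 k x) p.2.
  by apply: funext => k; apply: funext => x; rewrite !ffunE.
transitivity (\sum_(F : {ffun 'I_m -> {ffun T -> {vspace E}}} | [forall k, F k a == 0%VS])
    \sum_(c : {ffun 'I_m -> {vspace E}} | `[< P (replace a (fun k x => F k x) c) >]) 1)%N; last first.
  by apply: eq_bigr => F _; rewrite sum1dep_card.
rewrite pair_big_dep -sum1dep_card /= (reindex_onto rep unrep) /=; last first.
  move=> F _; apply/ffunP => k; apply/ffunP => x; rewrite !ffunE /replace.
  by case: (eqVneq x a) => [->|xa]; rewrite !ffunE // /replace (negbTE xa).
apply: eq_bigl => -[F c] /=; rewrite repE /= andbC; congr (_ && _).
apply/eqP/'forall_eqP => [[E1 _] k|F0].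
  by rewrite -E1 ffunE ffunE /replace eqxx ffunE.
rewrite /unrep; congr pair; last by apply/ffunP => k; rewrite !ffunE /replace eqxx.
apply/ffunP => k; apply/ffunP => x; rewrite !ffunE /replace /=.
by case: (eqVneq x a) => [->|xa]; rewrite !ffunE ?F0 // /replace (negbTE xa).
Qed.

Lemma card_flags_step a r r' f V f' C d :
  sink_flip e a r r' -> reflection e a f V f' C -> stable r f V ->
  (forall k, (d k a <= \dim (V a))%N) ->
  (forall i j : 'I_m, (i <= j)%N -> (d j a <= d i a)%N) ->
  #|flags r f V d| = #|flags r' f' (reflected e a C f' V) (reflect_flag_dim e a d)| %[mod q].
Proof.
move=> fl H stV d_le d_anti; rewrite /flags.
rewrite (card_replace a (is_flag r f V d)).
rewrite (card_replace a (is_flag r' f' (reflected e a C f' V) (reflect_flag_dim e a d))).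
rewrite -modn_summ -[RHS]modn_summ; congr (_ %% _)%N; apply: eq_bigr => F _.
set F1 : 'I_m -> T -> {vspace E} := fun k x => F k x.
have [off|noff] := pselect (is_flag_off a r f V d F1); last first.
  by congr (_ %% _)%N; rewrite !eq_card0 // => c; rewrite inE; apply/asboolP;
    [move/(is_flag_replace_source eirr fl H)=> [] | move/(is_flag_replace_sink eirr f V fl)=> []].
transitivity (#|[set c : {ffun 'I_m -> {vspace E}} |
    chain (fun k => incoming e a f (F1 k)) (fun=> V a) (d^~ a) c]| %% q)%N.
  congr (_ %% _)%N; apply: eq_card => c; rewrite !inE; apply/asboolP/idP.
    by move/(is_flag_replace_sink eirr f V fl)=> [].
  by move=> ch; apply/(is_flag_replace_sink eirr f V fl).
transitivity (#|[set c : {ffun 'I_m -> {vspace E}} |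
    chain (fun=> 0%VS) (fun k => reflected e a C f' (F1 k) a)
      ((reflect_flag_dim e a d)^~ a) c]| %% q)%N; last first.
  congr (_ %% _)%N; apply: eq_card => c; rewrite !inE; apply/idP/asboolP.
    by move=> ch; apply/(is_flag_replace_source eirr fl H).
  by move/(is_flag_replace_source eirr fl H)=> [].
(* For fixed spaces away from [a], both numbers of chains are 1 modulo [q], or both sets are empty,
   by the equivalence of the two bounds. *)
have [le|nle] := pselect (forall k, (\dim (incoming e a f (F1 k)) <= d k a)%N).
  have le' := proj1 (off_dim_equiv eirr H stV off) le.
  rewrite count_chain_above ?count_chain_below //.
  - by move=> i j ij; rewrite (reflected_anti eirr f' C off) // reflect_flag_dim_anti.
  - by move=> k; rewrite sub0v dimv0 le'.
  - by move=> i j ij; rewrite (incoming_anti eirr off) // d_anti.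
  - by move=> k; rewrite (incoming_le eirr fl stV off) le d_le.
congr (_ %% _)%N; rewrite !eq_card0 // => c; rewrite inE; apply/negP => ch; apply: nle.
  by apply/(off_dim_equiv eirr H stV off)/(exists_chain_source eirr f' C off); exists c.
by apply/(exists_chain_sink eirr fl stV off d_le d_anti); exists c.
Qed.

Theorem card_flags p vs f V (I : finType) (W : I -> T -> {vspace E}) d :
  enumerates p -> follows p vs -> root_bound y E #|I| ->
  indec_decomposed (arr e p) f V W -> all (root0 e) (part_dims W) ->
  all (fun B => run e vs B == [ffun=> 0%N]) (part_dims W) ->
  #|flags (arr e p) f V d| = good_dims e (profile e vs (part_dims W)) d %[mod q].
Proof.
elim: vs p f V W d => [|a vs IH] p f V W d pE fo bnd decW roots runs; last first.
  case: p pE fo decW => //= b p pE /andP[/eqP ba fo] decW.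
  rewrite ba in pE decW *.
  have fl := arr_flip e_sym eirr (proj1 pE) (proj2 pE).
  have [f' [C H]] := decomposed_exists_reflection e_sym y_ok a bnd (proj1 decW) roots.
  have [decW' EW] := indec_decomposed_step eirr fl H decW.
  have stV := decomposed_stable (proj1 decW).
  rewrite -(decomposed_dim a (proj1 decW)) -EW.
  have IHd := IH _ _ _ _ (reflect_flag_dim e a d) (enumerates_rot pE) fo bnd decW'.
  case: (boolP ([forall k, (d k a <= \dim (V a))%N] &&
      [forall i : 'I_m, forall j : 'I_m, (i <= j)%N ==> (d j a <= d i a)%N])).
    case/andP=> c1 c2; rewrite c1 c2 /=.
    move/forallP: c1 => c1; move/'forall_'forall_implyP: c2 => c2.
    rewrite (card_flags_step fl H stV c1 c2) IHd // EW; last by rewrite all_map.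
    exact: (root0_map e_sym eirr y_ok).
  rewrite andbA => nc; rewrite (negbTE nc) /=; congr (_ %% _)%N.
  apply: eq_card0 => F; rewrite inE; apply/asboolP => isF.
  have [c1 c2] := is_flag_dims a isF; case/negP: nc; apply/andP; split.
    exact/forallP.
  exact/'forall_'forall_implyP.
have gE := exists_flag e_sym eirr y_ok d pE fo bnd decW roots runs.
case: (boolP (good_dims _ _ _)) => good; last first.
  congr (_ %% _)%N; apply: eq_card0 => F; rewrite inE; apply/asboolP => isF.
  by case/negP: good; apply/gE; exists (fun k x => F k x).
(* The run is over and all prescribed dimensions are 0, so the zero flag is the only one. *)
congr (_ %% _)%N; apply/eqP/cards1P; exists [ffun=> [ffun=> 0%VS]].
have [F0 isF0] := proj2 gE good; move/'forall_'forall_eqP: good => d0.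
apply/setP => F; rewrite !inE; apply/asboolP/eqP => [[_ h _ _]|->].
  by apply/ffunP => k; apply/ffunP => x; rewrite !ffunE; apply/eqP; rewrite -dimv_eq0 h d0.
suff -> : (fun k x => [ffun=> [ffun=> 0%VS]] k x) = F0 by [].
have [_ h _ _] := isF0; apply: funext => k; apply: funext => x; rewrite !ffunE.
by apply/esym/eqP; rewrite -dimv_eq0 h d0.
Qed.

End CountFlags.

(** * Dynkin quivers *)

Section DynkinWeight.
Local Open Scope nat_scope.

(* A multiple of the sum of the positive roots in the basis of simple roots. *)
Definition dynkin_weight (D : dynkin_type) (i : nat) : nat :=
  match D with
  | TypeA n => i.+1 * (n.+1 - i)
  | TypeD n => if i < n.+2 then 2 * (i.+1 * (2 * n + 6 - i)) else n.+4 * n.+3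
  | TypeE6 => nth 0 [:: 16; 30; 42; 30; 16; 22] i
  | TypeE7 => nth 0 [:: 34; 66; 96; 75; 52; 27; 49] i
  | TypeE8 => nth 0 [:: 92; 182; 270; 220; 168; 114; 58; 136] i
  end.

Lemma sum_ord_le_seq n (P : pred nat) (F : nat -> nat) (s : seq nat) :
  (forall j, j < n -> P j -> j \in s) -> \sum_(j < n | P j) F j <= \sum_(j <- s) F j.
Proof.
move=> Ps; apply: (@leq_trans (\sum_(j < n) \sum_(c <- s) (val j == c) * F c)).
  rewrite big_mkcond; apply: leq_sum => j _; case: ifP => // Pj.
  by rewrite (big_rem _ (Ps j (ltn_ord j) Pj)) /= eqxx mul1n leq_addr.
rewrite exchange_big /=; apply: leq_sum => c _.
rewrite -big_distrl /= -[leqRHS]mul1n leq_mul2r; apply/orP; right.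
case: (ltnP c n) => cn; last first.
  rewrite big1 // => j _; case: eqP => // jc; move: (ltn_ord j).
  by rewrite jc ltnNge cn.
by rewrite (bigD1 (Ordinal cn)) //= eqxx big1 // => j; rewrite -val_eqE /= => /negbTE->.
Qed.

Lemma sum_ord_sumn n (P : pred nat) (F : nat -> nat) :
  \sum_(j < n | P j) F j = sumn [seq F j | j <- iota 0 n & P j].
Proof. by rewrite sumnE big_map big_filter -(big_mkord P F) /index_iota subn0. Qed.

Lemma dynkin_weight_lt D i : i < dynkin_rank D ->
  \sum_(j < dynkin_rank D | dynkin_adj D i j) dynkin_weight D j < 2 * dynkin_weight D i.
Proof.
(* The exceptional diagrams are checked by computation. *)
have byE (b : bool) n (P : rel nat) (w : nat -> nat) :
    all (fun i => sumn [seq w j | j <- iota 0 n & P i j] < 2 * w i) (iota 0 n) ->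
    forall i, i < n -> \sum_(j < n | P i j) w j < 2 * w i.
  move=> /allP h k kn; rewrite sum_ord_sumn; apply: h.
  by rewrite mem_iota.
case: D => [n|n|||] /=; try by move: i; exact: (byE true).
  move=> lt; case: i lt => [|i] lt.
    apply: (@leq_ltn_trans (\sum_(j <- [:: 1]) j.+1 * (n.+1 - j))).
      apply: (sum_ord_le_seq (P := fun j => _)) => j _; rewrite inE /dynkin_adj /=.
      by case/orP => /eqP; lia.
    by rewrite big_seq1; lia.
  apply: (@leq_ltn_trans (\sum_(j <- [:: i; i.+2]) j.+1 * (n.+1 - j))).
    apply: (sum_ord_le_seq (P := fun j => _)) => j _; rewrite !inE /dynkin_adj /=.
    by case/orP => /eqP; lia.
  by rewrite big_cons big_seq1; nia.
pose w j := if j < n.+2 then 2 * (j.+1 * (2 * n + 6 - j)) else n.+4 * n.+3.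
rewrite -/(w i) => lt.
(* The distance [t] to the branch vertex [n.+1] replaces the truncated subtraction by an
   addition. *)
have wlo j t : j + t = n.+1 -> w j = 2 * (j.+1 * (n + 5 + t)).
  by rewrite /w => jt; rewrite ifT; [congr (2 * (_ * _)) |]; lia.
have whi j : n.+1 < j -> w j = n.+4 * n.+3.
  by rewrite /w => jn; rewrite ifF //; lia.
have bound s : (forall j, dynkin_adj (TypeD n) i j -> j \in s) -> \sum_(j <- s) w j < 2 * w i ->
    \sum_(j < n.+4 | dynkin_adj (TypeD n) i j) w j < 2 * w i.
  by move=> h; apply: leq_ltn_trans; apply: (sum_ord_le_seq (P := fun j => _)) => j _; apply: h.
have adjE j : dynkin_adj (TypeD n) i j ->
    [|| (i.+1 == j) && (j < n.+3), (i == n.+1) && (j == n.+3),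
        (j.+1 == i) && (i < n.+3) | (j == n.+1) && (i == n.+3)].
  by rewrite /dynkin_adj /= /branch_edge /=; case/orP=> /orP[] ->; rewrite ?orbT.
have [ei|i1] := eqVneq i n.+3; [subst i|].
  apply: (bound [:: n.+1]); last by rewrite big_seq1 (whi n.+3) // (wlo n.+1 0) ?addn0 //; nia.
  by move=> j /adjE; rewrite inE; lia.
have [ei|i2] := eqVneq i n.+2; [subst i|].
  apply: (bound [:: n.+1]); last by rewrite big_seq1 (whi n.+2) // (wlo n.+1 0) ?addn0 //; nia.
  by move=> j /adjE; rewrite inE; lia.
have [ei|i3] := eqVneq i n.+1; [subst i|].
  apply: (bound [:: n; n.+2; n.+3]); last first.
    by rewrite !big_cons big_nil (whi n.+2) // (whi n.+3) // (wlo n 1) ?addn1 // (wlo n.+1 0) ?addn0 //; nia.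
  by move=> j /adjE; rewrite !inE; lia.
have ile : i <= n by lia.
case: i lt bound adjE i1 i2 i3 ile => [|i] lt bound adjE i1 i2 i3 ile.
  apply: (bound [:: 1]); last by rewrite big_seq1 (wlo 1 n) // (wlo 0 n.+1) //; nia.
  by move=> j /adjE; rewrite !inE; lia.
have [t tE] : exists t, i.+1 + t = n by exists (n - i.+1); rewrite subnKC.
apply: (bound [:: i; i.+2]); last first.
  rewrite !big_cons big_nil (wlo i t.+2) ?(wlo i.+2 t) ?(wlo i.+1 t.+1); nia.
by move=> j /adjE; rewrite !inE; lia.
Qed.

End DynkinWeight.

Section DynkinQuiver.
Variables (Q : quiver) (dQ : dynkin Q).
Notation T := (vertex Q).

Definition adjacent : rel T := fun x y => (0 < nb_edges x y)%N.

Lemma nb_edges_sym (x y : T) : nb_edges x y = nb_edges y x.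
Proof. by apply: eq_card => a; rewrite !inE orbC. Qed.

Lemma adjacent_sym : symmetric adjacent.
Proof. by move=> x y; rewrite /adjacent nb_edges_sym. Qed.

Lemma adjacent_irr : irreflexive adjacent.
Proof.
move=> x; apply/negbTE; rewrite -leqNgt leqn0 cards_eq0; apply/eqP/setP => a.
rewrite !inE orbb; apply/negP => /andP[/eqP sx /eqP tx].
by have := dynkin_loopless dQ a; rewrite sx tx eqxx.
Qed.

Lemma nb_edgesE (x y : T) : nb_edges x y = adjacent x y.
Proof.
have [k [D [phi [_ edgeP]]]] := dQ.
by rewrite /adjacent edgeP; case: (_ && _).
Qed.

Lemma adjacent_arrow (a : arrow Q) : adjacent (src a) (tgt a).
Proof. by apply/card_gt0P; exists a; rewrite inE !eqxx. Qed.

Lemma dynkin_certificate : exists y : T -> nat, forall x, (hat adjacent y x < 2 * y x)%N.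
Proof.
have [k [D [phi [[psi phiK psiK] edgeP]]]] := dQ.
exists (fun x => dynkin_weight (D (tag (phi x))) (tagged (phi x))) => x.
apply: leq_ltn_trans (dynkin_weight_lt (ltn_ord (tagged (phi x)))).
rewrite /hat (reindex psi) /=; last by exists phi => z _; [apply: psiK | apply: phiK].
set c := tag (phi x); set i := nat_of_ord (tagged (phi x)).
rewrite (eq_bigl (fun p : {c : 'I_k & 'I_(dynkin_rank (D c))} =>
  (tag p == c) && dynkin_adj (D (tag p)) i (nat_of_ord (tagged p)))); last first.
  move=> [c' j]; rewrite /adjacent edgeP psiK eq_sym lt0b -/c -/i /=; move: i => i0.
  by case: (eqVneq c' c) => //= cc; rewrite -cc.
rewrite (eq_bigr (fun p : {c : 'I_k & 'I_(dynkin_rank (D c))} =>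
  dynkin_weight (D (tag p)) (nat_of_ord (tagged p)))) => [|p _]; last by rewrite psiK.
rewrite -(sig_big_dep (fun c' => c' == c) (fun c' (j : 'I_(dynkin_rank (D c'))) => dynkin_adj (D c') i j)
  (fun c' (j : 'I_(dynkin_rank (D c'))) => dynkin_weight (D c') j)) /=.
by rewrite big_pred1_eq.
Qed.

Lemma qdim_tits (d : dim_vector Q) : qdim adjacent d = 2 * tits_form d.
Proof.
(* Each arrow contributes to the two ordered pairs formed by its distinct ends. *)
have sumE : \sum_x \sum_(t | adjacent x t) (d x)%:Z * (d t)%:Z
    = 2 * \sum_(a : arrow Q) (d (src a))%:Z * (d (tgt a))%:Z.
  transitivity (\sum_x \sum_t \sum_(a : arrow Q)
     (((src a == x) && (tgt a == t))%:R + ((src a == t) && (tgt a == x))%:R)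
     * ((d x)%:Z * (d t)%:Z)).
    apply: eq_bigr => x _; rewrite big_mkcond /=; apply: eq_bigr => t _.
    rewrite -mulr_suml.
    have -> : \sum_(a : arrow Q) (((src a == x) && (tgt a == t))%:R
        + ((src a == t) && (tgt a == x))%:R) = (nb_edges x t)%:Z.
      rewrite /nb_edges -sum1_card -natz natr_sum [RHS]big_mkcond /=; apply: eq_bigr => a _.
      have : ~~ ((src a == x) && (tgt a == x)).
        by apply: contra (dynkin_loopless dQ a) => /andP[/eqP-> /eqP->].
      rewrite inE; case: (src a == x); case: (tgt a == x);
        by case: (src a == t); case: (tgt a == t).
    by rewrite nb_edgesE; case: (adjacent x t); rewrite ?mul1r ?mul0r.
  under eq_bigr => x _ do rewrite exchange_big /=.
  rewrite exchange_big mulr_sumr /=; apply: eq_bigr => a _.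
  have one (u v : T) : \sum_x \sum_t ((u == x) && (v == t))%:R * ((d x)%:Z * (d t)%:Z)
      = (d u)%:Z * (d v)%:Z.
    rewrite (bigD1 u) //= (bigD1 v) //= !eqxx mul1r !big1 ?addr0 // => x.
      by rewrite eq_sym => /negbTE xu; rewrite big1 // => t _; rewrite xu mul0r.
    by rewrite eq_sym => /negbTE ->; rewrite mul0r.
  under eq_bigr => x _ do (under eq_bigr => t _ do rewrite mulrDl); rewrite /=.
  under eq_bigr => x _ do rewrite big_split /=.
  rewrite big_split /= one [X in _ + X]exchange_big /=.
  under [X in _ + X]eq_bigr => x _ do (under eq_bigr => t _ do rewrite [_%:Z * _]mulrC); rewrite /=.
  by rewrite one; ring.
rewrite /qdim /qform /tits_form mulrBr -sumE mulr_sumr -sumrB.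
by apply: eq_bigr => x _; rewrite mulrBr mulr_sumr; congr (_ - _); ring.
Qed.

Lemma root_qdim (b : pos_root Q) : qdim adjacent (val b) = 2.
Proof. by rewrite qdim_tits (eqP (valP b)). Qed.

(* If every vertex of [S] had an arrow to [S], the Tits form would be
   nonpositive at the indicator vector of [S]. *)
Lemma exists_sink (S : {set T}) : S != finset.set0 ->
  exists2 x, x \in S & forall a, src a = x -> tgt a \notin S.
Proof.
move=> S0; apply/not_exists2P => nosink.
have [y y_ok] := dynkin_certificate.
(* The choice of an arrow out of each vertex of [S] is injective, as an arrow determines its source;
   hence at least as many arrows as vertices lie within [S]. *)
have /fin_all_exists[g gP] x : exists a : option (arrow Q), x \in S ->
    exists b, [/\ a = Some b, src b = x & tgt b \in S].
  case: (boolP (x \in S)) => xS; last by exists None.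
  have [//|nx] := nosink x; have [b bP] : exists b, src b = x /\ tgt b \in S.
    apply: contrapT => nb; apply: nx => b bx; apply/negP => tS; apply: nb.
    by exists b.
  by exists (Some b) => _; exists b; case: bP.
pose d : dim_vector Q := [ffun x => (x \in S) : nat].
have : tits_form d <= 0.
  rewrite /tits_form subr_le0.
  have -> : \sum_i (d i)%:Z ^+ 2 = #|S|%:Z.
    rewrite -sum1_card -natz natr_sum [RHS]big_mkcond /=; apply: eq_bigr => x _.
    by rewrite ffunE; case: (x \in S).
  have -> : \sum_(a : arrow Q) (d (src a))%:Z * (d (tgt a))%:Z
      = #|[set a : arrow Q | (src a \in S) && (tgt a \in S)]|%:Z.
    rewrite -sum1_card -natz natr_sum [RHS]big_mkcond /=; apply: eq_bigr => a _.
    by rewrite !ffunE inE; case: (src a \in S); case: (tgt a \in S).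
  rewrite lez_nat -(card_in_imset (f := g)).
    rewrite -[X in (_ <= X)%N](card_imset _ (@Some_inj _)); apply/subset_leq_card/fintype.subsetP => _ /imsetP[x xS ->].
    have [b [-> bx tS]] := gP x xS; apply: imset_f.
    by rewrite inE bx xS tS.
  move=> x z xS zS; have [b [-> <- _]] := gP x xS; have [c [-> <- _]] := gP z zS.
  by case=> ->.
have /finset.set0Pn[x xS] := S0.
have : 0 < qdim adjacent d.
  rewrite lt_neqAle; apply/andP; split.
    rewrite eq_sym; apply/eqP => /(qdim_eq0 adjacent_sym y_ok)/ffunP/(_ x).
    by rewrite !ffunE xS.
  have := qform_bound adjacent_sym y_ok (fun x => (d x)%:Z) x; rewrite -/(qdim _ d).
  have := y_gt0 y_ok x; nia.
by rewrite qdim_tits; lia.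
Qed.

(** Removing sinks one after another orders the vertices so that every arrow goes from a later to an
    earlier one; [arr] then recovers the orientation of [Q]. *)
Lemma exists_order : exists p : seq T, enumerates p /\
  forall x z, arr adjacent p x z <-> exists a, src a = x /\ tgt a = z.
Proof.
suff H (S : {set T}) : exists p, [/\ uniq p, p =i S &
    forall a, src a \in S -> tgt a \in S -> (index (tgt a) p < index (src a) p)%N].
  have [p [up pS ordp]] := H finset.setT.
  exists p; split; first by split=> // x; rewrite pS inE.
  have arrP a : arr adjacent p (src a) (tgt a).
    by rewrite /arr adjacent_arrow ordp ?inE.
  move=> x z; split=> [/andP[/card_gt0P[a]]|[a [<- <-]]//].
  rewrite inE => /orP[/andP[/eqP sx /eqP tz] _|/andP[/eqP sz /eqP tx]].
    by exists a.
  by have /andP[_] := arrP a; rewrite sz tx; lia.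
have [n] := ubnP #|S|; elim: n S => // n IH S cS.
have [->|S0] := eqVneq S finset.set0.
  by exists [::]; split=> // [x|a]; rewrite ?inE.
have [x xS xsink] := exists_sink S0.
have [|p [up pS ordp]] := IH (S :\ x); first by rewrite [#|S|](cardsD1 x) xS in cS.
exists (x :: p); split=> /=.
- by rewrite up pS !inE eqxx.
- by move=> z; rewrite !inE pS !inE; case: eqP => // ->.
move=> a sS tS; case: (eqVneq x (src a)) => [xs|xs].
  by have := xsink a (esym xs); rewrite tS.
case: eqVneq => [//|xt]; rewrite ltnS ordp // !inE ?sS ?tS andbT eq_sym //.
Qed.

End DynkinQuiver.

(** * From representations to systems of subspaces *)

Lemma lfun_bijective (K : fieldType) (A B : vectType K) (f : 'Hom(A, B)) :
  bijective f <-> lker f = 0%VS /\ limg f = fullv.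
Proof.
split=> [[g fK gK]|[k0 im]].
  split; first by apply/eqP/lker0P/(can_inj fK).
  by apply/vspaceP => v; rewrite memvf -[v]gK memv_img ?memvf.
exists (f^-1)%VF; first by apply: lker0_lfunK; rewrite k0.
by move=> v; rewrite limg_lfunVK // im memvf.
Qed.

Lemma bijective_dim (K : fieldType) (A B : vectType K) (f : 'Hom(A, B)) :
  bijective f -> \dim {:A} = \dim {:B}.
Proof.
move/lfun_bijective => [k0 im]; have := limg_ker_dim f fullv.
by rewrite k0 capv0 dimv0 im.
Qed.

Lemma exists_bijective (K : fieldType) (A B : vectType K) : \dim {:A} = \dim {:B} ->
  exists f : 'Hom(A, B), bijective f.
Proof.
move=> dAB; have [|f [inj _]] := @exists_injective_on K A B fullv fullv; first by rewrite dAB.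
exists f; apply/lfun_bijective; split.
  by have /injective_onP := inj; rewrite capfv.
apply/eqP; rewrite eqEdim subvf -dAB /=.
by have /dim_injective_on-> := inj; rewrite leqnn.
Qed.

Lemma dim_subvs (K : fieldType) (A : vectType K) (U : {vspace A}) :
  \dim {: subvs_of U} = \dim U.
Proof. by rewrite dimvf. Qed.

Section QuotientSimple.
Variables (K : fieldType) (Q : quiver) (X : rep K Q).
Hypothesis loopless : forall a : arrow Q, src a != tgt a.

(** Without loops, every map in a representation with the dimension vector of a simple one is zero,
    so the dimensions alone decide. *)
Lemma quot_simpleP (U : subfamily X) i :
  iso (quot U) (simple_rep K i) <-> forall j, (\dim (U j) + (j == i) = \dim {:X j})%N.
Proof.
have dimq j : \dim {: quot U j} = (\dim {:X j} - \dim (U j))%N.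
  by rewrite dim_subvs dimv_compl.
have dims j : \dim {: simple_rep K i j} = (j == i) by rewrite dimvf -[RHS]mul1n.
have leU j : (\dim (U j) <= \dim {:X j})%N by rewrite dimvS ?subvf.
split=> [[phi [bij _]] j|dimE].
  by have := bijective_dim (bij j); rewrite dimq dims => <-; rewrite subnKC.
have /fin_all_exists[phi bij] j : exists f : 'Hom(quot U j, simple_rep K i j), bijective f.
  apply: exists_bijective; rewrite dimq dims; have := dimE j; have := leU j; lia.
have zero j : j != i -> forall u : simple_rep K i j, u = 0.
  move=> ji u; apply/eqP; rewrite -memv0; suff -> : (0%VS = fullv :> {vspace simple_rep K i j}).
    exact: memvf.
  by apply/eqP; rewrite eq_sym -dimv_eq0 dims (negbTE ji).
exists phi; split=> // a; apply/lfunP => v; rewrite !comp_lfunE.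
case: (eqVneq (tgt a) i) => [ti|ti]; last by rewrite [LHS]zero // [RHS]zero.
suff -> : v = 0 by rewrite !linear0.
have [g gK _] := bij (src a); rewrite -[v]gK (zero _ _ (phi (src a) v)); last first.
  by rewrite -ti.
by rewrite -[RHS]gK linear0.
Qed.

Lemma dim_sub_in (W U : subfamily X) j : (U j <= W j)%VS -> \dim (sub_in W U j) = \dim (U j).
Proof.
move=> UW; have vE (v : subvs_of (W j)) : linfun vsval v = vsval v by rewrite lfunE.
rewrite -(dim_injective_on (linfun vsval) _).1; last first.
  by move=> v _; rewrite vE => v0; apply: val_inj.
congr (\dim _); rewrite lpreimK //; apply: subv_trans UW _; apply/subvP => v vW.
by apply/memv_imgP; exists (vsproj (W j) v); rewrite ?memvf // vE vsprojK.
Qed.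

End QuotientSimple.

Section Models.
Variables (K : fieldType) (Q : quiver).
Hypothesis dQ : dynkin Q.
Notation T := (vertex Q).
Variable p : seq T.
Hypothesis arrowP : forall x z, arr (@adjacent Q) p x z <-> exists a, src a = x /\ tgt a = z.
Notation r := (arr (@adjacent Q) p).

Section Space.
Variable E : vectType K.
Implicit Types (f : T -> T -> 'End(E)) (V W : T -> {vspace E}).

(** A copy of [X] inside the single space [E], to which the results on systems of subspaces
    apply. *)
Record models (X : rep K Q) (iota : forall x, 'Hom(X x, E)) f V : Prop := Models {
  model_inj : forall x, lker (iota x) = 0%VS;
  model_img : forall x, limg (iota x) = V x;
  model_com : forall a v, iota (tgt a) (rmap X a v) = f (src a) (tgt a) (iota (src a) v) }.

Lemma parallel_arrows (a b : arrow Q) : src a = src b -> tgt a = tgt b -> a = b.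
Proof.
move=> sab tab; have : (nb_edges (src a) (tgt a) <= 1)%N by rewrite nb_edgesE // leq_b1.
by move/card_le1_eqP; apply; rewrite inE ?sab ?tab !eqxx.
Qed.

Lemma exists_model (X : rep K Q) : (forall x, \dim {:X x} <= \dim {:E})%N ->
  exists iota f V, models (X := X) iota f V.
Proof.
move=> dX; have /fin_all_exists[iota injP] x : exists h : 'Hom(X x, E), lker h = 0%VS.
  have [h [inj _]] := exists_injective_on (dX x); exists h.
  by have /injective_onP := inj; rewrite capfv.
pose ext (a : arrow Q) : 'End(E) :=
  (iota (tgt a) \o rmap X a \o (iota (src a))^-1)%VF.
(* A Dynkin quiver has no parallel arrows, so the sum has at most one term. *)
exists iota, (fun x z => \sum_(a | (src a == x) && (tgt a == z)) ext a),
  (fun x => limg (iota x)); split=> // a v.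
rewrite (big_pred1 a) => [|b]; last first.
  apply/andP/eqP => [[/eqP sab /eqP tab]|->//]; exact: parallel_arrows.
by rewrite !comp_lfunE lker0_lfunK ?injP.
Qed.

Section Model.
Variables (X : rep K Q) (iota : forall x, 'Hom(X x, E)).
Variables (f : T -> T -> 'End(E)) (V : T -> {vspace E}).
Hypothesis M : models iota f V.

Lemma iota_inj x : injective (iota x).
Proof. by apply/lker0P; rewrite (model_inj M). Qed.

Lemma model_dim x : \dim (V x) = \dim {:X x}.
Proof.
by rewrite -(model_img M) limg_dim_eq // (model_inj M) capv0.
Qed.

Definition image_family (U : subfamily X) : T -> {vspace E} := fun x => (iota x @: U x)%VS.
Definition preim_family W : subfamily X := fun x => (iota x @^-1: W x)%VS.

Lemma memv_image (U : subfamily X) x v : (iota x v \in image_family U x) = (v \in U x).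
Proof.
apply/memv_imgP/idP => [[u uU /iota_inj->]//|vU].
by exists v.
Qed.

Lemma image_familyK (U : subfamily X) x : preim_family (image_family U) x = U x.
Proof. by apply/vspaceP => v; rewrite -memv_preim memv_image. Qed.

Lemma preim_familyK W x : (W x <= V x)%VS -> image_family (preim_family W) x = W x.
Proof. by move=> WV; rewrite /image_family /preim_family lpreimK // (model_img M). Qed.

Lemma image_sub (U : subfamily X) x : (image_family U x <= V x)%VS.
Proof. by rewrite -(model_img M) limgS ?subvf. Qed.

Lemma image_dim (U : subfamily X) x : \dim (image_family U x) = \dim (U x).
Proof. by rewrite limg_dim_eq // (model_inj M) capv0. Qed.

Lemma image_subE (U U' : subfamily X) x :
  (image_family U x <= image_family U' x)%VS = (U x <= U' x)%VS.
Proof. by rewrite limg_ker0 ?(model_inj M). Qed.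

Lemma image_stable (U : subfamily X) : subrep U <-> stable r f (image_family U).
Proof.
split=> [sub|/stableP st a].
  apply/stableP => x z /arrowP[a [<- <-]] _ /memv_imgP[v vU ->].
  rewrite -(model_com M) memv_img //; apply: (subvP (sub a)); exact: memv_img.
apply/subvP => _ /memv_imgP[v vU ->]; rewrite -memv_image (model_com M) st ?memv_image //.
by apply/arrowP; exists a.
Qed.

Lemma model_stable : stable r f V.
Proof.
have -> : V = image_family (fun=> fullv) by apply: funext => x; rewrite -(model_img M).
by apply/image_stable => a; rewrite subvf.
Qed.

Lemma model_restr (U : subfamily X) : subrep U ->
  models (X := restr U) (fun x => iota x \o linfun vsval)%VF f (image_family U).
Proof.
move=> sub; have vE x (v : subvs_of (U x)) : linfun vsval v = vsval v by rewrite lfunE.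
split=> [x|x|a v].
- apply/eqP/lker0P => u v; rewrite !comp_lfunE !vE => /iota_inj; exact: val_inj.
- rewrite limg_comp; congr (_ @: _)%VS; apply/vspaceP => v; apply/memv_imgP/idP.
    by case=> u _ ->; rewrite vE subvsP.
  by move=> vU; exists (vsproj (U x) v); rewrite ?memvf // vE vsprojK.
- rewrite !comp_lfunE !vE.
  rewrite (lfunE (vsproj (U (tgt a)) \o (rmap X a \o vsval))) /= vsprojK ?(model_com M) //.
  by apply: (subvP (sub a)); rewrite memv_img // subvsP.
Qed.

Lemma model_full_sub W : (forall x, (W x <= V x)%VS) -> image_family (preim_family W) = W.
Proof. by move=> WV; apply: funext => x; rewrite preim_familyK. Qed.

Lemma model_zero : zero_family V <-> forall i, {:X i}%VS = 0%VS.
Proof.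
split=> V0 x; apply/eqP; rewrite -dimv_eq0; last by rewrite model_dim V0 dimv0.
by rewrite -model_dim V0 dimv0.
Qed.

Lemma model_indecomposable : indecomposable X <-> indec r f V /\ ~ zero_family V.
Proof.
have VE x : image_family (fun=> fullv) x = V x by rewrite -(model_img M).
split=> [[[i Xi] ind]|[ind nz]].
  split; last by move/model_zero/(_ i)/eqP; rewrite (negbTE Xi).
  move=> U1 U2 st1 st2 UV.
  have le1 x : (U1 x <= V x)%VS by have [<- _] := UV x; rewrite addvSl.
  have le2 x : (U2 x <= V x)%VS by have [<- _] := UV x; rewrite addvSr.
  have zero W : (forall x, (W x <= V x)%VS) -> (forall i, preim_family W i = 0%VS) ->
      zero_family W.
    by move=> le z x; rewrite -(preim_familyK (le x)) /image_family z limg0.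
  have [||j|z|z] := ind (preim_family U1) (preim_family U2).
  - by apply/image_stable; rewrite model_full_sub.
  - by apply/image_stable; rewrite model_full_sub.
  - have [sumU capU] := UV j; split; apply/vspaceP => v.
      rewrite memvf; have : iota j v \in (U1 j + U2 j)%VS.
        by rewrite sumU -(model_img M) memv_img ?memvf.
      case/memv_addP => u1 u1U [u2 u2U E1]; apply/memv_addP.
      have : u1 \in V j by apply: (subvP (le1 j)).
      have : u2 \in V j by apply: (subvP (le2 j)).
      rewrite -(model_img M) => /memv_imgP[v2 _ E2] /memv_imgP[v1 _ E3].
      exists v1; first by rewrite -memv_preim -E3.
      exists v2; first by rewrite -memv_preim -E2.
      by apply: (@iota_inj j); rewrite linearD /= -E2 -E3.
    rewrite memv_cap -!memv_preim -memv_cap capU !memv0.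
    by rewrite -(inj_eq (@iota_inj j)) linear0.
  - by left; apply: zero.
  - by right; apply: zero.
split.
  apply: contrapT => nX; apply: nz; apply/model_zero => i; apply/eqP/negPn/negP => Xi.
  by apply: nX; exists i.
move=> U W subU subW UW.
have zero (A : subfamily X) : zero_family (image_family A) -> forall i, A i = 0%VS.
  by move=> z i; rewrite -(image_familyK A i) /preim_family z lpreim0 (model_inj M).
have [||x|z|z] := ind (image_family U) (image_family W).
- exact/image_stable.
- exact/image_stable.
- have [sumU capU] := UW x; rewrite /image_family -limgD sumU (model_img M); split=> //.
  apply/eqP; rewrite -subv0; apply/subvP => _ /memv_capP[/memv_imgP[v vU ->]].
  by rewrite memv_image memv0 => vW; rewrite (_ : v = 0) ?linear0 //; apply/eqP;
    rewrite -memv0 -capU memv_cap vU.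
- by left; apply: zero.
- by right; apply: zero.
Qed.

End Model.

Lemma model_iso (X Y : rep K Q) iota f V : models (X := X) iota f V -> iso X Y ->
  exists kappa, models (X := Y) kappa f V.
Proof.
move=> M [phi [bij com]].
have pinv x : lker (phi x) = 0%VS /\ limg (phi x) = fullv by apply/lfun_bijective.
have phiK x v : phi x ((phi x)^-1%VF v) = v.
  by rewrite limg_lfunVK //; have [_ ->] := pinv x; rewrite memvf.
have phiK' x v : (phi x)^-1%VF (phi x v) = v by rewrite lker0_lfunK //; have [-> _] := pinv x.
exists (fun x => iota x \o (phi x)^-1)%VF; split=> [x|x|a v].
- apply/eqP/lker0P => u v; rewrite !comp_lfunE => /(iota_inj M) E1.
  by rewrite -[u]phiK E1 phiK.
- rewrite limg_comp -(model_img M); congr (_ @: _)%VS; apply/vspaceP => v.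
  by rewrite memvf -[v]phiK' memv_img ?memvf.
- rewrite !comp_lfunE -(model_com M); congr (iota _ _).
  rewrite -[RHS]phiK'; congr ((phi _)^-1%VF _).
  by have /lfunP/(_ ((phi (src a))^-1%VF v)) := com a; rewrite !comp_lfunE phiK.
Qed.

Lemma iso_of_models (X Y : rep K Q) iota f V kappa g W h :
  models (X := X) iota f V -> models (X := Y) kappa g W -> sys_iso r f V g W h -> iso X Y.
Proof.
move=> MX MY [himg hinj hcom].
have hV x v : h x (iota x v) \in limg (kappa x).
  by rewrite (model_img MY) -himg memv_img // -(model_img MX) memv_img ?memvf.
pose phi x : 'Hom(X x, Y x) := ((kappa x)^-1 \o h x \o iota x)%VF.
have phiE x v : kappa x (phi x v) = h x (iota x v).
  by rewrite !comp_lfunE limg_lfunVK.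
have phi_inj x : lker (phi x) = 0%VS.
  apply/eqP/lker0P => u v E1; apply: (iota_inj MX).
  apply: (injective_on_eq (hinj x)); rewrite -?phiE ?E1 //;
    by rewrite -(model_img MX) memv_img ?memvf.
exists phi; split=> [x|a].
  apply/lfun_bijective; split=> //; apply/eqP; rewrite eqEdim subvf /=.
  rewrite (limg_dim_eq (U := fullv)) ?phi_inj ?capv0 //.
  rewrite -(model_dim MX) -(model_dim MY) -himg.
  by have /dim_injective_on-> := hinj x.
apply/lfunP => v; apply: (iota_inj MY).
rewrite (comp_lfunE (phi (tgt a)) (rmap X a)) (comp_lfunE (rmap Y a) (phi (src a))).
rewrite phiE (model_com MX) (model_com MY).
rewrite phiE hcom //; first by apply/arrowP; exists a.
by rewrite -(model_img MX) memv_img ?memvf.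
Qed.

Lemma rep_of_system f V : stable r f V -> exists X iota, models (X := X) iota f V.
Proof.
move=> /stableP st.
have vE x (v : subvs_of (V x)) : linfun vsval v = vsval v by rewrite lfunE.
pose X := @Rep K Q (fun x => subvs_of (V x))
  (fun a => (linfun (vsproj (V (tgt a))) \o f (src a) (tgt a) \o linfun vsval)%VF).
exists X, (fun x => linfun vsval); split=> [x|x|a v].
- by apply/eqP/lker0P => u v; rewrite !vE => /val_inj.
- apply/vspaceP => v; apply/memv_imgP/idP => [[u _ ->]|vV]; first by rewrite vE subvsP.
  by exists (vsproj (V x) v); rewrite ?memvf // vE vsprojK.
- rewrite /= !vE !comp_lfunE lfunE /= vE vsprojK //; apply: st; last exact: subvsP.
  by apply/arrowP; exists a.
Qed.

End Space.

End Models.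

(** * Isomorphism classes and filtrations *)

Section DirectSums.
Variables (K : fieldType) (E : vectType K) (T : finType).
Implicit Types (f : T -> T -> 'End(E)) (V : T -> {vspace E}) (r : rel T).

Lemma decomposed_reindex r f V (I J : finType) (h : I -> J) (Z : J -> T -> {vspace E}) :
  bijective h -> decomposed r f V Z -> decomposed r f V (fun i => Z (h i)).
Proof.
move=> [g hK gK] [st dir sumV].
have onh : {on [pred j : J | true], bijective h} by exists g => ? _; [exact: hK | exact: gK].
have sumE x : (\sum_i Z (h i) x = \sum_j Z j x)%VS by rewrite [RHS](reindex h).
split=> [i|x|x]; [exact: st | | by rewrite sumE].
apply/directvP => /=; rewrite sumE; have /directvP /= -> := dir x.
by rewrite (reindex h).
Qed.

Definition sum_parts (I J : Type) (W : I -> T -> {vspace E}) (Z : J -> T -> {vspace E})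
  (ij : I + J) : T -> {vspace E} := match ij with inl i => W i | inr j => Z j end.

Lemma exists_indec_decomposition r f V : stable r f V ->
  exists (I : finType) (W : I -> T -> {vspace E}),
    indec_decomposed r f V W /\ forall i, ~ zero_family (W i).
Proof.
have [n] := ubnP (\sum_x \dim (V x))%N; elim: n V => // n IH V Vn st.
have [V0|nz] := pselect (zero_family V).
  exists void, (fun _ _ => 0%VS); split; last by case.
  split; last by case.
  split=> [[]|x|x]; last by rewrite big1.
  by apply/directv_sum_independent => ? ? ? [].
have [ind|nind] := pselect (indec r f V).
  exists unit, (fun=> V); split=> //; split=> //.
  have sum1 x : (\sum_(i : unit) V x = V x)%VS by rewrite (big_pred1 tt) //; case.
  split=> [//|x|x]; rewrite ?sum1 //.
  apply/directv_sum_independent => us _; rewrite (big_pred1 tt); last by case.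
  by move=> us0 [].
have [U1 [U2 [st1 st2 UV nz1 nz2]]] : exists U1 U2, [/\ stable r f U1, stable r f U2,
    forall x, (U1 x + U2 x = V x)%VS /\ (U1 x :&: U2 x = 0)%VS,
    ~ zero_family U1 & ~ zero_family U2].
  apply: contrapT => nU; apply: nind => U1 U2 st1 st2 UV.
  apply: contrapT => /not_orP[z1 z2]; apply: nU; by exists U1, U2.
have dimV x : (\dim (V x) = \dim (U1 x) + \dim (U2 x))%N.
  by have [<- cap] := UV x; rewrite -dimv_sum_cap cap dimv0 addn0.
have pos (U : T -> {vspace E}) : ~ zero_family U -> (0 < \sum_x \dim (U x))%N.
  move=> nzU; rewrite lt0n sum_nat_eq0; apply/negP => /forallP z; apply: nzU => x.
  by apply/eqP; rewrite -dimv_eq0; have := z x.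
have sumV : (\sum_x \dim (V x) = \sum_x \dim (U1 x) + \sum_x \dim (U2 x))%N.
  by rewrite -big_split; apply: eq_bigr => x _; rewrite dimV.
have p1 := pos _ nz1; have p2 := pos _ nz2.
have [|I [W [[[stW dirW sumW] indW] nzW]]] := IH U1 _ st1; first by lia.
have [|J [Z [[[stZ dirZ sumZ] indZ] nzZ]]] := IH U2 _ st2; first by lia.
exists (I + J)%type, (sum_parts W Z); split; last by case.
split; last by case.
have sumE x : (\sum_ij sum_parts W Z ij x = V x)%VS.
  by rewrite big_sumType /= sumW sumZ; have [] := UV x.
split=> [[]|x|] //; apply/directvP; rewrite /= sumE dimV big_sumType /= -sumW -sumZ.
by have /directvP /= -> := dirW x; have /directvP /= -> := dirZ x.
Qed.

End DirectSums.

Section Classes.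
Variable Q : quiver.
Hypothesis dQ : dynkin Q.
Notation T := (vertex Q).
Notation e := (@adjacent Q).
Variables (y : T -> nat) (p : seq T).
Hypothesis y_ok : forall x, (hat e y x < 2 * y x)%N.
Hypothesis pE : enumerates p.
Hypothesis arrowP : forall x z, arr e p x z <-> exists a, src a = x /\ tgt a = z.
Notation r := (arr e p).
Let e_sym : symmetric e := @adjacent_sym Q.
Let eirr : irreflexive e := adjacent_irr dQ.

Definition class_parts (alpha : rep_class Q) : finType :=
  {b : finsupp alpha & 'I_(alpha (val b))}.
Definition part_root alpha (t : class_parts alpha) : pos_root Q := val (tag t).
Definition class_dims alpha : seq (dim_vector Q) :=
  [seq val (part_root t) | t <- enum (class_parts alpha)].

Lemma class_dims_roots alpha : all (root0 e) (class_dims alpha).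
Proof.
by apply/allP => _ /mapP[t _ ->]; rewrite /root0 root_qdim // eqxx.
Qed.

Lemma root_neq0 (b : pos_root Q) : val b != [ffun=> 0%N].
Proof. by apply/eqP => b0; have := root_qdim dQ b; rewrite b0 qdim0. Qed.

(** Any larger number of passes works too, so that two classes can be compared along the same
    run. *)
Lemma runs_eq0 (bs : seq (dim_vector Q)) : all (root0 e) bs ->
  exists N, forall M, (N <= M)%N ->
    all (fun B => run e (flatten (nseq M p)) B == [ffun=> 0%N]) bs.
Proof.
elim: bs => [|B bs IH] /=; first by exists 0%N.
case/andP => RB /IH[N NP]; have [N' N'P] : exists N, run e (flatten (nseq N p)) B = [ffun=> 0%N].
  case/orP: RB => /eqP h; last by exists 0%N; rewrite h.
  have [|N' N'P] := not_exact_run e_sym eirr y_ok (proj1 pE) (proj2 pE) (B := B).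
    by move=> B0; move: h; rewrite B0 qdim0.
  by exists N'; apply: (root_run_eq0 e_sym eirr y_ok h).
exists (maxn N N') => M; rewrite geq_max => /andP[NM N'M]; rewrite NP // andbT.
by rewrite -(subnKC N'M) nseqD flatten_cat run_cat N'P run0.
Qed.

(** The multiset prescribes the index type of the summands in [has_class]; a decomposition found
    otherwise is re-indexed along this bijection. *)
Lemma class_parts_bij (alpha : rep_class Q) (J : finType) (b : J -> pos_root Q) :
  (forall c, #|[pred j | b j == c]| = alpha c) ->
  exists h : class_parts alpha -> J, bijective h /\ forall t, b (h t) = part_root t.
Proof.
move=> cE; pose h (t : class_parts alpha) : J :=
  enum_val (cast_ord (esym (cE (part_root t))) (tagged t)).
have hb t : b (h t) = part_root t.
  by have := enum_valP (cast_ord (esym (cE (part_root t))) (tagged t)); rewrite inE => /eqP.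
exists h; split=> //.
have surj j : exists t, h t = j.
  have aj : j \in [pred j' | b j' == b j] by rewrite inE.
  have bs : b j \in finsupp alpha.
    rewrite mem_finsupp -cE -lt0n; apply/card_gt0P; by exists j.
  pose k := cast_ord (cE (b j)) (enum_rank_in aj j).
  exists (existT (fun c : finsupp alpha => 'I_(alpha (val c))) [` bs]%fset k).
  rewrite /h /part_root /=.
  have -> : cast_ord (esym (cE (b j))) k = enum_rank_in aj j by apply: val_inj.
  by rewrite enum_rankK_in.
have inj : injective h.
  move=> [c k] [c' k'] hE; have := hb (existT _ c k); rewrite hE hb => /val_inj /= cc.
  case: _ / cc in k hE *; congr existT; apply: val_inj.
  by have /(congr1 val) := enum_val_inj hE.
have /fin_all_exists[g gP] := surj; exists g => // t; exact/inj/gP.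
Qed.

Lemma count_class_dims (alpha : rep_class Q) (b : pos_root Q) : count_mem (val b) (class_dims alpha) = alpha b.
Proof.
rewrite /class_dims count_map -sum1_count big_enum_cond /=.
rewrite (eq_bigl (fun t : class_parts alpha => true && (val (tag t) == b))); last first.
  by move=> t /=; rewrite -val_eqE.
rewrite -(sig_big_dep predT (fun (c : finsupp alpha) (_ : 'I_(alpha (val c))) => val c == b)
  (fun _ _ => 1%N)) /=.
rewrite (eq_bigr (fun c : finsupp alpha => (val c == b) * alpha (val c)))%N; last first.
  move=> c _; case: eqP => _; last by rewrite big_pred0.
  by rewrite sum1_card card_ord mul1n.
case: (boolP (b \in finsupp alpha)) => [bs|bs].
  rewrite (bigD1 [` bs]%fset) //= eqxx mul1n big1 ?addn0 // => c cb.
  by case: eqP => // E1; case/eqP: cb; apply: val_inj.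
rewrite big1 => [|c _]; first by rewrite fsfun_dflt.
by case: eqP => // E1; move: (valP c) bs; rewrite E1 => ->.
Qed.

Lemma class_dims_inj alpha beta : perm_eq (class_dims alpha) (class_dims beta) -> alpha = beta.
Proof.
move=> /permP ab; apply/msetP => b.
by rewrite -!count_class_dims ab.
Qed.

Section Space.
Variables (K : fieldType) (E : vectType K).
Implicit Types (f : T -> T -> 'End(E)) (V : T -> {vspace E}).

Lemma model_class (X : rep K Q) iota f V alpha : models (X := X) (E := E) iota f V ->
  has_class X alpha <-> exists W : class_parts alpha -> T -> {vspace E},
    indec_decomposed r f V W /\ part_dims W = class_dims alpha.
Proof.
move=> M; have VE x : (iota x @: fullv = V x)%VS by rewrite (model_img M).
split=> [[U [parts sumU]]|[W [[[st dir sumW] ind] dimW]]].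
  exists (fun t => image_family iota (U t)); split.
    split.
      split=> [t|x|x].
      - by apply/(image_stable arrowP M); have [] := parts t.
      - have [/directvP /= dirU sumUx] := sumU x.
        apply/directvP => /=; rewrite /image_family -limg_sum.
        rewrite limg_dim_eq ?(model_inj M) ?capv0 // dirU; apply: eq_bigr => t _.
        by rewrite limg_dim_eq // (model_inj M) capv0.
      - by have [_ sumUx] := sumU x; rewrite /image_family -limg_sum sumUx VE.
    move=> t; have [sub ind _] := parts t.
    by have [] := proj1 (model_indecomposable arrowP (model_restr M sub)) ind.
  rewrite /part_dims /class_dims; apply: eq_map => t.
  have [_ _ <-] := parts t; apply/ffunP => x; rewrite !ffunE.
  by rewrite (image_dim M) dim_subvs.
have dimWt t : dimf (W t) = val (part_root t).
  move/eq_in_map: dimW => /(_ t); apply; exact: mem_enum.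
have WV t x : (W t x <= V x)%VS by rewrite -sumW (sumv_sup t).
pose U t := preim_family iota (W t).
have UE t : image_family iota (U t) = W t by apply: (model_full_sub M).
have sub t : subrep (U t) by apply/(image_stable arrowP M); rewrite UE.
exists U; split=> [t|x].
  split=> //.
    apply/(model_indecomposable arrowP (model_restr M (sub t))); rewrite UE; split=> //.
    by move/dimf_eq0; rewrite dimWt; apply/eqP; exact: root_neq0.
  rewrite -[RHS]dimWt; apply/ffunP => x; rewrite !ffunE.
  by rewrite dim_subvs -(image_dim M) UE.
have sumUx : (\sum_t U t x = fullv)%VS.
  apply/eqP; rewrite eqEdim subvf /= -(model_dim M) -sumW.
  rewrite -(limg_dim_eq (f := iota x) (U := (\sum_t U t x)%VS)) ?(model_inj M) ?capv0 //.
  have imE : (\sum_t (iota x @: U t x) = \sum_t W t x)%VS.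
    by apply: eq_bigr => t _; rewrite -[LHS]/(image_family iota (U t) x) UE.
  by rewrite limg_sum imE.
split=> //; apply/directvP => /=; rewrite sumUx -(model_dim M) -sumW.
have /directvP /= -> := dir x; apply: eq_bigr => t _.
by rewrite -UE (image_dim M).
Qed.

Lemma indec_decomposed_class f V (J : finType) (Z : J -> T -> {vspace E}) (b : J -> pos_root Q)
    (alpha : rep_class Q) :
  indec_decomposed r f V Z -> (forall j, dimf (Z j) = val (b j)) ->
  (forall c, #|[pred j | b j == c]| = alpha c) ->
  exists W : class_parts alpha -> T -> {vspace E},
    indec_decomposed r f V W /\ part_dims W = class_dims alpha.
Proof.
move=> [dec ind] dimZ cE; have [h [hbij hb]] := class_parts_bij cE.
exists (fun t => Z (h t)); split.
  by split=> [|t]; [exact: decomposed_reindex | exact: ind].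
by apply: eq_map => t; rewrite dimZ hb.
Qed.

End Space.

Definition space_bound (n : nat) : nat := #|T| * (n * (2 * \sum_t y t)).

Lemma dim_row (K : fieldType) N : \dim {: 'rV[K]_N} = N.
Proof. by rewrite dimvf -[RHS]mul1n. Qed.

Lemma exists_row_model (K : fieldType) (X : rep K Q) N : (forall x, \dim {:X x} <= N)%N ->
  exists iota f V, models (X := X) (E := 'rV[K]_N) iota f V.
Proof. by move=> dX; apply: exists_model => // x; rewrite dim_row. Qed.

(** The ambient space has to be chosen before the summands of a representation are known; this
    bounds the form on all possible ones. *)
Lemma qdim_le (B D : dim_vector Q) : (forall x, B x <= D x)%N ->
  (`|qdim e B| <= \sum_x D x * (2 * D x + hat e D x))%N.
Proof.
move=> BD; have hatBD x : (hat e B x <= hat e D x)%N by apply: leq_sum.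
rewrite -lez_nat abszE /qdim /qform (le_trans (ler_norm_sum _ _ _)) //.
rewrite -natz natr_sum; apply: ler_sum => x _; rewrite natz hatZ normrM.
have := BD x; have := hatBD x; set a := hat e B x; set b := hat e D x => ab BDx.
by rewrite [leRHS]natz PoszM; apply: ler_pM => //; lia.
Qed.

Lemma exists_class (K : fieldType) (X : rep K Q) : exists alpha, has_class X alpha.
Proof.
pose D := dimvec X; have DE x : D x = \dim {:X x} by rewrite ffunE.
pose q := (\sum_x D x * (2 * D x + hat e D x))%N.
(* The first term leaves room for [X], the second for the reflections of any indecomposable summand,
   as [indec_root] requires. *)
pose N := (\sum_x D x + #|T| * (\sum_t y t * q))%N.
have [|iota [f [V M]]] := @exists_row_model K X N.
  by move=> x; rewrite /N -DE (bigD1 x) //= -!addnA leq_addr.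
have [J [Z [decZ nzZ]]] := exists_indec_decomposition (model_stable arrowP M).
have [[stZ dirZ sumZ] indZ] := decZ.
have root j : tits_form (dimf (Z j)) == 1.
  have nz : dimf (Z j) <> [ffun=> 0%N] by move/dimf_eq0; apply: nzZ.
  have [n nex] := not_exact_run e_sym eirr y_ok (proj1 pE) (proj2 pE) nz.
  have : qdim e (dimf (Z j)) = 2.
    apply: (indec_root e_sym eirr y_ok pE (follows_flatten n p) (stZ j) (indZ j)) => //.
    rewrite dim_row /N; apply: leq_trans (leq_addl _ _); rewrite leq_mul2l.
    apply/orP; right; apply: leq_sum => t _; rewrite leq_mul2l; apply/orP; right.
    apply: qdim_le => x; rewrite DE -(model_dim M) ffunE dimvS //.
    by rewrite -sumZ (sumv_sup j).
  by rewrite (qdim_tits dQ) => h; apply/eqP; lia.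
pose b j : pos_root Q := exist _ (dimf (Z j)) (root j).
pose alpha : rep_class Q := seq_mset [seq b j | j <- enum J].
exists alpha; apply/(model_class _ M); apply: (indec_decomposed_class decZ (b := b)) => // c.
rewrite /alpha mset_seqE count_map -sum1_count big_enum_cond /= sum1_card.
by apply: eq_card => j.
Qed.

Lemma dim_class (K : fieldType) (X : rep K Q) alpha : has_class X alpha ->
  forall x, \dim {:X x} = (\sum_(B <- class_dims alpha) B x)%N.
Proof.
have [|iota [f [V M]]] := @exists_row_model K X (\sum_x \dim {:X x}).
  by move=> x; rewrite (bigD1 x) //= leq_addr.
move=> /(model_class _ M)[W [[dec _] dimW]] x.
by rewrite -(model_dim M) (decomposed_dim x dec) dimW.
Qed.

Lemma size_class_dims alpha : size (class_dims alpha) = #|class_parts alpha|.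
Proof. by rewrite size_map -cardE. Qed.

Lemma class_iso (K : fieldType) (X Y : rep K Q) alpha :
  has_class X alpha -> has_class Y alpha -> iso X Y.
Proof.
move=> cX cY; pose D := (\sum_x \dim {:X x})%N; pose N := (D + space_bound #|class_parts alpha|)%N.
have dX x : (\dim {:X x} <= N)%N.
  by rewrite /N /D (bigD1 x) //= -!addnA leq_addr.
have [iota [f [V MX]]] := exists_row_model dX.
have [|kappa [g [W MY]]] := @exists_row_model K Y N.
  by move=> x; rewrite (dim_class cY) -(dim_class cX).
have [A [decA dimA]] := proj1 (model_class _ MX) cX.
have [B [decB dimB]] := proj1 (model_class _ MY) cY.
have [n /(_ n (leqnn n)) runs] := runs_eq0 (class_dims_roots alpha).
have bnd : root_bound y 'rV[K]_N #|class_parts alpha| by rewrite /root_bound dim_row leq_addl.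
have [|||h hP] := same_dims_iso e_sym eirr y_ok pE (follows_flatten n p) bnd decA decB.
- by rewrite dimA.
- by rewrite dimA class_dims_roots.
- by rewrite dimA.
exact: (iso_of_models arrowP MX MY hP).
Qed.

Lemma iso_class (K : fieldType) (X Y : rep K Q) alpha :
  iso X Y -> has_class X alpha -> has_class Y alpha.
Proof.
have [|iota [f [V M]]] := @exists_row_model K X (\sum_x \dim {:X x}).
  by move=> x; rewrite (bigD1 x) //= leq_addr.
move=> /(model_iso M)[kappa MY] /(model_class _ M) h.
exact/(model_class _ MY).
Qed.

Lemma class_unique (K : fieldType) (X : rep K Q) alpha beta :
  has_class X alpha -> has_class X beta -> alpha = beta.
Proof.
move=> cA cB; pose D := (\sum_x \dim {:X x})%N; pose N := (D + space_bound #|class_parts alpha|)%N.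
have dX x : (\dim {:X x} <= N)%N.
  by rewrite /N /D (bigD1 x) //= -!addnA leq_addr.
have [iota [f [V M]]] := exists_row_model dX.
have [A [decA dimA]] := proj1 (model_class _ M) cA.
have [B [decB dimB]] := proj1 (model_class _ M) cB.
have [n1 r1] := runs_eq0 (class_dims_roots alpha).
have [n2 r2] := runs_eq0 (class_dims_roots beta).
(* One number of passes that kills the roots of both classes. *)
pose n := maxn n1 n2; have {}r1 := r1 n (leq_maxl _ _); have {}r2 := r2 n (leq_maxr _ _).
have := @decomposed_profile _ _ _ e_sym eirr y_ok _ _ _ _ f V _ _ A B pE (follows_flatten n p).
rewrite dimA dimB => /(_ _ decA decB (class_dims_roots alpha)) prof.
apply: class_dims_inj.
have nz gamma : [seq B0 <- class_dims gamma | B0 != [ffun=> 0%N]] = class_dims gamma.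
  by apply/all_filterP/allP => _ /mapP[t _ ->]; exact: root_neq0.
rewrite -(nz alpha) -(nz beta); apply: (profile_inj e_sym eirr y_ok) r1 r2 _.
- exact: class_dims_roots.
- exact: class_dims_roots.
- by apply: prof; rewrite /root_bound dim_row leq_addl.
Qed.

Lemma class_realized (K : fieldType) alpha : exists X : rep K Q, has_class X alpha.
Proof.
pose N := space_bound 1; pose I := class_parts alpha; pose E1 := 'rV[K]_N.
have /fin_all_exists2[F fP _] (t : I) : exists2 fW : (T -> T -> 'End(E1)) * (T -> {vspace E1}),
    [/\ stable r fW.1 fW.2, indec r fW.1 fW.2 & dimf fW.2 = val (part_root t)] & true.
  have rt := root_qdim dQ (part_root t).
  have nz : val (part_root t) <> [ffun=> 0%N] by apply/eqP; exact: root_neq0.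
  have [n nex] := not_exact_run e_sym eirr y_ok (proj1 pE) (proj2 pE) nz.
  have [|f [W fWP]] := exists_indec e_sym eirr y_ok (E := E1) pE (follows_flatten n p) rt nex.
    by rewrite /root_bound dim_row.
  by exists (f, W).
(* One copy of [E1] for each summand; the maps act on tuples componentwise. *)
pose E2 := {ffun I -> E1}.
pose f x z : 'End(E2) := \sum_t (inj_at E1 t \o (F t).1 x z \o proj_at E1 t)%VF.
have fE x z u t : f x z u t = (F t).1 x z (u t).
  rewrite sum_lfunE; under eq_bigr => s _ do rewrite !comp_lfunE proj_atE.
  exact: (sum_inj_at predT (fun s => (F s).1 x z (u s))).
pose V x : {vspace E2} := famspace predT (fun t => (F t).2 x).
pose D t x : {vspace E2} := (inj_at E1 t @: (F t).2 x)%VS.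
have f_inj x z t v : f x z (inj_at E1 t v) = inj_at E1 t ((F t).1 x z v).
  apply/ffunP => s; rewrite fE !inj_atE; case: eqP => [->//|_]; exact: linear0.
(* A representation modelled both in [E1] and in [E2] carries indecomposability from one space to
   the other. *)
have modD t : exists (Xt : rep K Q) (iota1 : forall x, 'Hom(Xt x, E1))
    (iota2 : forall x, 'Hom(Xt x, E2)),
    models iota1 (F t).1 (F t).2 /\ models iota2 f (D t).
  have [st _ _] := fP t; have [Xt [iota M]] := rep_of_system arrowP st.
  exists Xt, iota, (fun x => inj_at E1 t \o iota x)%VF; split=> //; split=> [x|x|a v].
  - apply/eqP/lker0P => u v; rewrite !comp_lfunE => uv; apply: (iota_inj M).
    by have /ffunP/(_ t) := uv; rewrite !inj_atE eqxx.
  - by rewrite limg_comp (model_img M).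
  - by rewrite !comp_lfunE f_inj (model_com M).
have decD : indec_decomposed r f V D.
  split; last first.
    move=> t; have [_ ind dimt] := fP t; have [Xt [i1 [i2 [M1 M2]]]] := modD t.
    have : indecomposable Xt.
      apply/(model_indecomposable arrowP M1); split=> // /dimf_eq0; rewrite dimt.
      by apply/eqP; exact: root_neq0.
    by case/(model_indecomposable arrowP M2).
  split=> [t|x|//].
    by have [Xt [i1 [i2 [M1 M2]]]] := modD t; exact: (model_stable arrowP M2).
  apply/directvP; rewrite /= -/(famspace predT (fun t => (F t).2 x)) dim_famspace.
  apply: eq_bigr => t _; apply/esym/dim_injective_on.
  exact: (inj_at_inj (U := fun t => (F t).2 x)).
have [X [iota M]] := rep_of_system arrowP (decomposed_stable (proj1 decD)).
exists X; apply/(model_class _ M); exists D; split=> //.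
apply: eq_map => t; have [_ _ <-] := fP t; apply/ffunP => x; rewrite !ffunE.
by apply/dim_injective_on; exact: (inj_at_inj (U := fun t => (F t).2 x)).
Qed.

Section Filtrations.
Variables (K : fieldType) (X : rep K Q).

(** The composition factors of the [k]-th step of a filtration of type [w] are the letters of [w]
    after the first [k]. *)
Definition word_dim (w : seq T) (k : 'I_(size w).+1) (x : T) : nat := count_mem x (drop k w).

Lemma count_drop (w : seq T) (k : 'I_(size w)) x :
  count_mem x (drop k w) = (count_mem x (drop k.+1 w) + (x == tnth (in_tuple w) k))%N.
Proof.
by rewrite (drop_nth x) //= addnC (tnth_nth x) eq_sym.
Qed.

(** By [quot_simpleP] the condition on the quotients is one on dimensions. The condition on [X]
    makes the step 0 of the flag the whole space. *)
Lemma filtration_flag N iota f V (w : seq T) : models (X := X) (E := 'rV[K]_N) iota f V ->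
  has_filtration w X <-> (forall x, \dim {:X x} = count_mem x w) /\
    exists F, is_flag r f V (@word_dim w) F.
Proof.
move=> M; have loopless := dynkin_loopless dQ.
split=> [[F [sub F0 Fn mono quotF]]|[dimX [F [FV dimF stF monoF]]]].
  have dimF k x : (k <= size w)%N -> \dim (F k x) = count_mem x (drop k w).
    move=> kw; rewrite -(subKn kw); have : (size w - k <= size w)%N by lia.
    elim: (size w - k)%N => [|n IH] nw; first by rewrite subn0 Fn dimv0 drop_size.
    have kl : (size w - n.+1 < size w)%N by lia.
    pose l := Ordinal kl; have lS : l.+1 = (size w - n)%N by rewrite /= ; lia.
    have /(quot_simpleP loopless)/(_ x) := quotF l.
    rewrite dim_sub_in ?mono // dim_subvs lS IH; last by lia.
    by rewrite (count_drop l) lS => <-.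
  split; first by move=> x; rewrite -(F0 x) dimF // drop0.
  exists (fun k => image_family iota (F k)); split.
  - by move=> k x; apply: (image_sub M).
  - by move=> k x; rewrite (image_dim M) dimF // -ltnS.
  - by move=> k; apply/(image_stable arrowP M)/sub; rewrite -ltnS.
  - move=> i j ij x; rewrite (image_subE M).
    have : (j <= size w)%N by rewrite -ltnS.
    elim: (val j) ij => [|n IH]; first by rewrite leqn0 => /eqP->.
    rewrite leq_eqVlt => /predU1P[-> //|]; rewrite ltnS => iN Nw.
    by apply: subv_trans (mono n Nw x) (IH iN (ltnW Nw)).
pose F' (k : nat) : subfamily X := preim_family iota (F (inord k)).
have imF k : image_family iota (F' k) = F (inord k).
  by apply: (model_full_sub M) => x; apply: FV.
have dimF' k x : (k <= size w)%N -> \dim (F' k x) = count_mem x (drop k w).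
  by move=> kw; rewrite -(image_dim M) imF dimF /word_dim inordK.
have monoF' k x : (k < size w)%N -> (F' k.+1 x <= F' k x)%VS.
  move=> kw; rewrite -(image_subE M) !imF; apply: monoF.
  by rewrite !inordK // ltnS // ltnW.
exists F'; split=> [k kw|x|x|k kw x|k].
- by apply/(image_stable arrowP M); rewrite imF.
- by apply/eqP; rewrite eqEdim subvf /= dimF' // drop0 dimX.
- by apply/eqP; rewrite -dimv_eq0 dimF' // drop_size.
- exact: monoF'.
- apply/(quot_simpleP loopless) => x.
  rewrite dim_sub_in ?monoF' // dim_subvs !dimF' ?(ltnW (ltn_ord k)) //.
  by rewrite -count_drop.
Qed.

End Filtrations.

(** The witness is built from [alpha] alone and is chosen before any field, which is the
    independence to be proved. *)
Lemma class_filtration alpha : exists G : seq T -> bool,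
  (forall (K : fieldType) (X : rep K Q) w, has_class X alpha -> has_filtration w X <-> G w) /\
  (forall (K : finFieldType) N (X : rep K Q) iota f V w,
     (space_bound #|class_parts alpha| <= N)%N -> models (X := X) (E := 'rV[K]_N) iota f V ->
     has_class X alpha -> (forall x, \dim {:X x} = count_mem x w) ->
     #|flags r f V (@word_dim w)| = G w %[mod #|K|]).
Proof.
have [n /(_ n (leqnn n)) runs] := runs_eq0 (class_dims_roots alpha).
pose ns := profile e (flatten (nseq n p)) (class_dims alpha).
exists (fun w => [forall x, (\sum_(B <- class_dims alpha) B x)%N == count_mem x w]
  && good_dims e ns (@word_dim w)); split=> [K X w cX|K N X iota f V w bnd M cX dimX].
  pose D := (\sum_x \dim {:X x})%N; pose N := (D + space_bound #|class_parts alpha|)%N.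
  have [|iota [f [V M]]] := @exists_row_model K X N.
    by move=> x; rewrite /N /D (bigD1 x) //= -!addnA leq_addr.
  have [W [decW dimW]] := proj1 (model_class _ M) cX.
  have bnd : root_bound y 'rV[K]_N #|class_parts alpha| by rewrite /root_bound dim_row leq_addl.
  rewrite (filtration_flag _ M).
  have -> : (exists F, is_flag r f V (@word_dim w) F) <-> good_dims e ns (@word_dim w).
    rewrite /ns -dimW; apply: (exists_flag e_sym eirr y_ok _ pE (follows_flatten n p)) => //.
      by rewrite dimW class_dims_roots.
    by rewrite dimW.
  split=> [[dimX good]|/andP[/forallP dimX good]].
    by rewrite good andbT; apply/forallP => x; rewrite -(dim_class cX) dimX.
  by split=> // x; rewrite (dim_class cX); apply/eqP.
have -> : [forall x, (\sum_(B <- class_dims alpha) B x)%N == count_mem x w].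
  by apply/forallP => x; rewrite -(dim_class cX) dimX.
have [W [decW dimW]] := proj1 (model_class _ M) cX.
rewrite /= /ns -dimW; apply: (card_flags e_sym eirr y_ok _ pE (follows_flatten n p)) => //.
- by rewrite /root_bound dim_row.
- by rewrite dimW class_dims_roots.
- by rewrite dimW.
Qed.

End Classes.

(** * Hall numbers modulo the characteristic *)

Section HallNumbers.
Variable Q : quiver.
Hypothesis dQ : dynkin Q.
Notation T := (vertex Q).
Notation e := (@adjacent Q).
Variables (y : T -> nat) (p : seq T).
Hypothesis y_ok : forall x, (hat e y x < 2 * y x)%N.
Hypothesis pE : enumerates p.
Hypothesis arrowP : forall x z, arr e p x z <-> exists a, src a = x /\ tgt a = z.
Notation r := (arr e p).

Variable G : rep_class Q -> seq T -> bool.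
Hypothesis filtrationP : forall alpha (K : fieldType) (X : rep K Q) w,
  has_class X alpha -> has_filtration w X <-> G alpha w.
Hypothesis card_flagsP : forall alpha (K : finFieldType) N (X : rep K Q) iota f V w,
  (space_bound y #|class_parts alpha| <= N)%N -> models (X := X) (E := 'rV[K]_N) iota f V ->
  has_class X alpha -> (forall x, \dim {:X x} = count_mem x w) ->
  #|flags r f V (@word_dim Q w)| = G alpha w %[mod #|K|].

Section Finite.
Variables (K : finFieldType) (N : nat).
Notation E := 'rV[K]_N.
Implicit Types (f : T -> T -> 'End(E)) (V : T -> {vspace E}).

(** The step 0 is forced to be [V], and the remaining steps have the dimensions prescribed by
    [w]. *)
Lemma card_flags_cons f V (i : T) (w : seq T) : stable r f V ->
  (forall x, \dim (V x) = count_mem x (i :: w)) ->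
  #|flags r f V (@word_dim Q (i :: w))| = #|flags r f V (@word_dim Q w)|.
Proof.
move=> stV dimV; rewrite {1}/flags.
rewrite (card_insert_ord ord0 (P := fun c : 'I_(size w).+2 -> {ffun T -> {vspace E}} =>
  `[< is_flag r f V (@word_dim Q (i :: w)) (fun k x => c k x) >])) => [|c c' cc]; last first.
  by have -> : c = c' by apply: funext.
have lastE (U : {ffun T -> {vspace E}}) (c : {ffun 'I_(size w).+1 -> {ffun T -> {vspace E}}}) :
    is_flag r f V (@word_dim Q (i :: w)) (fun k x => insert_ord ord0 U c k x) <->
    U = [ffun x => V x] /\ is_flag r f V (@word_dim Q w) (fun k x => c k x).
  split=> [[h1 h2 h3 h4]|[-> [h1 h2 h3 h4]]].
    split.
      apply/ffunP => x; rewrite ffunE; apply/eqP; rewrite eqEdim.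
      have := h1 ord0 x; have := h2 ord0 x; rewrite insert_ord_at => -> ->.
      exact: eq_leq (dimV x).
    split=> [k x|k x|k|k l kl x].
    - by have := h1 (lift ord0 k) x; rewrite insert_ord_lift.
    - by have := h2 (lift ord0 k) x; rewrite insert_ord_lift.
    - by have := h3 (lift ord0 k); rewrite insert_ord_lift.
    - by have := h4 (lift ord0 k) (lift ord0 l) kl x; rewrite !insert_ord_lift.
  split=> [k x|k x|k|k l kl x].
  - by case: (unliftP ord0 k) => [j ->|->]; rewrite ?insert_ord_lift ?insert_ord_at ?ffunE.
  - case: (unliftP ord0 k) => [j ->|->]; rewrite ?insert_ord_lift ?insert_ord_at ?ffunE ?h2 //.
  - case: (unliftP ord0 k) => [j ->|->]; rewrite ?insert_ord_lift ?insert_ord_at //.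
    by apply/stableP => x z rxz v; rewrite !ffunE; apply: (stableP _ _ _ stV).
  - case: (unliftP ord0 l) kl => [j ->|->]; case: (unliftP ord0 k) => [j' ->|->];
      rewrite ?insert_ord_lift ?insert_ord_at ?ffunE // => kl; exact: h4.
rewrite (bigD1 [ffun x => V x]) //= big1 ?addn0 => [|U UV]; last first.
  apply: eq_card0 => c; rewrite inE; apply/asboolP => /lastE[UE _].
  by rewrite UE eqxx in UV.
by apply: eq_card => c; rewrite !inE; apply/asboolP/asboolP => [/lastE[]//|h]; apply/lastE.
Qed.

Definition sub_of_dim f V (w : seq T) (U : {ffun T -> {vspace E}}) : Prop :=
  [/\ stable r f U, forall x, (U x <= V x)%VS & forall x, \dim (U x) = count_mem x w].

Lemma card_flags_partition f V (w : seq T) :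
  #|flags r f V (@word_dim Q w)|
  = (\sum_(U : {ffun T -> {vspace E}} | `[< sub_of_dim f V w U >])
       #|flags r f U (@word_dim Q w)|)%N.
Proof.
rewrite -sum1_card (partition_big
  (fun F : {ffun 'I_(size w).+1 -> {ffun T -> {vspace E}}} => F ord0)
  (fun U : {ffun T -> {vspace E}} => `[< sub_of_dim f V w U >])) /=; last first.
  move=> F; rewrite inE => /asboolP[h1 h2 h3 h4]; apply/asboolP.
  by split=> // x; rewrite h2 /word_dim drop0.
apply: eq_bigr => U /asboolP[stU UV dimU].
rewrite sum1dep_card; apply: eq_card => F; rewrite !inE.
apply/andP/asboolP => [[/asboolP[h1 h2 h3 h4] /eqP UE]|[h1 h2 h3 h4]].
  by split=> // k x; rewrite -UE; apply: h4.
split.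
  by apply/asboolP; split=> // k x; apply: subv_trans (UV x).
apply/eqP/ffunP => x; apply/eqP; rewrite eqEdim h1 dimU h2 /word_dim drop0.
by rewrite leqnn.
Qed.

End Finite.

Lemma card_class_parts (K : fieldType) (X : rep K Q) alpha : has_class X alpha ->
  (#|class_parts alpha| <= \sum_x \dim {:X x})%N.
Proof.
move=> cX; rewrite -size_class_dims.
under eq_bigr => x _ do rewrite (dim_class dQ arrowP cX).
rewrite exchange_big /= -sum1_size big_seq [leqRHS]big_seq.
apply: leq_sum => _ /mapP[t _ ->]; rewrite lt0n sum_nat_eq0; apply/negP => /forallP z.
by have /eqP := root_neq0 dQ (part_root t); apply; apply/ffunP => x; rewrite ffunE; apply/eqP/(z x).
Qed.

Definition filtered_subreps (K : finFieldType) (X : rep K Q) (i : T) (w : seq T) :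
    {set {dffun forall x, {vspace X x}}} :=
  [set U : {dffun forall x, {vspace X x}} | `[< [/\ subrep (fun x => U x),
     iso (quot (fun x => U x)) (simple_rep K i) & has_filtration w (restr (fun x => U x))] >]].

Lemma filtration_dim (K : fieldType) (X : rep K Q) w : has_filtration w X ->
  forall x, \dim {:X x} = count_mem x w.
Proof.
have [|iota [f [V M]]] := @exists_row_model Q dQ K X (\sum_x \dim {:X x}).
  by move=> x; rewrite (bigD1 x) //= leq_addr.
by move=> /(filtration_flag dQ arrowP w M)[].
Qed.

(** The flags of [X] for [i :: w] are grouped by their proper step [U] of dimension prescribed by
    [w]. The group of [U] has 1 element modulo [q] if [U] has a filtration of type [w] and 0
    otherwise, so the number of flags is congruent to the number of filtered [U]. *)
Lemma card_filtered_subreps (K : finFieldType) (X : rep K Q) gamma i w :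
  has_class X gamma -> #|filtered_subreps X i w| = G gamma (i :: w) %[mod #|K|].
Proof.
move=> cX; have loopless := dynkin_loopless dQ.
have [dimX|ndimX] := pselect (forall x, \dim {:X x} = count_mem x (i :: w)); last first.
  have -> : G gamma (i :: w) = false.
    by apply/negP => /(filtrationP (i :: w) cX)/filtration_dim/ndimX.
  congr (_ %% _)%N; apply: eq_card0 => U; rewrite inE; apply/asboolP.
  move=> [_ /(quot_simpleP loopless) q /filtration_dim fil]; apply: ndimX => x.
  by rewrite -q -dim_subvs fil /= addnC eq_sym.
(* The same ambient space must suit [X] and all its subrepresentations; each of them has at most [D]
   indecomposable summands. *)
pose D := (\sum_x \dim {:X x})%N; pose N := (D + space_bound y D)%N.
have [|iota [f [V M]]] := @exists_row_model Q dQ K X N.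
  by move=> x; rewrite /N /D (bigD1 x) //= -!addnA leq_addr.
have mono n m : (n <= m)%N -> (space_bound y n <= space_bound y m)%N.
  by move=> nm; rewrite leq_mul2l leq_mul2r nm !orbT.
have bnd : (space_bound y #|class_parts gamma| <= N)%N.
  by apply: leq_trans (leq_addl _ _); apply/mono/card_class_parts.
rewrite -(card_flagsP bnd M cX dimX) card_flags_cons; last 2 first.
- exact: (model_stable arrowP M).
- by move=> x; rewrite (model_dim M).
rewrite card_flags_partition.
pose good (U : {ffun T -> {vspace 'rV[K]_N}}) :=
  has_filtration w (restr (preim_family iota U)).
have flagsE (U : {ffun T -> {vspace 'rV[K]_N}}) : sub_of_dim f V w U ->
    #|flags r f U (@word_dim Q w)| = `[< good U >] %[mod #|K|].
  move=> [stU UV dimU]; have UE : image_family iota (preim_family iota U) = U.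
    exact: (model_full_sub M).
  have sub : subrep (preim_family iota U) by apply/(image_stable arrowP M); rewrite UE.
  have MU := model_restr M sub; rewrite UE in MU.
  have dimR x : \dim {: restr (preim_family iota U) x} = \dim (U x).
    by rewrite -(model_dim MU).
  have [beta cU] := exists_class dQ y_ok pE arrowP (restr (preim_family iota U)).
  rewrite (card_flagsP _ MU cU); last 2 first.
  - apply: leq_trans (leq_addl _ _); apply: mono; apply: leq_trans (card_class_parts cU) _.
    by apply: leq_sum => x _; rewrite dimR -(model_dim M) dimvS.
  - by move=> x; rewrite dimR.
  congr (_ %% _)%N; congr nat_of_bool; apply/idP/asboolP; last by move/(filtrationP w cU).
  by move=> ?; apply/(filtrationP w cU).
transitivity ((\sum_(U : {ffun T -> {vspace 'rV[K]_N}} | `[< sub_of_dim f V w U >])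
   `[< good U >]) %% #|K|)%N; last first.
  rewrite -modn_summ -[RHS]modn_summ; congr (_ %% _)%N.
  by apply: eq_bigr => U /asboolP/flagsE->.
congr (_ %% _)%N; rewrite -big_mkcondr /= sum1dep_card.
pose im (U : {dffun forall x, {vspace X x}}) : {ffun T -> {vspace 'rV[K]_N}} :=
  [ffun x => (iota x @: U x)%VS].
have imE (U : {dffun forall x, {vspace X x}}) :
    im U = image_family iota (fun x => U x) :> (T -> {vspace 'rV[K]_N}).
  by apply: funext => x; rewrite ffunE.
have preimE (U : {dffun forall x, {vspace X x}}) : preim_family iota (im U) = (fun x => U x).
  apply: functional_extensionality_dep => x.
  by rewrite -[RHS](image_familyK M (fun x => U x)) /preim_family ffunE.
have im_inj : injective im.
  move=> U W UW; apply/ffunP => x.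
  by have := congr1 (fun F : {ffun T -> {vspace 'rV[K]_N}} => preim_family iota F x) UW;
    rewrite !preimE.
rewrite -(card_imset _ im_inj); apply: eq_card => W; rewrite [RHS]inE.
apply/imsetP/andP => [[U]|[/asboolP[stW WV dimW] /asboolP gW]].
  rewrite inE => /asboolP[subU quotU filU] ->; split; apply/asboolP; last by rewrite /good preimE.
  split=> [|x|x].
  - by rewrite imE; apply/(image_stable arrowP M).
  - by rewrite imE; apply: (image_sub M).
  - by rewrite imE (image_dim M) -dim_subvs (filtration_dim filU).
pose U : {dffun forall x, {vspace X x}} := finfun (preim_family iota W).
have UE : (fun x => U x) = preim_family iota W.
  by apply: functional_extensionality_dep => x; rewrite ffunE.
have imW : image_family iota (preim_family iota W) = W by apply: (model_full_sub M).
exists U; last first.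
  apply/ffunP => x; have := congr1 (fun F : T -> {vspace 'rV[K]_N} => F x) (imE U).
  by rewrite UE imW => ->.
rewrite inE UE; apply/asboolP; split=> //.
  by apply/(image_stable arrowP M); rewrite imW.
apply/(quot_simpleP loopless) => x; rewrite -(image_dim M) imW dimW dimX /= addnC.
by rewrite eq_sym.
Qed.

Lemma iso_dim (K : fieldType) (X Y : rep K Q) x : iso X Y -> \dim {:X x} = \dim {:Y x}.
Proof. by move=> [phi [bij _]]; exact: bijective_dim (bij x). Qed.

Lemma iso_sym (K : fieldType) (X Y : rep K Q) : iso X Y -> iso Y X.
Proof.
have [alpha cX] := exists_class dQ y_ok pE arrowP X.
move=> XY; apply: (class_iso dQ y_ok pE arrowP _ cX).
exact: (iso_class dQ arrowP XY cX).
Qed.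

(** Every filtered [U] is counted once, in the term of its own class. *)
Lemma sum_hall_numbers (K : finFieldType) (X : rep K Q) i w
    (M : rep_class Q -> rep K Q) (bs : seq (rep_class Q)) :
  uniq bs -> (forall beta, has_class (M beta) beta) ->
  (forall beta, (beta \in bs) = G beta w) ->
  (\sum_(beta <- bs) hall_number (simple_rep K i) (M beta) X)%N = #|filtered_subreps X i w|.
Proof.
move=> ubs cM bsE.
pose P (beta : rep_class Q) (U : {dffun forall x, {vspace X x}}) :=
  `[< [/\ subrep (fun x => U x), iso (restr (fun x => U x)) (M beta)
        & iso (quot (fun x => U x)) (simple_rep K i)] >].
transitivity (\sum_(beta <- bs) \sum_(U | P beta U) 1)%N.
  by apply: eq_bigr => beta _; rewrite sum1dep_card.
rewrite big_seq (exchange_big_dep (fun U => U \in filtered_subreps X i w)) /=; last first.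
  move=> beta U; rewrite bsE => Gb /asboolP[subU isoU quotU]; rewrite inE; apply/asboolP.
  split=> //; apply/(filtrationP w _)/Gb.
  exact: (iso_class dQ arrowP (iso_sym isoU) (cM beta)).
rewrite -sum1_card; apply: eq_bigr => U; rewrite inE => /asboolP[subU quotU filU].
have [beta cU] := exists_class dQ y_ok pE arrowP (restr (fun x => U x)).
have Gb : G beta w by apply/(filtrationP w cU).
rewrite sum1_count (eq_in_count (a2 := pred1 beta)) => [|b bbs] /=.
  by rewrite count_uniq_mem // bsE Gb.
rewrite bbs /=; apply/asboolP/eqP => [[_ isoU _]|->].
  apply: (class_unique dQ y_ok pE arrowP _ cU).
  exact: (iso_class dQ arrowP (iso_sym isoU) (cM b)).
by split=> //; apply: (class_iso dQ y_ok pE arrowP cU).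
Qed.

Lemma has_class_simple (K : fieldType) i : has_class (simple_rep K i) [mset simple_root dQ i]%mset.
Proof.
have [alpha cS] := exists_class dQ y_ok pE arrowP (simple_rep K i).
have dimS x : \dim {: simple_rep K i x} = (x == i) by rewrite dimvf -[RHS]mul1n.
have dimE := dim_class dQ arrowP cS.
suff <- : alpha = [mset simple_root dQ i]%mset by [].
have size1 : (size (class_dims alpha) <= 1)%N.
  rewrite size_class_dims (leq_trans (card_class_parts cS)) //.
  under eq_bigr => x _ do rewrite dimS.
  by rewrite -big_mkcond /= sum1_card; apply/card_le1_eqP => a b /eqP-> /eqP->.
have dimsE : class_dims alpha = [:: unit_dim i].
  move: size1 dimE; case: (class_dims alpha) => [|B [|//]] _ dimE.
    by have := dimE i; rewrite big_nil dimS eqxx.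
  congr (_ :: _); apply/ffunP => x; have := dimE x.
  by rewrite big_seq1 dimS ffunE.
apply/msetP => b; rewrite -count_class_dims dimsE msetnE /= addn0.
have -> : (b == simple_root dQ i) = (unit_dim i == val b) by rewrite eq_sym -val_eqE.
by case: eqP.
Qed.

Definition class_dim (gamma : rep_class Q) (x : T) : nat := (\sum_(B <- class_dims gamma) B x)%N.

Lemma class_dim_size gamma : (size (class_dims gamma) <= \sum_x class_dim gamma x)%N.
Proof.
have [X cX] := class_realized dQ y_ok pE arrowP 'F_2 gamma.
rewrite size_class_dims (leq_trans (card_class_parts cX)) // leq_sum // => x _.
by rewrite (dim_class dQ arrowP cX).
Qed.

(** All roots in such a class have entries at most [n], and their multiplicities are at most [n] as
    well; these multiplicities, recorded by [code], determine the class. *)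
Lemma finite_class_dim (d : T -> nat) : finite_set [set gamma | forall x, class_dim gamma x = d x]%classic.
Proof.
pose n := (\sum_x d x)%N; pose box := {ffun T -> 'I_n.+1}.
pose toroot (B : box) : dim_vector Q := [ffun x => B x : nat].
pose code gamma : {ffun box -> 'I_n.+1} :=
  [ffun B => inord (count_mem (toroot B) (class_dims gamma))].
pose A := [set gamma | forall x, class_dim gamma x = d x]%classic.
pose decode (c : {ffun box -> 'I_n.+1}) : rep_class Q := 
  xget mset0 [set gamma | A gamma /\ code gamma = c]%classic.
apply: (@sub_finite_set _ _ (decode @` setT)%classic); last exact/finite_image/finite_finset.
move=> gamma Agamma; exists (code gamma) => //.
have sizeA delta : A delta -> (size (class_dims delta) <= n)%N.
  by move=> Ad; rewrite (leq_trans (class_dim_size delta)) //; apply: leq_sum => x _; rewrite Ad.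
rewrite /decode; case: xgetP => [delta _ [Adelta codeE]|/(_ gamma)]; last by case.
apply/msetP => b; rewrite -!count_class_dims.
have small eps : A eps -> val b \in class_dims eps -> forall x, (val b x < n.+1)%N.
  move=> Aeps bin x; rewrite ltnS (leq_trans _ (_ : d x <= n)%N) //; last first.
    by rewrite /n (bigD1 x) //= leq_addr.
  by rewrite -(Aeps x) /class_dim (big_rem _ bin) /= leq_addr.
have countE : (forall x, (val b x < n.+1)%N) ->
    count_mem (val b) (class_dims delta) = count_mem (val b) (class_dims gamma).
  move=> bn; pose B : box := [ffun x => Ordinal (bn x)].
  have BE : toroot B = val b by apply/ffunP => x; rewrite !ffunE.
  have /ffunP/(_ B)/(congr1 val) := codeE; rewrite !ffunE BE /= !inordK //.
    by rewrite ltnS (leq_trans (count_size _ _)) ?sizeA.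
  by rewrite ltnS (leq_trans (count_size _ _)) ?sizeA.
have [bd|/count_memPn bd] := boolP (val b \in class_dims delta); first exact/countE/small/bd.
have [bg|/count_memPn bg] := boolP (val b \in class_dims gamma); first exact/countE/small/bg.
by rewrite bd bg.
Qed.

Section HallPolynomials.
Variable f : rep_class Q -> rep_class Q -> rep_class Q -> {poly int}.
Hypothesis fP : hall_polynomials f.
Notation S i := [mset simple_root dQ i]%mset.

Lemma horner_dvd (P : {poly int}) (q : int) : (q %| P.[q] - P.[0])%Z.
Proof.
elim/poly_ind: P => [|P c _]; first by rewrite !horner0 subrr dvdz0.
by rewrite !hornerMXaddC mulr0 add0r addrK dvdz_mull.
Qed.

Lemma prime_dvd_eq0 (a : int) : (forall q, prime q -> (q%:Z %| a)%Z) -> a = 0.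
Proof.
move=> h; have [q aq pq] := prime_above `|a|; have := h q pq.
rewrite dvdzE /= => /dvdn_leq; case: (posnP `|a|) => [a0 _|a0 /(_ isT)]; lia.
Qed.

(** The left side is the coefficient of [gamma] in the product of the basis element of the simple at
    [i] with the sum of all classes having a filtration of type [w]. *)
Lemma sum_hall_coef gamma i w (bs : seq (rep_class Q)) : uniq bs ->
  (forall beta, (beta \in bs) = G beta w) ->
  \sum_(beta <- bs) (f (S i) beta gamma).[0] = (G gamma (i :: w))%:Z.
Proof.
move=> ubs bsE; apply/eqP; rewrite -subr_eq0; apply/eqP/prime_dvd_eq0 => q pq.
have [M cM] := choice (class_realized dQ y_ok pE arrowP 'F_q).
have [X cX] := class_realized dQ y_ok pE arrowP 'F_q gamma.
have sumE : \sum_(beta <- bs) (f (S i) beta gamma).[q%:Z]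
    = #|filtered_subreps X i w|%:Z.
  rewrite -(sum_hall_numbers X i ubs cM bsE) -[RHS]natz natr_sum; apply: eq_bigr => beta _.
  by have := fP (has_class_simple _ i) (cM beta) cX; rewrite card_Fp // => <-; rewrite natz.
have d1 : (q%:Z %| \sum_(beta <- bs) (f (S i) beta gamma).[q%:Z]
    - \sum_(beta <- bs) (f (S i) beta gamma).[0])%Z.
  by rewrite -sumrB; apply: rpred_sum => beta _; apply: horner_dvd.
have d2 : (q%:Z %| #|filtered_subreps X i w|%:Z - (G gamma (i :: w))%:Z)%Z.
  rewrite -eqz_mod_dvd !modz_nat; have := card_filtered_subreps i w cX.
  by rewrite card_Fp // => ->.
rewrite sumE in d1; set A := _%:Z in d1 d2; set B := \sum_(_ <- _) _ in d1 *.
have -> : B - (G gamma (i :: w))%:Z = (A - (G gamma (i :: w))%:Z) - (A - B) by ring.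
exact: rpredB.
Qed.

(** For other dimensions the Hall numbers over all prime fields vanish, so the constant term is
    divisible by every prime. *)
Lemma hall_coef_dim gamma beta i : (f (S i) beta gamma).[0] != 0 ->
  forall x, class_dim gamma x = (class_dim beta x + (x == i))%N.
Proof.
move=> f0; apply: contrapT => ndim; case/eqP: f0; apply: prime_dvd_eq0 => q pq.
have [N cN] := class_realized dQ y_ok pE arrowP 'F_q beta.
have [X cX] := class_realized dQ y_ok pE arrowP 'F_q gamma.
have := horner_dvd (f (S i) beta gamma) q%:Z.
have := fP (has_class_simple _ i) cN cX; rewrite card_Fp // => <-.
have -> : hall_number (simple_rep 'F_q i) N X = 0%N.
  apply: eq_card0 => U; rewrite inE; apply/asboolP => -[_ isoU quotU]; apply: ndim => x.
  have /(quot_simpleP (dynkin_loopless dQ))/(_ x) := quotU.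
  rewrite -dim_subvs [\dim {: subvs_of _}](iso_dim x isoU).
  by rewrite (dim_class dQ arrowP cX) (dim_class dQ arrowP cN).
by rewrite sub0r rpredN.
Qed.

Notation classes w := [set gamma | G gamma w]%classic.

Lemma classes_dim w gamma : G gamma w -> forall x, class_dim gamma x = count_mem x w.
Proof.
move=> Gg x; have [X cX] := class_realized dQ y_ok pE arrowP 'F_2 gamma.
by rewrite /class_dim -(dim_class dQ arrowP cX) (filtration_dim (proj2 (filtrationP w cX) Gg)).
Qed.

Lemma finite_classes w : finite_set (classes w).
Proof.
by apply: (sub_finite_set _ (finite_class_dim (fun x => count_mem x w))) => gamma /= /classes_dim.
Qed.

Lemma class_dims0 : class_dims (mset0 : rep_class Q) = [::].
Proof.
case E1 : (class_dims mset0) => [//|B bs].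
have : B \in class_dims (mset0 : rep_class Q) by rewrite E1 mem_head.
case/mapP => t _ BE; have := count_class_dims mset0 (part_root t).
by rewrite -BE E1 /= eqxx mset0E.
Qed.

Lemma classes_nil gamma : G gamma [::] <-> gamma = mset0.
Proof.
split=> [Gg|->].
  apply: class_dims_inj; rewrite class_dims0; have := class_dim_size gamma.
  rewrite big1 => [|x _]; last by rewrite (classes_dim Gg).
  by rewrite leqn0 size_eq0 => /eqP->.
have [X cX] := class_realized dQ y_ok pE arrowP 'F_2 mset0.
have X0 x : 0%VS = {:X x}%VS.
  by apply/esym/eqP; rewrite -dimv_eq0 (dim_class dQ arrowP cX) class_dims0 big_nil.
apply/(filtrationP [::] cX); exists (fun _ _ => 0%VS); split=> //.
- by move=> k _ a; rewrite limg0 sub0v.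
- by case.
Qed.

(** The finite range of summation does not depend on [beta], so that the sums over [beta] and
    [gamma] can be exchanged in [word0E]. *)
Lemma basis_mul_simple i beta w : G beta w ->
  basis_mul0 f (S i) beta
  = \sum_(gamma <- fset_set [set gamma | forall x, class_dim gamma x = count_mem x (i :: w)]%classic)
      (f (S i) beta gamma).[0]%:~R *: basis0 gamma.
Proof.
move=> Gb; rewrite /basis_mul0; apply: fsbigTE => gamma.
apply: contraNeq => nz; rewrite in_fset_set; last exact: finite_class_dim.
apply/mem_set => x /=; rewrite (@hall_coef_dim gamma beta i).
  by rewrite (classes_dim Gb) addnC eq_sym.
by apply: contraNneq nz => ->; rewrite scale0r.
Qed.

Definition class_sum (A : {fset rep_class Q}) : hall0 Q := \sum_(gamma <- A) basis0 gamma.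

Lemma mcoeff_basis (gamma beta : rep_class Q) : (basis0 gamma)@_beta = (gamma == beta)%:R.
Proof. exact: mcoeffU. Qed.

Lemma mcoeff_class_sum A beta : (class_sum A)@_beta = (beta \in A)%:R.
Proof.
have -> : (class_sum A)@_beta = \sum_(gamma <- A) (gamma == beta)%:R :> rat.
  by rewrite raddf_sum; apply: eq_bigr => gamma _; exact: mcoeff_basis.
rewrite -natr_sum; congr (_%:R); rewrite -count_uniq_mem ?fset_uniq // -sum1_count.
by rewrite [RHS]big_mkcond /=; apply: eq_bigr => gamma _; case: (gamma == beta).
Qed.

Lemma msupp_class_sum A : msupp (class_sum A) = A.
Proof.
apply/fsetP => beta; rewrite -mcoeff_neq0 mcoeff_class_sum.
by case: (beta \in A); rewrite ?oner_eq0 ?eqxx.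
Qed.

Lemma word0E w : word0 f dQ w = class_sum (fset_set (classes w)).
Proof.
elim: w => [|i w IH].
  have -> : classes [::] = [set mset0]%classic by apply/seteqP; split=> gamma /classes_nil.
  by rewrite fset_set1 /class_sum big_seq_fset1.
rewrite /= IH /mul0 msupp_class_sum {1}/basis0 msuppU oner_eq0 big_seq_fset1.
set D := fset_set [set gamma | forall x, class_dim gamma x = count_mem x (i :: w)]%classic.
have inw beta : (beta \in fset_set (classes w)) = G beta w.
  by rewrite in_fset_set ?in_setE; [apply/idP/idP => [/set_mem|/mem_set] | exact: finite_classes].
transitivity (\sum_(beta <- fset_set (classes w)) \sum_(gamma <- D)
    (f (S i) beta gamma).[0]%:~R *: basis0 gamma : hall0 Q).
  rewrite big_seq [RHS]big_seq; apply: eq_bigr => beta bw.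
  by rewrite mcoeff_class_sum bw mcoeffUU mulr1 scale1r (@basis_mul_simple i beta w) -?inw.
rewrite exchange_big /= /class_sum.
transitivity (\sum_(gamma <- D) (G gamma (i :: w))%:R *: basis0 gamma : hall0 Q).
  apply: eq_bigr => gamma _.
  have <- : \sum_(beta <- fset_set (classes w)) (f (S i) beta gamma).[0]%:~R
      = (G gamma (i :: w))%:R :> rat.
    transitivity ((\sum_(beta <- fset_set (classes w)) (f (S i) beta gamma).[0])%:~R : rat).
      exact/esym/(rmorph_sum (intr : int -> rat)).
    by rewrite (sum_hall_coef gamma i (fset_uniq _) inw); case: (G _ _).
  exact/esym/scaler_suml.
rewrite (bigID (fun gamma => G gamma (i :: w))) /= [X in _ + X]big1 ?addr0; last first.
  by move=> gamma /negbTE->; rewrite scale0r.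
rewrite (eq_bigr (fun gamma => basis0 gamma)) => [|gamma ->]; last by rewrite scale1r.
rewrite -big_filter; apply: perm_big; apply: uniq_perm => [||gamma].
- by rewrite filter_uniq // fset_uniq.
- exact: fset_uniq.
rewrite mem_filter !in_fset_set; [|exact: finite_classes | exact: finite_class_dim].
apply/andP/idP => [[Gg _]|/set_mem Gg]; first exact/mem_set.
by split=> //; apply/mem_set => x; apply: classes_dim.
Qed.

Lemma word0_sum w : word0 f dQ w = \sum_(gamma \in classes w) basis0 gamma.
Proof.
rewrite word0E /class_sum fsbig_seq; last exact: fset_uniq.
by rewrite fset_setK //; exact: finite_classes.
Qed.

End HallPolynomials.

End HallNumbers.

Theorem proposition6p23 (Q : quiver) (dQ : dynkin Q) (w : seq (vertex Q)) :
  (forall (K L : fieldType) (X : rep K Q) (Y : rep L Q) (alpha : rep_class Q),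
     has_class X alpha -> has_class Y alpha ->
     (has_filtration w X <-> has_filtration w Y)) /\
  (forall f : rep_class Q -> rep_class Q -> rep_class Q -> {poly int},
     hall_polynomials f ->
     forall K : fieldType,
       word0 f dQ w = \sum_(gamma \in filtered_classes K w) basis0 gamma).
Proof.
have [y y_ok] := dynkin_certificate dQ.
have [p [pE arrowP]] := exists_order dQ.
have [G GP] := choice (class_filtration dQ y_ok pE arrowP).
have filP alpha (K : fieldType) (X : rep K Q) v : has_class X alpha ->
    has_filtration v X <-> G alpha v by have [h _] := GP alpha; apply: h.
split=> [K L X Y alpha cX cY|f fP K]; first by rewrite (filP _ _ _ _ cX) (filP _ _ _ _ cY).
rewrite (word0_sum dQ y_ok pE arrowP filP) //; last first.
  by move=> alpha K' N X iota f' V v; have [_ h] := GP alpha; apply: h.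
congr (\sum_(gamma \in _) _); apply/seteqP; split=> gamma /=.
  (* Membership in [filtered_classes K w] asks for a representation over [K], which exists for every
     class. *)
  move=> Gg; have [X cX] := class_realized dQ y_ok pE arrowP K gamma.
  by exists X; split=> //; apply/(filP _ _ _ _ cX).
by move=> [X [cX filX]]; apply/(filP _ _ _ _ cX).
Qed.
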